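(* Let $G$ be an entire function and let $A$ be the operator $f\mapsto Gf'$ on $\mathcal{F}^2$. Then $A$ is the generator of an analytic semigroup of operators on $\mathcal{F}^2$ if and only if there exists $\theta\in(0,\pi/2)$ such that $$\limsup_{|z|\to\infty}\operatorname{Re}\big(e^{\pm i\theta}\,\overline{z}\,G(z)\big)\le 0$$ (for both choices of sign). In this case, the semigroup consists of composition operators and is quasicontractive.
   Context: $\mathcal{F}^2$ is the Hilbert space of entire functions $f$ with $\|f\|_2^2=\frac{1}{\pi}\int_{\mathbb{C}}|f(z)|^2e^{-|z|^2}\,dm(z)<\infty$. For $0<\theta<\pi/2$, $\Sigma_\theta=\{re^{i\alpha}:r>0,|\alpha|<\theta\}$. An analytic semigroup is one given by an analytic map $\xi\mapsto T_\xi$ from some $\Sigma_\theta$ to the bounded operators, satisfying $T_{\xi+\eta}=T_\xi T_\eta$, strongly continuous at $0$ with $T_0=I$, and $\sup_{\xi\in\Sigma_\theta,|\xi|<1}\|T_\xi\|<\infty$; its generator is $Ax=\lim_{t\to0^+}(T_tx-x)/t$. A semigroup is quasicontractive if $\|T_t\|\le e^{\omega t}$ for all $t\ge0$ for some $\omega\in\mathbb{R}$. A composition operator is $f\mapsto f\circ\phi$ with $\phi$ entire. *)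

(* Defs.v *)
From Stdlib Require Import Reals.
From Coquelicot Require Import Coquelicot.
From mathcomp Require Import all_boot all_algebra.
From mathcomp Require Import all_classical all_reals all_analysis.
From mathcomp Require Import Rstruct Rstruct_topology.

Set Implicit Arguments.
Unset Strict Implicit.

Definition is_cderiv (f : C -> C) (z l : C) : Prop :=
  @Coquelicot.Derive.is_derive C_AbsRing C_NormedModule f z l.

Definition entire (f : C -> C) : Prop := forall z : C, exists l : C, is_cderiv f z l.

Definition leb2 := ((@lebesgue_measure R) \x (@lebesgue_measure R))%E.

Definition fock_integral (f : C -> C) : \bar R :=
  (\int[leb2]_(p in setT)
      (Rmult (pow (Cmod (f p)) 2) (exp (Ropp (pow (Cmod p) 2))))%:E)%E.

Definition Fock (f : C -> C) : Prop := entire f /\ (fock_integral f < +oo)%E.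

Definition fnorm (f : C -> C) : R := sqrt (Rdiv (fine (fock_integral f)) PI).

Local Open Scope R_scope.

(* (a priori arbitrary) maps on functions C -> C; operators on F^2 are
   considered through their action on elements of F^2 *)
Definition op := (C -> C) -> (C -> C).

Definition bounded_op (T : op) : Prop :=
  (forall f, Fock f -> Fock (T f)) /\
  (forall f g, Fock f -> Fock g ->
     T (fun z => Cplus (f z) (g z)) = (fun z => Cplus (T f z) (T g z))) /\
  (forall (a : C) f, Fock f ->
     T (fun z => Cmult a (f z)) = (fun z => Cmult a (T f z))) /\
  (exists M : R, forall f, Fock f -> fnorm (T f) <= M * fnorm f).

Definition sector (theta : R) (xi : C) : Prop :=
  exists r alpha : R, 0 < r /\ Rabs alpha < theta /\
    xi = (Rmult r (Rtrigo_def.cos alpha), Rmult r (Rtrigo_def.sin alpha)).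

(* xi |-> T xi is analytic from Sigma_theta into the bounded operators on
   F^2: complex differentiability in operator norm, written out *)
Definition op_analytic (theta : R) (T : C -> op) : Prop :=
  forall xi, sector theta xi ->
    exists D : op, bounded_op D /\
      forall eps : R, 0 < eps -> exists delta : R, 0 < delta /\
        forall h : C, h <> RtoC 0 -> Cmod h < delta -> sector theta (Cplus xi h) ->
          forall f, Fock f ->
            fnorm (fun z => Cminus (Cdiv (Cminus (T (Cplus xi h) f z) (T xi f z)) h)
                                   (D f z))
              <= eps * fnorm f.

Definition analytic_semigroup (theta : R) (T : C -> op) : Prop :=
  0 < theta < PI / 2 /\
  (forall xi, sector theta xi -> bounded_op (T xi)) /\
  op_analytic theta T /\
  (forall xi eta, sector theta xi -> sector theta eta ->
     forall f, Fock f -> T (Cplus xi eta) f = T xi (T eta f)) /\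
  (forall f, Fock f -> T (RtoC 0) f = f) /\
  (forall f, Fock f -> forall eps : R, 0 < eps ->
     exists delta : R, 0 < delta /\
       forall xi, sector theta xi -> Cmod xi < delta ->
         fnorm (fun z => Cminus (T xi f z) (f z)) <= eps) /\
  (exists M : R, forall xi, sector theta xi -> Cmod xi < 1 ->
     forall f, Fock f -> fnorm (T xi f) <= M * fnorm f).

(* "A : f |-> G f' is the generator of T": the generator
   A x = lim_{t->0+} (T_t x - x)/t (limit in F^2, domain = where it exists)
   coincides with f |-> G f' on its maximal domain {f in F^2 : G f' in F^2}:
   for f, g in F^2, (T_t f - f)/t -> g in F^2 as t -> 0+  iff  g = G f'. *)
Definition generated_by (T : C -> op) (G : C -> C) : Prop :=
  forall f g, Fock f -> Fock g ->
    ((forall eps : R, 0 < eps -> exists delta : R, 0 < delta /\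
        forall t : R, 0 < t < delta ->
          fnorm (fun z => Cminus (Cdiv (Cminus (T (RtoC t) f z) (f z)) (RtoC t))
                                 (g z)) <= eps)
     <->
     (forall z, exists l, is_cderiv f z l /\ g z = Cmult (G z) l)).

Definition limsup_cond (G : C -> C) (theta s : R) : Prop :=
  forall eps : R, 0 < eps -> exists R0 : R, forall z : C, R0 < Cmod z ->
    Re (Cmult (Cmult (Rtrigo_def.cos (Rmult s theta), Rtrigo_def.sin (Rmult s theta)) (Cconj z)) (G z)) <= eps.

Definition composition_semigroup (theta : R) (T : C -> op) : Prop :=
  forall xi, (xi = RtoC 0 \/ sector theta xi) ->
    exists phi : C -> C, entire phi /\
      forall f, Fock f -> T xi f = (fun z => f (phi z)).

Definition quasicontractive (T : C -> op) : Prop :=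
  exists omega : R, forall t : R, 0 <= t ->
    forall f, Fock f -> fnorm (T (RtoC t) f) <= exp (Rmult omega t) * fnorm f.

(* Main.v *)
(** If [A] generates an analytic semigroup [T], then [w t z = T_t f z - f (T_t id z)] solves the
    transport equation [dw/dt = G dw/dz] with zero initial value; Cauchy's estimates on shrinking discs
    force [w = 0] for small [t], so [T_t] is composition with the entire function [T_t id]. Testing
    boundedness on the kernels [exp (z conj w)] gives [|T_t id z|^2 <= |z|^2 + K], so by Liouville
    [T_t id], and with it [G z = a z + b], is affine, and [T] is composition with the complex-time flow
    of [G]. Since the linear part of the flow contracts on a whole sector, [Re a < 0] or [a = b = 0].
    The limsup condition is equivalent to the same alternative: it bounds [Re (conj z G z)] from
    above, hence also the real part of the entire function [(G z - G 0) / z], which is therefore constant.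
    Conversely, under this alternative the flow satisfies [|phi_xi z|^2 <= |z|^2 + K |xi|] on some
    sector, and an affine change of variables bounds the composition operators by [exp (om |xi|)].
    Strong continuity follows from the parallelogram law and Fatou's lemma; analyticity and the form of
    the generator follow from Cauchy's formula and the fundamental theorem of calculus in the time
    variable, through Minkowski's inequality for integrals. *)

Require Import Defs.
From Stdlib Require Import Reals Lra Lia Classical IndefiniteDescription FunctionalExtensionality.
From Coquelicot Require Import Coquelicot.
From mathcomp Require Import ssreflect ssrfun ssrbool.
From mathcomp Require all_boot all_order all_algebra ring lra.
From mathcomp Require all_classical all_reals all_analysis measurable_realfun Rstruct Rstruct_topology.

Local Open Scope R_scope.

(** * Complex derivatives and the exponential *)

(** Two gaps shape the argument. The generator is given only by real increments at time 0 on pairs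
    of elements of the space, so the transport equation is available for [t > 0] only: analyticity
    supplies a derivative there, and the semigroup law identifies it with [G] times the space
    derivative of [T_t f]. The initial value has to be recovered as a limit, by strong continuity.
    Moreover [G] is a priori an arbitrary entire function without a global flow, so the equation
    cannot be solved by characteristics; this is why [T_t f] is compared with the second solution
    [f (T_t id)] through Cauchy's estimates. Characteristics become available once [G] is affine,
    and they then determine [T] on the whole sector. On the Hilbert side there is neither an inner
    product nor a vector-valued integral: norm inequalities are integrated inequalities between
    squared moduli, averages are limits of Riemann sums, and the bound of [|f z|] by a multiple of
    [exp (|z|^2 / 2)] times the norm turns norm limits into locally uniform ones. The angle of the
    sector and the angle of the limsup condition are not matched; they are linked only through the
    alternative on [a] and [b]. *)

Definition cdiff (f : C -> C) (z l : C) : Prop :=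
  forall eps, 0 < eps -> exists d, 0 < d /\ forall h, Cmod h < d ->
    Cmod (f (z + h) - f z - l * h)%C <= eps * Cmod h.

Lemma is_cderivP f z l : is_cderiv f z l <-> cdiff f z l.
Proof.
split.
- case=> _ H e He.
  have {H} H := H z (fun P HP => HP) (mkposreal e He).
  case: H => d /= H.
  exists d; split; first exact: cond_pos.
  move=> h Hh.
  have Hb : @ball (AbsRing_UniformSpace C_AbsRing) z d (z + h)%C.
    rewrite /ball /= /AbsRing_ball /abs /= /minus /plus /opp /=.
    by replace ((z + h + - z)%C) with h by ring.
  have := H _ Hb.
  rewrite /norm /= /abs /minus /plus /opp /scal /= /mult /=.
  replace (f (z + h) + - f z + - ((z + h + - z) * l))%C with (f (z + h) - f z - l * h)%C by ring.
  by replace ((z + h + - z)%C) with h by ring.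
- move=> H; split.
  + split.
    * by move=> x y; rewrite /scal /plus /= /mult /=; ring.
    * by move=> k x; rewrite /scal /plus /= /mult /=; ring.
    * exists (Cmod l + 1); split.
        by have := Cmod_ge_0 l; lra.
      move=> x; rewrite /norm /= /scal /= /mult /= /abs /= Cmod_mult.
      by have := Cmod_ge_0 x; nra.
  + move=> x Hx e.
    have <- : z = x.
      apply: (@is_filter_lim_locally_unique C_AbsRing (AbsRing_NormedModule C_AbsRing)).
      exact: Hx.
    case: (H e (cond_pos e)) => d [Hd Hd'].
    exists (mkposreal d Hd); change (forall y : C, @ball (AbsRing_UniformSpace C_AbsRing) z d y -> norm (minus (minus (f y) (f z)) (scal (minus y z) l)) <= e * norm (minus y z))=> y.
    rewrite /ball /= /AbsRing_ball /abs /= /minus /plus /opp /= => Hy.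
    have := Hd' _ Hy.
    rewrite /norm /= /abs /minus /plus /opp /scal /= /mult /=.
    replace (z + (y + - z))%C with y by ring.
    by replace (f y + - f z + - ((y + - z) * l))%C with (f y - f z - l * (y + - z))%C by ring.
Qed.

Definition ccont (f : C -> C) (z : C) : Prop :=
  forall eps, 0 < eps -> exists d, 0 < d /\ forall h, Cmod h < d ->
    Cmod (f (z + h) - f z)%C < eps.

Lemma Cmod_minus_sym a b : Cmod (a - b)%C = Cmod (b - a)%C.
Proof. by rewrite -(Cmod_opp (b - a)%C); congr Cmod; ring. Qed.

Lemma Cmod_le_plus a b : Cmod a <= Cmod b + Cmod (a - b)%C.
Proof. by have := Cmod_triangle b (a - b)%C; replace (b + (a - b))%C with a by ring. Qed.

Lemma ccont_const c z : ccont (fun=> c) z.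
Proof.
move=> e He; exists 1; split; first lra.
by move=> h _; replace (c - c)%C with (RtoC 0) by ring; rewrite Cmod_0.
Qed.

Lemma ccont_id z : ccont (fun w => w) z.
Proof.
by move=> e He; exists e; split=> // h; replace (z + h - z)%C with h by ring.
Qed.

Lemma ccont_plus f g z : ccont f z -> ccont g z -> ccont (fun w => (f w + g w)%C) z.
Proof.
move=> Hf Hg e He.
have [d1 [Hd1 H1]] := Hf (e / 2) ltac:(lra).
have [d2 [Hd2 H2]] := Hg (e / 2) ltac:(lra).
exists (Rmin d1 d2); split; first exact: Rmin_pos.
move=> h Hh.
have [/H1 h1 /H2 h2] := Rmin_Rgt_l _ _ _ Hh.
replace (f (z + h) + g (z + h) - (f z + g z))%C with
  ((f (z + h) - f z) + (g (z + h) - g z))%C by ring.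
have := Cmod_triangle (f (z + h)%C - f z)%C (g (z + h)%C - g z)%C; lra.
Qed.

Lemma ccont_mult f g z : ccont f z -> ccont g z -> ccont (fun w => (f w * g w)%C) z.
Proof.
move=> Hf Hg e He.
have pf := Cmod_ge_0 (f z); have pg := Cmod_ge_0 (g z).
set k := Rmin 1 (e / (Cmod (f z) + Cmod (g z) + 1)).
have Hk : 0 < k by apply: Rmin_pos; [lra|apply: Rdiv_lt_0_compat; lra].
have Hk1 : k <= 1 by exact: Rmin_l.
have Hk2 : k * (Cmod (f z) + Cmod (g z) + 1) <= e.
  have : k <= e / (Cmod (f z) + Cmod (g z) + 1) by exact: Rmin_r.
  move/(Rmult_le_compat_r (Cmod (f z) + Cmod (g z) + 1)).
  have -> : e / (Cmod (f z) + Cmod (g z) + 1) * (Cmod (f z) + Cmod (g z) + 1) = e by field; lra.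
  by apply; lra.
have [d1 [Hd1 H1]] := Hf k Hk.
have [d2 [Hd2 H2]] := Hg k Hk.
exists (Rmin d1 d2); split; first exact: Rmin_pos.
move=> h Hh.
have [/H1 h1 /H2 h2] := Rmin_Rgt_l _ _ _ Hh.
replace (f (z + h) * g (z + h) - (f z * g z))%C with
  ((f (z + h) - f z) * (g (z + h) - g z) + f z * (g (z + h) - g z) +
   g z * (f (z + h) - f z))%C by ring.
have := Cmod_triangle ((f (z + h) - f z) * (g (z + h) - g z) + f z * (g (z + h) - g z))%C (g z * (f (z + h) - f z))%C.
have := Cmod_triangle ((f (z + h) - f z) * (g (z + h) - g z))%C (f z * (g (z + h) - g z))%C.
rewrite !Cmod_mult.
have := Cmod_ge_0 (f (z + h) - f z)%C; have := Cmod_ge_0 (g (z + h) - g z)%C.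
move: (Cmod (f (z + h) - f z)%C) (Cmod (g (z + h) - g z)%C) h1 h2 => x y *.
nra.
Qed.

Lemma ccont_comp f g z : ccont g z -> ccont f (g z) -> ccont (fun w => f (g w)) z.
Proof.
move=> Hg Hf e He.
have [d [Hd H]] := Hf e He.
have [d2 [Hd2 H2]] := Hg d Hd.
exists d2; split=> // h Hh.
have := H _ (H2 h Hh).
by replace (g z + (g (z + h) - g z))%C with (g (z + h)%C) by ring.
Qed.

(** Carathéodory's form of the derivative: with a slope function continuous at [z], the product and
    chain rules reduce to algebra and continuity, without quotients. *)
Lemma cdiff_slope f z l :
  cdiff f z l <-> exists q : C -> C, (forall w, f w = f z + q w * (w - z))%C /\ q z = l /\ ccont q z.
Proof.
split.
- move=> H.
  exists (fun w => if Ceq_dec w z then l else ((f w - f z) / (w - z))%C); split; last split.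
  + move=> w; case: Ceq_dec => [E|Hw] /=; first by rewrite E; ring.
    by field; apply: Cminus_eq_contra.
  + by case: Ceq_dec.
  + move=> e He.
    have [d [Hd Hd']] := H (e / 2) ltac:(lra).
    exists d; split=> // h Hh.
    have := Hd' h Hh.
    have -> : (if Ceq_dec z z then l else ((f z - f z) / (z - z))%C) = l by case: Ceq_dec.
    case: Ceq_dec => [_|Hz] /=.
      by replace (l - l)%C with (RtoC 0) by ring; rewrite Cmod_0.
    have Hh0 : h <> RtoC 0 by move=> E; apply: Hz; rewrite E Cplus_0_r.
    have -> : ((f (z + h) - f z) / (z + h - z) - l)%C = ((f (z + h) - f z - l * h) / h)%C.
      by replace (z + h - z)%C with h by ring; field.
    rewrite Cmod_div //.
    have ph : 0 < Cmod h by apply/Cmod_gt_0.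
    move=> Hle; apply: (Rle_lt_trans _ (e / 2)); last lra.
    apply: (Rmult_le_reg_r (Cmod h)) => //.
    by rewrite /Rdiv Rmult_assoc Rinv_l; lra.
- case=> q [Hq [Hl Hc]] e He.
  have [d [Hd Hd']] := Hc e He.
  exists d; split=> // h Hh.
  rewrite (Hq (z + h)%C) -Hl.
  replace (f z + q (z + h) * (z + h - z) - f z - q z * h)%C with ((q (z + h) - q z) * h)%C by ring.
  rewrite Cmod_mult.
  by have := Hd' h Hh; have := Cmod_ge_0 h; nra.
Qed.

Lemma cdiff_ext f g z l : (forall w, f w = g w) -> cdiff f z l -> cdiff g z l.
Proof. by move=> H; rewrite (functional_extensionality f g H). Qed.

Lemma cdiff_ext_loc f g z l r : 0 < r -> (forall w, Cmod (w - z)%C < r -> f w = g w) ->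
  cdiff f z l -> cdiff g z l.
Proof.
move=> Hr H Hf e He.
have [d [Hd Hd']] := Hf e He.
exists (Rmin d r); split; first exact: Rmin_pos.
move=> h Hh.
have := Hd' h (Rlt_le_trans _ _ _ Hh (Rmin_l _ _)).
rewrite !H //; first by replace (z - z)%C with (RtoC 0) by ring; rewrite Cmod_0.
by replace (z + h - z)%C with h by ring; apply: Rlt_le_trans Hh (Rmin_r _ _).
Qed.

Lemma cdiff_cont f z l : cdiff f z l -> ccont f z.
Proof.
case/cdiff_slope=> q [Hq [_ Hc]].
rewrite (functional_extensionality _ _ Hq).
apply: ccont_plus; first exact: ccont_const.
apply: ccont_mult => //.
by apply: (ccont_plus (fun w => w) (fun w => (- z)%C)); [exact: ccont_id|exact: ccont_const].
Qed.

Lemma cdiff_const c z : cdiff (fun=> c) z (RtoC 0).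
Proof.
move=> e He; exists 1; split; first lra.
move=> h _; replace (c - c - 0 * h)%C with (RtoC 0) by ring; rewrite Cmod_0.
by have := Cmod_ge_0 h; nra.
Qed.

Lemma cdiff_id z : cdiff (fun w => w) z (RtoC 1).
Proof.
move=> e He; exists 1; split; first lra.
move=> h _; replace (z + h - z - 1 * h)%C with (RtoC 0) by ring; rewrite Cmod_0.
by have := Cmod_ge_0 h; nra.
Qed.

Lemma cdiff_plus f g z l m :
  cdiff f z l -> cdiff g z m -> cdiff (fun w => f w + g w)%C z (l + m)%C.
Proof.
move=> /cdiff_slope[q [Hq [<- Hc]]] /cdiff_slope[p [Hp [<- Hd]]].
apply/cdiff_slope; exists (fun w => q w + p w)%C; split; last split => //.
  by move=> w; rewrite Hq Hp; ring.
exact: ccont_plus.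
Qed.

Lemma cdiff_mult f g z l m :
  cdiff f z l -> cdiff g z m -> cdiff (fun w => f w * g w)%C z (l * g z + f z * m)%C.
Proof.
move=> Hf Hg; have Hgc := cdiff_cont _ _ _ Hg.
move: Hf Hg => /cdiff_slope[q [Hq [<- Hc]]] /cdiff_slope[p [Hp [<- Hd]]].
apply/cdiff_slope; exists (fun w => q w * g w + f z * p w)%C; split; last split => //.
  by move=> w; rewrite Hq Hp; ring.
by apply: ccont_plus; apply: ccont_mult => //; exact: ccont_const.
Qed.

Lemma cdiff_scal c f z l : cdiff f z l -> cdiff (fun w => c * f w)%C z (c * l)%C.
Proof.
move=> H; have := cdiff_mult _ _ _ _ _ (cdiff_const c z) H.
by replace (0 * f z + c * l)%C with (c * l)%C by ring.
Qed.

Lemma cdiff_minus f g z l m :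
  cdiff f z l -> cdiff g z m -> cdiff (fun w => f w - g w)%C z (l - m)%C.
Proof.
move=> Hf Hg; have := cdiff_plus _ _ _ _ _ Hf (cdiff_scal (- (1))%C _ _ _ Hg).
replace (l + - (1) * m)%C with (l - m)%C by ring.
by apply: cdiff_ext => w; ring.
Qed.

Lemma cdiff_comp f g z l m :
  cdiff f (g z) l -> cdiff g z m -> cdiff (fun w => f (g w)) z (l * m)%C.
Proof.
move=> Hf Hg; have Hgc := cdiff_cont _ _ _ Hg.
move: Hf Hg => /cdiff_slope[q [Hq [<- Hc]]] /cdiff_slope[p [Hp [<- Hd]]].
apply/cdiff_slope; exists (fun w => q (g w) * p w)%C; split; last split => //.
  move=> w; rewrite (Hq (g w)).
  have -> : (g w - g z)%C = (p w * (w - z))%C by rewrite (Hp w); ring.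
  by ring.
by apply: ccont_mult => //; apply: ccont_comp.
Qed.

Lemma cdiff_unique f z l m : cdiff f z l -> cdiff f z m -> l = m.
Proof. by move=> /is_cderivP/is_C_derive_unique <- /is_cderivP/is_C_derive_unique. Qed.

Lemma cdiff_inv z : z <> RtoC 0 -> cdiff Cinv z (- (/ z * / z))%C.
Proof.
move=> Hz e He.
have pz : 0 < Cmod z by apply/Cmod_gt_0.
exists (Rmin (Cmod z / 2) (e * (Cmod z) ^ 3 / 2)); split.
  by apply: Rmin_pos; [lra|]; have := pow_lt _ 3 pz; nra.
move=> h Hh.
have [Hh1 Hh2] := Rmin_Rgt_l _ _ _ Hh.
have Hzh : Cmod z / 2 <= Cmod (z + h)%C.
  have := Cmod_le_plus z (z + h)%C.
  replace (z - (z + h))%C with (- h)%C by ring; rewrite Cmod_opp; lra.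
have Hn : (z + h)%C <> RtoC 0 by apply/Cmod_gt_0; lra.
have -> : (/ (z + h) - / z - - (/ z * / z) * h)%C = (h * h * / (z * z * (z + h)))%C by field.
rewrite !Cmod_mult Cmod_inv; last by repeat apply: Cmult_neq_0.
rewrite !Cmod_mult.
have p3 := pow_lt _ 3 pz.
have H3 : Cmod z ^ 3 / 2 <= Cmod z * Cmod z * Cmod (z + h)%C by simpl; nra.
have H4 : / (Cmod z * Cmod z * Cmod (z + h)%C) <= / (Cmod z ^ 3 / 2).
  by apply: Rinv_le_contravar => //; lra.
have H5 : Cmod h * / (Cmod z ^ 3 / 2) <= e.
  apply: (Rmult_le_reg_r (Cmod z ^ 3 / 2)); first lra.
  rewrite Rmult_assoc Rinv_l; lra.
have ph := Cmod_ge_0 h.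
apply: (Rle_trans _ (Cmod h * (Cmod h * / (Cmod z ^ 3 / 2)))); nra.
Qed.

Definition Cexp (z : C) : C := (exp (Re z) * cos (Im z), exp (Re z) * sin (Im z)).

Lemma Cexp_plus z w : Cexp (z + w)%C = (Cexp z * Cexp w)%C.
Proof.
rewrite /Cexp re_plus im_plus exp_plus cos_plus sin_plus /Cmult /=.
by apply: injective_projections => /=; ring.
Qed.

Lemma Cexp_0 : Cexp (RtoC 0) = RtoC 1.
Proof.
by rewrite /Cexp /= exp_0 cos_0 sin_0; apply: injective_projections => /=; ring.
Qed.

Lemma Cmod_Cexp z : Cmod (Cexp z) = exp (Re z).
Proof.
rewrite /Cexp /Cmod /=.
have -> : exp (Re z) * cos (Im z) * (exp (Re z) * cos (Im z) * 1) +
  exp (Re z) * sin (Im z) * (exp (Re z) * sin (Im z) * 1) =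
  exp (Re z) * exp (Re z) * ((sin (Im z))² + (cos (Im z))²) by rewrite /Rsqr; ring.
rewrite sin2_cos2 Rmult_1_r; apply: sqrt_square.
exact: Rlt_le (exp_pos _).
Qed.

Lemma Cexp_nz z : Cexp z <> RtoC 0.
Proof. by apply/Cmod_gt_0; rewrite Cmod_Cexp; exact: exp_pos. Qed.

Lemma Cexp_2PI z : Cexp (z + (0%R, (2 * PI)%R))%C = Cexp z.
Proof.
rewrite /Cexp re_plus im_plus /= Rplus_0_r.
have -> : Im z + 2 * PI = Im z + 2 * INR 1 * PI by simpl; ring.
by rewrite cos_period sin_period.
Qed.

Lemma derivable_pt_lim_0_abs f l : derivable_pt_lim f 0 l -> forall e, 0 < e ->
  exists d, 0 < d /\ forall x, Rabs x < d -> Rabs (f x - f 0 - l * x) <= e * Rabs x.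
Proof.
move=> H e He; have [d Hd] := H e He.
exists d; split; first exact: cond_pos.
move=> x Hx; case: (Req_dec x 0) => [->|Hx0].
  by replace (f 0 - f 0 - l * 0) with 0 by ring; rewrite Rabs_R0; lra.
have := Hd x Hx0 Hx; rewrite Rplus_0_l.
have -> : (f x - f 0) / x - l = (f x - f 0 - l * x) / x by field.
rewrite Rabs_div // => H'.
have px := Rabs_pos_lt _ Hx0.
apply: (Rmult_le_reg_r (/ Rabs x)); first exact: Rinv_0_lt_compat.
by rewrite [X in _ <= X]Rmult_assoc Rinv_r; rewrite /Rdiv in H'; lra.
Qed.

Lemma Cmod_le_abs z : Cmod z <= Rabs (Re z) + Rabs (Im z).
Proof.
rewrite /Cmod; apply: (Rle_trans _ (sqrt ((Rabs (fst z) + Rabs (snd z)) ^ 2))).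
  apply: sqrt_le_1_alt; rewrite -(pow2_abs (fst z)) -(pow2_abs (snd z)).
  have := Rabs_pos (fst z); have := Rabs_pos (snd z); nra.
rewrite sqrt_pow2; first by rewrite /Re /Im; lra.
have := Rabs_pos (fst z); have := Rabs_pos (snd z); lra.
Qed.

Lemma im_le_Cmod c : Rabs (Im c) <= Cmod c.
Proof. by have := Rmax_Cmod c; have := Rmax_r (Rabs (fst c)) (Rabs (snd c)); rewrite /Im; lra. Qed.

(* |e^z - 1 - z| <= |e^x - 1 - x| + |e^x (cos y - 1)| + |(e^x - 1) sin y| + |sin y - y| *)
Lemma cdiff_Cexp0 : cdiff Cexp (RtoC 0) (RtoC 1).
Proof.
move=> e0 He0.
set e := Rmin e0 1 / 8.
have He : 0 < e by rewrite /e; have : 0 < Rmin e0 1 by [apply: Rmin_pos; lra]; lra.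
have He1 : e <= e0 / 8 by rewrite /e; have := Rmin_l e0 1; lra.
have He2 : e <= 1 / 8 by rewrite /e; have := Rmin_r e0 1; lra.
have [d1 [Hd1 H1]] := derivable_pt_lim_0_abs _ _ (derivable_pt_lim_exp 0) e He.
have [d2 [Hd2 H2]] := derivable_pt_lim_0_abs _ _ (derivable_pt_lim_sin 0) e He.
have [d3 [Hd3 H3]] := derivable_pt_lim_0_abs _ _ (derivable_pt_lim_cos 0) e He.
rewrite exp_0 in H1; rewrite cos_0 sin_0 in H2; rewrite sin_0 cos_0 in H3.
exists (Rmin (Rmin d1 d2) (Rmin d3 (e / 2))); split; first by repeat apply: Rmin_pos => //; lra.
move=> [x y] Hh.
have Hx := re_le_Cmod (x, y); have Hy := im_le_Cmod (x, y).
rewrite /= in Hx Hy.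
have e1 := Rmin_l d1 d2.
have e2 := Rmin_r d1 d2.
have e3 := Rmin_l (Rmin d1 d2) (Rmin d3 (e / 2)).
have e4 := Rmin_r (Rmin d1 d2) (Rmin d3 (e / 2)).
have e5 := Rmin_l d3 (e / 2).
have e6 := Rmin_r d3 (e / 2).
have {H1} h1 := H1 x ltac:(lra); have {H2} h2 := H2 y ltac:(lra); have {H3} h3 := H3 y ltac:(lra).
rewrite Rminus_0_r Rmult_1_l in h2; rewrite Ropp_0 Rmult_0_l Rminus_0_r in h3.
rewrite Rmult_1_l in h1.
set r := Cmod (x, y) in Hh Hx Hy *.
rewrite Cplus_0_l Cexp_0.
apply: Rle_trans (Cmod_le_abs _) _; rewrite /= !Rmult_1_l !Rmult_0_l.
have px := Rabs_pos x; have py := Rabs_pos y.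
have hex : Rabs (exp x - 1) <= e.
  have -> : exp x - 1 = (exp x - 1 - x) + x by ring.
  by have := Rabs_triang (exp x - 1 - x) x; nra.
have hexx : Rabs (exp x) <= 2.
  have -> : exp x = (exp x - 1) + 1 by ring.
  by have := Rabs_triang (exp x - 1) 1; rewrite Rabs_R1; lra.
have hsin : Rabs (sin y) <= 2 * Rabs y.
  have -> : sin y = (sin y - y) + y by ring.
  by have := Rabs_triang (sin y - y) y; nra.
have t1 : Rabs (exp x * cos y + - (1) + - (x - 0)) <= e * Rabs x + Rabs (exp x) * Rabs (cos y - 1).
  have -> : exp x * cos y + - (1) + - (x - 0) = (exp x - 1 - x) + exp x * (cos y - 1) by ring.
  by apply: Rle_trans (Rabs_triang _ _) _; rewrite Rabs_mult; lra.
have t2 : Rabs (exp x * sin y + - 0 + - (y + 0)) <= Rabs (exp x - 1) * Rabs (sin y) + e * Rabs y.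
  have -> : exp x * sin y + - 0 + - (y + 0) = (exp x - 1) * sin y + (sin y - y) by ring.
  by apply: Rle_trans (Rabs_triang _ _) _; rewrite Rabs_mult; lra.
have t3 : Rabs (exp x) * Rabs (cos y - 1) <= 2 * (e * Rabs y).
  by apply: Rmult_le_compat => //; exact: Rabs_pos.
have t4 : Rabs (exp x - 1) * Rabs (sin y) <= e * (2 * Rabs y).
  by apply: Rmult_le_compat => //; exact: Rabs_pos.
have t5 : e * Rabs x <= e * r by apply: Rmult_le_compat_l; lra.
have t6 : e * Rabs y <= e * r by apply: Rmult_le_compat_l; lra.
have t7 : e * r <= e0 / 8 * r by apply: Rmult_le_compat_r; [exact: Cmod_ge_0|].
have pr : 0 <= e0 * r by apply: Rmult_le_pos; [lra|exact: Cmod_ge_0].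
lra.
Qed.

Lemma cdiff_Cexp z : cdiff Cexp z (Cexp z).
Proof.
have H1 : cdiff (fun w => w - z)%C z (RtoC 1).
  have := cdiff_minus _ _ _ _ _ (cdiff_id z) (cdiff_const z z).
  by replace (1 - 0)%C with (RtoC 1) by ring.
have H2 : cdiff Cexp (z - z)%C (RtoC 1).
  by replace (z - z)%C with (RtoC 0) by ring; exact: cdiff_Cexp0.
have := cdiff_scal (Cexp z) _ _ _ (cdiff_comp Cexp (fun w => w - z)%C z _ _ H2 H1).
replace (Cexp z * (1 * 1))%C with (Cexp z) by ring.
by apply: cdiff_ext => w; rewrite -Cexp_plus; congr Cexp; ring.
Qed.

(** * Paths in the plane and their integrals *)

(** The real-time counterpart of [cdiff], in the same expansion form, so that a complex derivative
    composes directly with the velocity of a path. *)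
Definition pdiff (g : R -> C) (s : R) (l : C) : Prop :=
  forall eps, 0 < eps -> exists d, 0 < d /\ forall h : R, Rabs h < d ->
    Cmod (g (s + h)%R - g s - l * h)%C <= eps * Rabs h.

Definition pcont (g : R -> C) (s : R) : Prop :=
  forall eps, 0 < eps -> exists d, 0 < d /\ forall h : R, Rabs h < d ->
    Cmod (g (s + h)%R - g s)%C < eps.

Lemma pcont_ccont f g s : pcont g s -> ccont f (g s) -> pcont (fun t => f (g t)) s.
Proof.
move=> Hg Hf e He.
have [d [Hd H]] := Hf e He.
have [d2 [Hd2 H2]] := Hg d Hd.
exists d2; split=> // h Hh.
have := H _ (H2 h Hh).
by replace (g s + (g (s + h)%R - g s))%C with (g (s + h)%R) by ring.
Qed.

Lemma pdiff_cont g s l : pdiff g s l -> pcont g s.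
Proof.
move=> H e He.
have [d [Hd Hd']] := H 1 Rlt_0_1.
have pl := Cmod_ge_0 l.
exists (Rmin d (e / (Cmod l + 2))); split.
  by apply: Rmin_pos => //; apply: Rdiv_lt_0_compat; lra.
move=> h Hh.
have [h1 h2] := Rmin_Rgt_l _ _ _ Hh.
have {h2} h2 : Rabs h * (Cmod l + 2) < e.
  have -> : e = e / (Cmod l + 2) * (Cmod l + 2) by field; lra.
  by apply: Rmult_lt_compat_r; lra.
have h3 := Hd' h h1.
replace (g (s + h)%R - g s)%C with (g (s + h)%R - g s - l * h + l * h)%C by ring.
have := Cmod_triangle (g (s + h)%R - g s - l * h)%C (l * h)%C.
rewrite Cmod_mult Cmod_R.
have := Rabs_pos h; nra.
Qed.

Lemma pdiff_comp f g s l m :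
  cdiff f (g s) l -> pdiff g s m -> pdiff (fun t => f (g t)) s (l * m)%C.
Proof.
move=> /cdiff_slope [q [Hq [<- Hc]]] Hg e He.
have pm := Cmod_ge_0 m; have pq := Cmod_ge_0 (q (g s)).
set k := Rmin 1 (e / (Cmod m + 1 + Cmod (q (g s)))).
have Hk : 0 < k by apply: Rmin_pos; [lra|apply: Rdiv_lt_0_compat; lra].
have Hk1 : k <= 1 by exact: Rmin_l.
have Hk2 : k * (Cmod m + 1 + Cmod (q (g s))) <= e.
  have -> : e = e / (Cmod m + 1 + Cmod (q (g s))) * (Cmod m + 1 + Cmod (q (g s))) by field; lra.
  by apply: Rmult_le_compat_r; [lra|exact: Rmin_r].
have [d1 [Hd1 H1]] := pcont_ccont q g s (pdiff_cont _ _ _ Hg) Hc k Hk.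
have [d2 [Hd2 H2]] := Hg k Hk.
exists (Rmin d1 d2); split; first exact: Rmin_pos.
move=> h Hh.
have [/H1 h1 /H2 h2] := Rmin_Rgt_l _ _ _ Hh.
have h3 : Cmod (g (s + h)%R - g s)%C <= (Cmod m + 1) * Rabs h.
  replace (g (s + h)%R - g s)%C with (g (s + h)%R - g s - m * h + m * h)%C by ring.
  have := Cmod_triangle (g (s + h)%R - g s - m * h)%C (m * h)%C.
  rewrite Cmod_mult Cmod_R.
  have := Rabs_pos h; nra.
rewrite (Hq (g (s + h)%R)).
replace (f (g s) + q (g (s + h)%R) * (g (s + h)%R - g s) - f (g s) - q (g s) * m * h)%C with
 ((q (g (s + h)%R) - q (g s)) * (g (s + h)%R - g s) + q (g s) * (g (s + h)%R - g s - m * h))%C by ring.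
apply: Rle_trans (Cmod_triangle _ _) _.
rewrite !Cmod_mult.
have p1 := Cmod_ge_0 (q (g (s + h)%R) - q (g s))%C.
have p2 := Cmod_ge_0 (g (s + h)%R - g s)%C.
have ph := Rabs_pos h.
have t1 : Cmod (q (g (s + h)%R) - q (g s))%C * Cmod (g (s + h)%R - g s)%C <= k * ((Cmod m + 1) * Rabs h).
  by apply: Rmult_le_compat => //; lra.
have t2 : Cmod (q (g s)) * Cmod (g (s + h)%R - g s - m * h)%C <= Cmod (q (g s)) * (k * Rabs h).
  by apply: Rmult_le_compat_l.
have t3 : k * (Cmod m + 1 + Cmod (q (g s))) * Rabs h <= e * Rabs h by apply: Rmult_le_compat_r.
lra.
Qed.

Lemma pdiff_affine (a b : C) s : pdiff (fun t => a + t * b)%C s b.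
Proof.
move=> e He; exists 1; split; first lra.
move=> h _; rewrite RtoC_plus.
replace (a + (s + h) * b - (a + s * b) - b * h)%C with (RtoC 0) by ring.
by rewrite Cmod_0; have := Rabs_pos h; nra.
Qed.

Lemma pdiff_ext f g s l : (forall t, f t = g t) -> pdiff f s l -> pdiff g s l.
Proof. by move=> H; rewrite (functional_extensionality f g H). Qed.

Lemma pdiff_minus f g s l m :
  pdiff f s l -> pdiff g s m -> pdiff (fun t => f t - g t)%C s (l - m)%C.
Proof.
move=> Hf Hg e He.
have [d1 [Hd1 H1]] := Hf (e / 2) ltac:(lra).
have [d2 [Hd2 H2]] := Hg (e / 2) ltac:(lra).
exists (Rmin d1 d2); split; first exact: Rmin_pos.
move=> h Hh.
have [/H1 h1 /H2 h2] := Rmin_Rgt_l _ _ _ Hh.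
replace (f (s + h)%R - g (s + h)%R - (f s - g s) - (l - m) * h)%C with
  ((f (s + h)%R - f s - l * h) - (g (s + h)%R - g s - m * h))%C by ring.
have := Cmod_triangle (f (s + h)%R - f s - l * h)%C (- (g (s + h)%R - g s - m * h))%C.
rewrite (Cmod_opp (g (s + h)%R - g s - m * h)%C) -/(Cminus _ _); lra.
Qed.

Lemma pdiff_is_derive g s l (c : C) :
  pdiff g s l -> is_derive (fun t => Re (c * g t)%C) s (Re (c * l)%C).
Proof.
move=> H; apply/is_derive_Reals => e He.
have pc := Cmod_ge_0 c.
have [d [Hd Hd']] := H (e / 2 / (Cmod c + 1)) ltac:(apply: Rdiv_lt_0_compat; lra).
exists (mkposreal d Hd) => h Hh0 Hh.
have := Hd' h Hh.
have -> : (Re (c * g (s + h)%R)%C - Re (c * g s)%C) / h - Re (c * l)%C =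
  Re (c * (g (s + h)%R - g s - l * h))%C / h.
  rewrite /Cminus !re_mult !re_plus !im_plus !re_opp !im_opp re_mult im_mult re_RtoC im_RtoC.
  by field.
rewrite Rabs_div // => H1.
have ph := Rabs_pos_lt _ Hh0.
apply: (Rle_lt_trans _ (e / 2)); last lra.
apply: (Rmult_le_reg_r (Rabs h)) => //.
have -> : forall x, Rabs x / Rabs h * Rabs h = Rabs x by move=> x; field; lra.
apply: Rle_trans (re_le_Cmod _) _; rewrite Cmod_mult.
apply: (Rle_trans _ (Cmod c * (e / 2 / (Cmod c + 1) * Rabs h))); first exact: Rmult_le_compat_l.
have -> : Cmod c * (e / 2 / (Cmod c + 1) * Rabs h) = (Cmod c / (Cmod c + 1)) * (e / 2 * Rabs h) by field; lra.
have H2 : Cmod c / (Cmod c + 1) <= 1.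
  by apply: (Rmult_le_reg_r (Cmod c + 1)); [lra|rewrite /Rdiv Rmult_assoc Rinv_l; lra].
have : 0 <= e / 2 * Rabs h by nra.
nra.
Qed.

(** Multiplication by [c] turns a modulus into a real part, which makes real mean value and integral
    inequalities apply to complex values without loss. *)
Lemma unit_rotation (w : C) : exists c : C, Cmod c = 1 /\ (c * w)%C = RtoC (Cmod w).
Proof.
case: (Ceq_dec w (RtoC 0)) => [->|Hw].
  by exists (RtoC 1); rewrite Cmod_1 Cmod_0; split=> //; ring.
have pw : 0 < Cmod w by apply/Cmod_gt_0.
have nw : RtoC (Cmod w) <> RtoC 0 by move=> /RtoC_inj; lra.
exists (Cconj w / Cmod w)%C; split.
  by rewrite Cmod_div // Cmod_conj Cmod_R Rabs_pos_eq; [field; lra|lra].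
transitivity (w * Cconj w / Cmod w)%C; first by field.
rewrite -Cmod2_conj /= Rmult_1_r RtoC_mult; by field.
Qed.

(** After [g b - g a] is rotated onto the positive axis by [c], the real function [phi - Re (c g)]
    has a nonnegative derivative, and the real mean value theorem applies to it. *)
Lemma path_mvi (g g' : R -> C) (phi phi' : R -> R) a b : a <= b ->
  (forall s, a <= s <= b -> pdiff g s (g' s)) ->
  (forall s, a <= s <= b -> is_derive phi s (phi' s)) ->
  (forall s, a <= s <= b -> Cmod (g' s) <= phi' s) ->
  Cmod (g b - g a)%C <= phi b - phi a.
Proof.
move=> Hab Hg Hphi Hle.
have [c [Hc Hcw]] := unit_rotation (g b - g a)%C.
pose psi s := phi s - Re (c * g s)%C.
have Hd : forall s, a <= s <= b -> is_derive psi s (phi' s - Re (c * g' s)%C).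
  move=> s Hs; apply: (@is_derive_minus R_AbsRing R_NormedModule); first exact: Hphi.
  by apply: pdiff_is_derive; exact: Hg.
have Hmm : Rmin a b = a /\ Rmax a b = b by rewrite Rmin_left // Rmax_right.
have [] := MVT_gen psi a b (fun s => phi' s - Re (c * g' s)%C).
- by case: Hmm => -> -> s Hs; apply: Hd; lra.
- case: Hmm => -> -> s Hs; apply/continuity_pt_filterlim.
  by apply: (ex_derive_continuous psi s); eexists; exact: Hd.
case: Hmm => -> -> x [Hx Hxe].
have h1 := re_le_Cmod (c * g' x)%C; rewrite Cmod_mult Hc Rmult_1_l in h1.
have h2 := Hle x Hx.
have h3 := Rle_abs (Re (c * g' x)%C).
have h4 : 0 <= psi b - psi a by rewrite Hxe; apply: Rmult_le_pos; lra.
have h5 : Re (c * (g b - g a))%C = Cmod (g b - g a)%C by rewrite Hcw re_RtoC.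
have h6 : Re (c * (g b - g a))%C = Re (c * g b)%C - Re (c * g a)%C.
  by rewrite /Cminus !re_mult re_plus im_plus re_opp im_opp; ring.
rewrite /psi in h4; lra.
Qed.

Lemma seg_mvi (f f' : C -> C) z h K :
  (forall s, 0 <= s <= 1 -> cdiff f (z + s * h)%C (f' (z + s * h)%C)) ->
  (forall s, 0 <= s <= 1 -> Cmod (f' (z + s * h)%C) <= K) ->
  Cmod (f (z + h) - f z)%C <= K * Cmod h.
Proof.
move=> Hf HK.
have := path_mvi (fun s => f (z + s * h)%C) (fun s => f' (z + s * h) * h)%C
  (fun s => K * Cmod h * s) (fun s => K * Cmod h) 0 1 Rle_0_1.
rewrite Cmult_1_l Cmult_0_l Cplus_0_r Rmult_1_r Rmult_0_r Rminus_0_r; apply.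
- move=> s Hs; apply: (pdiff_comp f (fun t => z + t * h)%C); first exact: Hf.
  exact: pdiff_affine.
- by move=> s Hs; auto_derive => //; ring.
- move=> s Hs; rewrite Cmod_mult; apply: Rmult_le_compat_r; [exact: Cmod_ge_0|exact: HK].
Qed.

(** * Integrals of continuous complex-valued functions over the unit interval *)

Definition cint (g : R -> C) : C :=
  (RInt (fun t => Re (g t)) 0 1, RInt (fun t => Im (g t)) 0 1).

Definition pcontall (g : R -> C) := forall s, pcont g s.

Lemma pcont_continuous_re g s : pcont g s -> continuous (fun t => Re (g t)) s.
Proof.
move=> H; apply/continuity_pt_filterlim => e He.
have [d [Hd Hd']] := H e He.
exists d; split=> // x [_ Hx]; simpl in x.
have := Hd' (x - s) Hx; replace (s + (x - s)) with x by ring.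
move=> Hlt; apply: Rle_lt_trans Hlt.
have := re_le_Cmod (g x - g s)%C.
by rewrite /Cminus re_plus re_opp.
Qed.

Lemma pcont_continuous_im g s : pcont g s -> continuous (fun t => Im (g t)) s.
Proof.
move=> H; apply/continuity_pt_filterlim => e He.
have [d [Hd Hd']] := H e He.
exists d; split=> // x [_ Hx]; simpl in x.
have := Hd' (x - s) Hx; replace (s + (x - s)) with x by ring.
move=> Hlt; apply: Rle_lt_trans Hlt.
have := im_le_Cmod (g x - g s)%C.
by rewrite /Cminus im_plus im_opp.
Qed.

Lemma ex_RInt_re g a b : pcontall g -> ex_RInt (fun t => Re (g t)) a b.
Proof.
move=> H; apply: (@ex_RInt_continuous R_CompleteNormedModule) => z _.
exact: pcont_continuous_re.
Qed.

Lemma ex_RInt_im g a b : pcontall g -> ex_RInt (fun t => Im (g t)) a b.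
Proof.
move=> H; apply: (@ex_RInt_continuous R_CompleteNormedModule) => z _.
exact: pcont_continuous_im.
Qed.

Lemma cint_ext f g : (forall t, 0 <= t <= 1 -> f t = g t) -> cint f = cint g.
Proof.
move=> H; congr pair; apply: RInt_ext => x;
  rewrite Rmin_left ?Rmax_right; try lra; by move=> Hx; rewrite H //; lra.
Qed.

Lemma pcontall_plus f g : pcontall f -> pcontall g -> pcontall (fun t => f t + g t)%C.
Proof.
move=> Hf Hg s e He.
have [d1 [Hd1 H1]] := Hf s (e / 2) ltac:(lra).
have [d2 [Hd2 H2]] := Hg s (e / 2) ltac:(lra).
exists (Rmin d1 d2); split; first exact: Rmin_pos.
move=> h Hh.
have [/H1 h1 /H2 h2] := Rmin_Rgt_l _ _ _ Hh.
replace (f (s + h)%R + g (s + h)%R - (f s + g s))%C with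
  ((f (s + h)%R - f s) + (g (s + h)%R - g s))%C by ring.
have := Cmod_triangle (f (s + h)%R - f s)%C (g (s + h)%R - g s)%C; lra.
Qed.

Lemma pcontall_const c : pcontall (fun=> c).
Proof.
move=> s e He; exists 1; split; first lra.
by move=> h _; replace (c - c)%C with (RtoC 0) by ring; rewrite Cmod_0.
Qed.

Lemma pcontall_scal c g : pcontall g -> pcontall (fun t => c * g t)%C.
Proof.
move=> H s; apply: (pcont_ccont (fun z => c * z)%C) => //.
by apply: ccont_mult; [exact: ccont_const|exact: ccont_id].
Qed.

Lemma pcontall_mult f g : pcontall f -> pcontall g -> pcontall (fun t => f t * g t)%C.
Proof.
move=> Hf Hg.
have sq : forall u, pcontall u -> pcontall (fun t => u t * u t)%C.
  by move=> u Hu s; apply: (pcont_ccont (fun z => z * z)%C) => //; apply: ccont_mult; exact: ccont_id.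
(* polarization *)
have -> : (fun t => f t * g t)%C = (fun t => / 2 * ((f t + g t) * (f t + g t) +
   (- (1)) * (f t * f t) + (- (1)) * (g t * g t)))%C.
  apply: functional_extensionality => t; field.
apply: pcontall_scal; apply: pcontall_plus; first apply: pcontall_plus.
- by apply: (sq (fun t => f t + g t)%C); exact: pcontall_plus.
- by apply: pcontall_scal; exact: sq.
- by apply: pcontall_scal; exact: sq.
Qed.

Lemma cint_plus f g : pcontall f -> pcontall g ->
  cint (fun t => f t + g t)%C = (cint f + cint g)%C.
Proof.
move=> Hf Hg; apply: injective_projections => /=.
- by apply: (@RInt_plus R_CompleteNormedModule); exact: ex_RInt_re.
- by apply: (@RInt_plus R_CompleteNormedModule); exact: ex_RInt_im.
Qed.

Lemma cint_scal c g : pcontall g -> cint (fun t => c * g t)%C = (c * cint g)%C.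
Proof.
move=> Hg.
have h1 := ex_RInt_re g 0 1 Hg; have h2 := ex_RInt_im g 0 1 Hg.
have sr : forall k (f : R -> R), ex_RInt f 0 1 -> RInt (fun t => k * f t) 0 1 = k * RInt f 0 1.
  by move=> k f; exact: (@RInt_scal R_CompleteNormedModule).
have er : forall k (f : R -> R), ex_RInt f 0 1 -> ex_RInt (fun t => k * f t) 0 1.
  by move=> k f; exact: (@ex_RInt_scal R_NormedModule).
apply: injective_projections => /=; rewrite -!sr //.
- by apply: (@RInt_minus R_CompleteNormedModule); apply: er.
- by apply: (@RInt_plus R_CompleteNormedModule); apply: er.
Qed.

Lemma cint_const c : cint (fun=> c) = c.
Proof.
rewrite /cint !RInt_const /scal /= /mult /= Rminus_0_r !Rmult_1_l.
by case: c.
Qed.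

Lemma cint_bound g K : pcontall g -> (forall t, 0 <= t <= 1 -> Cmod (g t) <= K) -> Cmod (cint g) <= K.
Proof.
move=> Hg HK.
have [c [Hc Hcw]] := unit_rotation (cint g).
have -> : Cmod (cint g) = Re (cint (fun t => c * g t)%C) by rewrite cint_scal // Hcw re_RtoC.
have Hcg := pcontall_scal c g Hg.
rewrite /=; have -> : K = RInt (fun=> K) 0 1.
  by rewrite RInt_const /scal /= /mult /=; ring.
apply: RInt_le; [lra|exact: (ex_RInt_re _ _ _ Hcg)|exact: ex_RInt_const|].
move=> x Hx; rewrite -/(Re (c * g x)%C).
apply: Rle_trans (Rle_abs _) _; apply: Rle_trans (re_le_Cmod (c * g x)%C) _.
by rewrite Cmod_mult Hc Rmult_1_l; apply: HK; lra.
Qed.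

Lemma cint_minus f g : pcontall f -> pcontall g ->
  cint (fun t => f t - g t)%C = (cint f - cint g)%C.
Proof.
move=> Hf Hg.
transitivity (cint (fun t => f t + (- (1)) * g t)%C); first by apply: cint_ext => t _; ring.
rewrite cint_plus //; last exact: pcontall_scal.
by rewrite cint_scal //; ring.
Qed.

Lemma cint_ftc (P p : R -> C) : (forall s, pdiff P s (p s)) -> pcontall p ->
  cint p = (P 1 - P 0)%C.
Proof.
move=> HP Hp.
have H1 : forall s, is_derive (fun t => Re (P t)) s (Re (p s)).
  move=> s; have := pdiff_is_derive _ _ _ (RtoC 1) (HP s).
  by rewrite Cmult_1_l; apply: is_derive_ext => t; rewrite Cmult_1_l.
have H2 : forall s, is_derive (fun t => Im (P t)) s (Im (p s)).
  move=> s; have := pdiff_is_derive _ _ _ (- Ci)%C (HP s).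
  have HI : forall w, Re (- Ci * w)%C = Im w by move=> w; rewrite re_mult /=; ring.
  by rewrite HI; apply: is_derive_ext => t; rewrite HI.
apply: injective_projections => /=; apply: is_RInt_unique.
- apply: (@is_RInt_derive R_CompleteNormedModule (fun t => Re (P t)) (fun t => Re (p t))) => x _ //.
  exact: pcont_continuous_re.
- apply: (@is_RInt_derive R_CompleteNormedModule (fun t => Im (P t)) (fun t => Im (p t))) => x _ //.
  exact: pcont_continuous_im.
Qed.

Lemma cint_half g : pcontall g ->
  cint g = (/ 2 * (cint (fun t => g (/ 2 * t + 0)%R) + cint (fun t => g (/ 2 * t + / 2)%R)))%C.
Proof.
move=> Hg.
have H : forall f : R -> R, (forall a b, ex_RInt f a b) ->
   RInt f 0 1 = / 2 * (RInt (fun t => f (/ 2 * t + 0)) 0 1 + RInt (fun t => f (/ 2 * t + / 2)) 0 1).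
  move=> f Hf.
  rewrite -(@RInt_Chasles R_CompleteNormedModule f 0 (/ 2) 1) //.
  have e1 := @RInt_comp_lin R_CompleteNormedModule f (/ 2) 0 0 1 (Hf _ _).
  have e2 := @RInt_comp_lin R_CompleteNormedModule f (/ 2) (/ 2) 0 1 (Hf _ _).
  have sr : forall k (f : R -> R), ex_RInt f 0 1 -> RInt (fun t => k * f t) 0 1 = k * RInt f 0 1.
    by move=> k f0; exact: (@RInt_scal R_CompleteNormedModule).
  rewrite /scal /= /mult /= in e1 e2.
  rewrite Rmult_plus_distr_l -!sr.
  - have E0 : / 2 * 0 + 0 = 0 by lra.
    have E1 : / 2 * 1 + 0 = / 2 by lra.
    have E2 : / 2 * 0 + / 2 = / 2 by lra.
    have E3 : / 2 * 1 + / 2 = 1 by lra.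
    rewrite E0 E1 in e1; rewrite E2 E3 in e2.
    by rewrite e1 e2.
  - have := @ex_RInt_comp_lin R_NormedModule f (/ 2) (/ 2) 0 1 (Hf _ _).
    move=> /(@ex_RInt_scal R_NormedModule _ _ _ 2); apply: ex_RInt_ext => x _.
    by rewrite /scal /= /mult /=; field.
  - have := @ex_RInt_comp_lin R_NormedModule f (/ 2) 0 0 1 (Hf _ _).
    move=> /(@ex_RInt_scal R_NormedModule _ _ _ 2); apply: ex_RInt_ext => x _.
    by rewrite /scal /= /mult /=; field.
have n2 : RtoC 2 <> RtoC 0 by move=> E; have := RtoC_inj _ _ E; lra.
have hr : forall z, (/ 2 * z)%C = (/ 2 * Re z, / 2 * Im z).
  move=> z; rewrite -RtoC_inv; last lra.
  by apply: injective_projections => /=; rewrite /Re /Im; ring.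
rewrite hr; congr pair; rewrite H /=; try ring.
- by move=> a b; exact: ex_RInt_re.
- by move=> a b; exact: ex_RInt_im.
Qed.

Lemma cint_rev g : pcontall g -> cint (fun t => g (- 1 * t + 1)) = cint g.
Proof.
move=> Hg.
have H : forall f : R -> R, (forall a b, ex_RInt f a b) ->
   RInt (fun t => f (- 1 * t + 1)) 0 1 = RInt f 0 1.
  move=> f Hf.
  have e1 := @RInt_comp_lin R_CompleteNormedModule f (- 1) 1 0 1.
  have E0 : - 1 * 0 + 1 = 1 by lra.
  have E1 : - 1 * 1 + 1 = 0 by lra.
  rewrite E0 E1 in e1.
  rewrite -(@opp_RInt_swap R_CompleteNormedModule f) // -(e1 (Hf _ _)).
  have er : ex_RInt (fun t => f (- 1 * t + 1)) 0 1.
    have := @ex_RInt_comp_lin R_NormedModule f (- 1) 1 0 1.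
    rewrite E0 E1 => /(_ (Hf _ _)) /(@ex_RInt_scal R_NormedModule _ _ _ (- 1)).
    by apply: ex_RInt_ext => x _; rewrite /scal /= /mult /=; ring.
  rewrite (@RInt_scal R_CompleteNormedModule (fun t => f (- 1 * t + 1)) 0 1 (- 1) er).
  move: (RInt (fun t => f (- 1 * t + 1)) 0 1) => x.
  by rewrite /opp /scal /= /mult /=; change (x = - (- 1 * x)%R); rewrite -Ropp_mult_distr_l Rmult_1_l Ropp_involutive.
congr pair; apply: (H (fun t => _ (g t))) => a b.
- exact: ex_RInt_re.
- exact: ex_RInt_im.
Qed.

Fixpoint csum (u : nat -> C) (n : nat) : C :=
  match n with O => RtoC 0 | S k => (csum u k + u k)%C end.

Definition rsum (g : R -> C) (n : nat) : C :=
  (/ INR n * csum (fun k => g (INR k / INR n)%R) n)%C.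

(** By uniform continuity the left-endpoint sums have error at most [e] per unit of length, and this
    error is accumulated by induction on the number of steps. The partial sums enter only through
    their recurrence [U], so that the real and imaginary parts of a complex sum are both
    instances. *)
Lemma RInt_riemann (f : R -> R) (U : nat -> nat -> R) :
  (forall n, U n 0%nat = 0) ->
  (forall n k, U n (S k) = U n k + f (INR k / INR n)) ->
  (forall t, continuous f t) -> forall e, 0 < e ->
  exists N : nat, (0 < N)%nat /\ forall n, (N <= n)%nat ->
   Rabs (/ INR n * U n n - RInt f 0 1) <= e.
Proof.
move=> U0 US Hf e He.
have ef : forall a b, ex_RInt f a b.
  by move=> a b; apply: (@ex_RInt_continuous R_CompleteNormedModule) => z _.
have Hc : forall x, 0 <= x <= 1 -> continuity_pt f x.
  by move=> x _; apply/continuity_pt_filterlim; exact: Hf.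
have [d Hd] := @Heine_cor2 f 0 1 Hc (mkposreal e He).
have [N [HN1 HN2]] := archimed_cor1 d (cond_pos d).
exists N; split=> // n HNn.
have pn : 0 < INR n by apply: lt_0_INR; lia.
have Hn : / INR n < d.
  apply: Rle_lt_trans HN1; apply: Rinv_le_contravar; first by apply: lt_0_INR.
  by apply: le_INR.
have key : forall k, (k <= n)%nat -> Rabs (/ INR n * U n k - RInt f 0 (INR k / INR n)) <= e * (INR k / INR n).
  elim=> [|k IH] Hk.
    rewrite U0 /= /Rdiv Rmult_0_l RInt_point /zero /= !Rmult_0_r.
    by replace (0 - 0) with 0 by ring; rewrite Rabs_R0; lra.
  have {IH} IH := IH ltac:(lia).
  have Hk1 : INR k + 1 <= INR n by rewrite -S_INR; apply: le_INR.
  have pk := pos_INR k.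
  have Ek : INR (S k) / INR n = INR k / INR n + / INR n by rewrite S_INR; field; lra.
  have pin : 0 < / INR n by apply: Rinv_0_lt_compat.
  have b0 : 0 <= INR k / INR n by apply: Rmult_le_pos; lra.
  have b1 : INR k / INR n + / INR n <= 1.
    by rewrite -Ek S_INR; apply: (Rmult_le_reg_r (INR n)) => //; rewrite /Rdiv Rmult_assoc Rinv_l; lra.
  rewrite Ek US -(@RInt_Chasles R_CompleteNormedModule f 0 (INR k / INR n)) // /plus /=.
  set a := INR k / INR n in IH b0 b1 *; set h := / INR n in IH pin b1 Hn *.
  have -> : h * (U n k + f a) - (RInt f 0 a + RInt f a (a + h)) =
     (h * U n k - RInt f 0 a) + (h * f a - RInt f a (a + h)) by ring.
  apply: Rle_trans (Rabs_triang _ _) _.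
  suff : Rabs (h * f a - RInt f a (a + h)) <= e * h by lra.
  have ec : ex_RInt (fun=> f a) a (a + h) by exact: ex_RInt_const.
  have -> : h * f a - RInt f a (a + h) = RInt (fun t => f a - f t) a (a + h).
    have -> : RInt (fun t => f a - f t) a (a + h) = RInt (fun=> f a) a (a + h) - RInt f a (a + h).
      exact: (@RInt_minus R_CompleteNormedModule (fun=> f a) f a (a + h)).
    by rewrite RInt_const /scal /= /mult /=; congr Rminus; ring.
  apply: Rle_trans (abs_RInt_le_const _ _ _ e _ _ _) _; first lra.
  - apply: (@ex_RInt_minus R_NormedModule (fun=> f a) f) => //.
  - move=> t Ht; apply: Rlt_le; apply: Hd; try lra.
    by rewrite Rabs_minus_sym Rabs_pos_eq; lra.
  - by right; ring.
have := key n (Nat.le_refl n).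
by have -> : INR n / INR n = 1 by [field; lra]; rewrite Rmult_1_r.
Qed.

Lemma cint_riemann g : pcontall g -> forall e, 0 < e ->
  exists N : nat, (0 < N)%nat /\ forall n, (N <= n)%nat -> Cmod (rsum g n - cint g)%C <= e.
Proof.
move=> Hg e He.
have [N1 [HN1 H1]] := RInt_riemann (fun t => Re (g t))
  (fun n k => Re (csum (fun j => g (INR j / INR n)) k)) (fun n => Logic.eq_refl)
  (fun n k => re_plus _ _) (fun t => pcont_continuous_re g t (Hg t)) (e / 2) ltac:(lra).
have [N2 [HN2 H2]] := RInt_riemann (fun t => Im (g t))
  (fun n k => Im (csum (fun j => g (INR j / INR n)) k)) (fun n => Logic.eq_refl)
  (fun n k => im_plus _ _) (fun t => pcont_continuous_im g t (Hg t)) (e / 2) ltac:(lra).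
exists (max N1 N2); split; first lia.
move=> n Hn.
have h1 := H1 n ltac:(lia); have h2 := H2 n ltac:(lia).
apply: Rle_trans (Cmod_le_abs _) _.
have n0 : INR n <> 0 by apply: not_0_INR; lia.
rewrite /Cminus re_plus im_plus re_opp im_opp /rsum -RtoC_inv // re_scal_l im_scal_l.
rewrite /Rminus in h1 h2; rewrite [Re (cint g)]/= [Im (cint g)]/=; lra.
Qed.

(** * Cauchy's theorem *)

Definition seg (f : C -> C) (p q : C) : C := ((q - p) * cint (fun t => f (p + t * (q - p))%C))%C.

Lemma pcontall_seg f p q : (forall z, ccont f z) -> pcontall (fun t => f (p + t * (q - p))%C).
Proof.
move=> Hf s; apply: (pcont_ccont f) => //.
by apply: pdiff_cont; exact: pdiff_affine.
Qed.

Lemma seg_half f p q : (forall z, ccont f z) ->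
  seg f p q = (seg f p ((p + q) / 2) + seg f ((p + q) / 2) q)%C.
Proof.
move=> Hf; rewrite /seg (cint_half (fun t => f (p + t * (q - p))%C)); last exact: pcontall_seg.
have -> : cint (fun t => f (p + (/ 2 * t + 0)%R * (q - p))%C) =
          cint (fun t => f (p + t * ((p + q) / 2 - p))%C).
  apply: cint_ext => t _; congr f.
  by rewrite Rplus_0_r RtoC_mult RtoC_inv; [field|lra].
have -> : cint (fun t => f (p + (/ 2 * t + / 2)%R * (q - p))%C) =
          cint (fun t => f ((p + q) / 2 + t * (q - (p + q) / 2))%C).
  apply: cint_ext => t _; congr f.
  by rewrite RtoC_plus RtoC_mult RtoC_inv; [field|lra].
by field.
Qed.

Lemma seg_rev f p q : (forall z, ccont f z) -> seg f q p = (- seg f p q)%C.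
Proof.
move=> Hf; rewrite /seg -(cint_rev (fun t => f (p + t * (q - p))%C)); last exact: pcontall_seg.
have -> : cint (fun t => f (p + (- 1 * t + 1)%R * (q - p))%C) = cint (fun t => f (q + t * (p - q))%C).
  apply: cint_ext => t _; congr f; rewrite RtoC_plus RtoC_mult.
  have -> : RtoC (- 1) = (- (1))%C by apply: injective_projections => /=; ring.
  ring.
ring.
Qed.

Lemma seg_primitive F f p q : (forall z, cdiff F z (f z)) -> (forall z, ccont f z) ->
  seg f p q = (F q - F p)%C.
Proof.
move=> HF Hf; rewrite /seg -cint_scal; last exact: pcontall_seg.
rewrite (cint_ftc (fun t => F (p + t * (q - p))%C)).
- by congr Cminus; congr F; ring.
- move=> s; rewrite Cmult_comm.
  by apply: (pdiff_comp F (fun t => p + t * (q - p))%C); [exact: HF|exact: pdiff_affine].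
- by apply: pcontall_scal; exact: pcontall_seg.
Qed.

Lemma seg_bound f p q K : (forall z, ccont f z) ->
  (forall t, 0 <= t <= 1 -> Cmod (f (p + t * (q - p))%C) <= K) ->
  Cmod (seg f p q) <= K * Cmod (q - p)%C.
Proof.
move=> Hf HK; rewrite /seg Cmod_mult Rmult_comm.
apply: Rmult_le_compat_r; first exact: Cmod_ge_0.
by apply: cint_bound => //; exact: pcontall_seg.
Qed.

Lemma seg_minus f g p q : (forall z, ccont f z) -> (forall z, ccont g z) ->
  seg (fun z => f z - g z)%C p q = (seg f p q - seg g p q)%C.
Proof.
move=> Hf Hg; rewrite /seg (cint_minus (fun t => f (p + t * (q - p))%C) (fun t => g (p + t * (q - p))%C));
  try exact: pcontall_seg.
ring.
Qed.

Lemma convex_dist c p q D t : 0 <= t <= 1 -> Cmod (p - c)%C <= D -> Cmod (q - c)%C <= D ->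
  Cmod (p + t * (q - p) - c)%C <= D.
Proof.
move=> Ht Hp Hq.
replace (p + t * (q - p) - c)%C with ((1 - t)%R * (p - c) + t * (q - c))%C by (rewrite RtoC_minus; ring).
apply: Rle_trans (Cmod_triangle _ _) _.
rewrite !Cmod_mult !Cmod_R !Rabs_pos_eq; try lra.
nra.
Qed.

Definition tri f (T : C * C * C) : C :=
  let: (p, q, r) := T in (seg f p q + seg f q r + seg f r p)%C.

Definition perim (T : C * C * C) : R :=
  let: (p, q, r) := T in Cmod (q - p)%C + Cmod (r - q)%C + Cmod (p - r)%C.

Definition holo (f : C -> C) : Prop := forall z, exists l, cdiff f z l.

Lemma holo_ccont f z : holo f -> ccont f z.
Proof. by move=> H; case: (H z) => l; exact: cdiff_cont. Qed.

(** The affine part of [f] at [c] has a quadratic primitive, so it integrates to zero around the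
    triangle and only the remainder counts. *)
Lemma tri_local f p q r c l eps D : holo f -> 0 <= eps ->
  (forall z, Cmod (z - c)%C <= D -> Cmod (f z - (f c + l * (z - c)))%C <= eps * Cmod (z - c)%C) ->
  Cmod (p - c)%C <= D -> Cmod (q - c)%C <= D -> Cmod (r - c)%C <= D ->
  Cmod (tri f (p, q, r)) <= eps * D * perim (p, q, r).
Proof.
move=> Hf He Hloc Hp Hq Hr.
have Hc : forall z, ccont f z by move=> z; exact: holo_ccont.
pose a := (fun z => f c + l * (z - c))%C.
have Ha : forall z, ccont a z.
  move=> z; apply: ccont_plus; first exact: ccont_const.
  apply: ccont_mult; first exact: ccont_const.
  by apply: (ccont_plus (fun w => w)); [exact: ccont_id|exact: ccont_const].
have HA : forall z, cdiff (fun z => f c * z + l / 2 * ((z - c) * (z - c)))%C z (a z).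
  move=> z.
  have Hz : cdiff (fun w => w - c)%C z (RtoC 1).
    have := cdiff_minus _ _ _ _ _ (cdiff_id z) (cdiff_const c z).
    by replace (1 - 0)%C with (RtoC 1) by ring.
  have := cdiff_plus _ _ _ _ _ (cdiff_scal (f c) _ _ _ (cdiff_id z))
    (cdiff_scal (l / 2)%C _ _ _ (cdiff_mult _ _ _ _ _ Hz Hz)).
  by replace (f c * 1 + l / 2 * (1 * (z - c) + (z - c) * 1))%C with (a z) by (rewrite /a; field).
have Hs : forall p q, Cmod (p - c)%C <= D -> Cmod (q - c)%C <= D ->
    Cmod (seg f p q - seg a p q)%C <= eps * D * Cmod (q - p)%C.
  move=> u v Hu Hv; rewrite -seg_minus //; apply: seg_bound.
    move=> z; rewrite (functional_extensionality (fun z => f z - a z)%C (fun z => f z + (- (1)) * a z)%C).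
      apply: ccont_plus => //; apply: ccont_mult => //; exact: ccont_const.
    by move=> x; ring.
  move=> t Ht; have Hz := convex_dist c u v D t Ht Hu Hv.
  by apply: Rle_trans (Hloc _ Hz) _; apply: Rmult_le_compat_l.
have E : tri f (p, q, r) = ((seg f p q - seg a p q) + (seg f q r - seg a q r) + (seg f r p - seg a r p))%C.
  by rewrite /tri !(seg_primitive _ a _ _ HA Ha); ring.
rewrite E /perim.
have h1 := Hs p q Hp Hq; have h2 := Hs q r Hq Hr; have h3 := Hs r p Hr Hp.
have := Cmod_triangle (seg f p q - seg a p q + (seg f q r - seg a q r))%C (seg f r p - seg a r p)%C.
have := Cmod_triangle (seg f p q - seg a p q)%C (seg f q r - seg a q r)%C.
lra.
Qed.

Definition mid (p q : C) : C := ((p + q) / 2)%C.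

Definition tri1 (T : C * C * C) := let: (p, q, r) := T in (p, mid p q, mid r p).
Definition tri2 (T : C * C * C) := let: (p, q, r) := T in (mid p q, q, mid q r).
Definition tri3 (T : C * C * C) := let: (p, q, r) := T in (mid r p, mid q r, r).
Definition tri4 (T : C * C * C) := let: (p, q, r) := T in (mid p q, mid q r, mid r p).

Lemma tri_split f T : (forall z, ccont f z) ->
  tri f T = (tri f (tri1 T) + tri f (tri2 T) + tri f (tri3 T) + tri f (tri4 T))%C.
Proof.
move=> Hf; case: T => -[p q] r; rewrite /tri /tri1 /tri2 /tri3 /tri4.
rewrite (seg_half f p q) // (seg_half f q r) // (seg_half f r p) // -!/(mid _ _).
rewrite (seg_rev f (mid p q) (mid r p)) // (seg_rev f (mid p q) (mid q r)) //.
rewrite (seg_rev f (mid q r) (mid r p)) //; ring.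
Qed.

Lemma perim_half T : let p T := perim T = perim T in
  perim (tri1 T) = perim T / 2 /\ perim (tri2 T) = perim T / 2 /\
  perim (tri3 T) = perim T / 2 /\ perim (tri4 T) = perim T / 2.
Proof.
have H : forall z, Cmod (z / 2)%C = Cmod z / 2.
  move=> z; rewrite Cmod_div; last by move=> E; have := RtoC_inj _ _ E; lra.
  by rewrite Cmod_R Rabs_pos_eq; lra.
case: T => -[p q] r; rewrite /perim /tri1 /tri2 /tri3 /tri4 /mid /=.
repeat split.
- replace ((p + q) / 2 - p)%C with ((q - p) / 2)%C by field.
  replace ((r + p) / 2 - (p + q) / 2)%C with ((r - q) / 2)%C by field.
  replace (p - (r + p) / 2)%C with ((p - r) / 2)%C by field.
  by rewrite !H; field.
- replace (q - (p + q) / 2)%C with ((q - p) / 2)%C by field.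
  replace ((q + r) / 2 - q)%C with ((r - q) / 2)%C by field.
  replace ((p + q) / 2 - (q + r) / 2)%C with ((p - r) / 2)%C by field.
  by rewrite !H; field.
- replace ((q + r) / 2 - (r + p) / 2)%C with ((q - p) / 2)%C by field.
  replace (r - (q + r) / 2)%C with ((r - q) / 2)%C by field.
  replace ((r + p) / 2 - r)%C with ((p - r) / 2)%C by field.
  by rewrite !H; field.
- replace ((q + r) / 2 - (p + q) / 2)%C with (- ((p - r) / 2))%C by field.
  replace ((r + p) / 2 - (q + r) / 2)%C with (- ((q - p) / 2))%C by field.
  replace ((p + q) / 2 - (r + p) / 2)%C with (- ((r - q) / 2))%C by field.
  by rewrite !Cmod_opp !H; field.
Qed.

Definition vert (T : C * C * C) : C := T.1.1.

(** The integral is the sum over the four half-size triangles, so one of them carries at least a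
    quarter of its modulus. The bound on the displacement of the marked vertex makes the vertices of
    the iterated triangles converge geometrically. *)
Lemma tri_step f T : (forall z, ccont f z) -> exists T', Cmod (tri f T) / 4 <= Cmod (tri f T') /\
  perim T' = perim T / 2 /\ Cmod (vert T' - vert T)%C <= perim T.
Proof.
move=> Hf.
have [P1 [P2 [P3 P4]]] := perim_half T.
have HV : Cmod (vert (tri1 T) - vert T)%C <= perim T /\ Cmod (vert (tri2 T) - vert T)%C <= perim T /\
    Cmod (vert (tri3 T) - vert T)%C <= perim T /\ Cmod (vert (tri4 T) - vert T)%C <= perim T.
  have H : forall z, Cmod (z / 2)%C = Cmod z / 2.
    move=> z; rewrite Cmod_div; last by move=> E; have := RtoC_inj _ _ E; lra.
    by rewrite Cmod_R Rabs_pos_eq; lra.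
  case: T {P1 P2 P3 P4} => -[p q] r; rewrite /vert /perim /tri1 /tri2 /tri3 /tri4 /mid /=.
  have g1 := Cmod_ge_0 (q - p)%C; have g2 := Cmod_ge_0 (r - q)%C; have g3 := Cmod_ge_0 (p - r)%C.
  repeat split.
  - by replace (p - p)%C with (RtoC 0) by ring; rewrite Cmod_0; lra.
  - by replace ((p + q) / 2 - p)%C with ((q - p) / 2)%C by field; rewrite H; lra.
  - by replace ((r + p) / 2 - p)%C with (- ((p - r) / 2))%C by field; rewrite Cmod_opp H; lra.
  - by replace ((p + q) / 2 - p)%C with ((q - p) / 2)%C by field; rewrite H; lra.
case: HV => V1 [V2 [V3 V4]].
apply: NNPP => N.
have N' : forall T', perim T' = perim T / 2 -> Cmod (vert T' - vert T)%C <= perim T ->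
    Cmod (tri f T') < Cmod (tri f T) / 4.
  by move=> T' h1 h2; apply: Rnot_le_lt => h3; apply: N; exists T'.
have h1 := N' _ P1 V1; have h2 := N' _ P2 V2; have h3 := N' _ P3 V3; have h4 := N' _ P4 V4.
have := tri_split f T Hf => E.
have := Cmod_triangle (tri f (tri1 T) + tri f (tri2 T) + tri f (tri3 T))%C (tri f (tri4 T)).
have := Cmod_triangle (tri f (tri1 T) + tri f (tri2 T))%C (tri f (tri3 T)).
have := Cmod_triangle (tri f (tri1 T)) (tri f (tri2 T)).
rewrite -E; lra.
Qed.

Lemma geometric_cv_R (u : nat -> R) K : 0 <= K ->
  (forall n, Rabs (u (S n) - u n) <= K / 2 ^ n) ->
  exists l, forall n, Rabs (u n - l) <= 2 * K / 2 ^ n.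
Proof.
move=> HK H.
have p2 : forall n, 0 < 2 ^ n by move=> n; apply: pow_lt; lra.
have H1 : forall k n, Rabs (u (n + k)%nat - u n) <= 2 * K / 2 ^ n - 2 * K / 2 ^ (n + k).
  elim=> [|k IH] n.
    by rewrite Nat.add_0_r; replace (u n - u n) with 0 by ring; rewrite Rabs_R0; lra.
  rewrite Nat.add_succ_r /=.
  have h := H (n + k)%nat; have {IH} IH := IH n.
  have := Rabs_triang (u (S (n + k)) - u (n + k)%nat) (u (n + k)%nat - u n).
  have -> : u (S (n + k)) - u (n + k)%nat + (u (n + k)%nat - u n) = u (S (n + k)) - u n by ring.
  have -> : 2 * K / (2 * 2 ^ (n + k)) = K / 2 ^ (n + k) by field; have := p2 (n + k)%nat; lra.
  lra.
have H2 : forall n m, (n <= m)%nat -> Rabs (u m - u n) <= 2 * K / 2 ^ n.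
  move=> n m Hnm; have := H1 (m - n)%nat n; have -> : (n + (m - n))%nat = m by lia.
  have : 0 <= 2 * K / 2 ^ m by apply: Rmult_le_pos; [lra|apply: Rlt_le; apply: Rinv_0_lt_compat].
  lra.
have [l Hl] : { l | Un_cv u l }.
  suff Hcc : Cauchy_crit u by exact: (Rcomplete.R_complete u Hcc).
  move=> e He.
  have [N HN] := pow_lt_1_zero (/ 2) ltac:(rewrite Rabs_pos_eq; lra) (e / (4 * K + 1)) ltac:(apply: Rdiv_lt_0_compat; lra).
  exists N => n m Hn Hm.
  have HN' := HN N (Nat.le_refl N).
  rewrite Rabs_pos_eq in HN'; last by apply: pow_le; lra.
  have h1 := H2 N n ltac:(lia); have h2 := H2 N m ltac:(lia).
  rewrite /Rdist.
  have -> : u n - u m = (u n - u N) - (u m - u N) by ring.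
  apply: Rle_lt_trans (Rabs_triang _ _) _; rewrite Rabs_Ropp.
  rewrite pow_inv in HN'.
  have h3 : / 2 ^ N * (4 * K + 1) < e.
    have -> : e = e / (4 * K + 1) * (4 * K + 1) by field; lra.
    apply: Rmult_lt_compat_r; lra.
  have : 0 < / 2 ^ N by apply: Rinv_0_lt_compat.
  rewrite /Rdiv in h1 h2; nra.
exists l => n.
apply: Rnot_lt_le => Hlt.
have [N HN] := Hl (Rabs (u n - l) - 2 * K / 2 ^ n) ltac:(lra).
have := HN (max N n) ltac:(lia); have := H2 n (max N n) ltac:(lia); rewrite /Rdist => h1 h2.
have := Rabs_triang (u n - u (max N n)) (u (max N n) - l).
have -> : u n - u (max N n) + (u (max N n) - l) = u n - l by ring.
rewrite Rabs_minus_sym in h1; lra.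
Qed.

Lemma re_minus a b : Re (a - b)%C = Re a - Re b.
Proof. by rewrite /Cminus re_plus re_opp. Qed.

Lemma im_minus a b : Im (a - b)%C = Im a - Im b.
Proof. by rewrite /Cminus im_plus im_opp. Qed.

Lemma geometric_cv (u : nat -> C) K : 0 <= K ->
  (forall n, Cmod (u (S n) - u n)%C <= K / 2 ^ n) ->
  exists l, forall n, Cmod (u n - l)%C <= 4 * K / 2 ^ n.
Proof.
move=> HK H.
have [x Hx] : exists l, forall n, Rabs (Re (u n) - l) <= 2 * K / 2 ^ n.
  by apply: geometric_cv_R => // n; rewrite -re_minus; apply: Rle_trans (re_le_Cmod _) (H n).
have [y Hy] : exists l, forall n, Rabs (Im (u n) - l) <= 2 * K / 2 ^ n.
  by apply: geometric_cv_R => // n; rewrite -im_minus; apply: Rle_trans (im_le_Cmod _) (H n).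
exists (x, y) => n.
apply: Rle_trans (Cmod_le_abs _) _.
rewrite /Cminus re_plus im_plus re_opp im_opp.
have := Hx n; have := Hy n; rewrite /Rminus /Rdiv [Re (x, y)]/= [Im (x, y)]/=; lra.
Qed.

(** Iterated subdivision shrinks to a point [c]. Differentiability at [c] makes the integral over
    the [n]-th triangle small against [1 / 4^n], whereas the subdivision keeps it at least
    [|tri f T| / 4^n]. *)
Theorem goursat f T : holo f -> tri f T = RtoC 0.
Proof.
move=> Hf; apply: NNPP => N0.
have Hc : forall z, ccont f z by move=> z; exact: holo_ccont.
have pos : 0 < Cmod (tri f T) by apply/Cmod_gt_0.
pose next S0 := proj1_sig (constructive_indefinite_description _ (tri_step f S0 Hc)).
have nextP : forall S0, Cmod (tri f S0) / 4 <= Cmod (tri f (next S0)) /\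
    perim (next S0) = perim S0 / 2 /\ Cmod (vert (next S0) - vert S0)%C <= perim S0.
  by move=> S0; rewrite /next; case: constructive_indefinite_description.
pose Ts := fix Ts n := match n with O => T | S k => next (Ts k) end.
have p2 : forall n, 0 < 2 ^ n by move=> n; apply: pow_lt; lra.
have HP : forall n, perim (Ts n) = perim T / 2 ^ n.
  elim=> [|n IH] /=; first by field.
  by case: (nextP (Ts n)) => _ [-> _]; rewrite IH; field; have := p2 n; lra.
have HT : forall n, Cmod (tri f T) / (2 ^ n * 2 ^ n) <= Cmod (tri f (Ts n)).
  elim=> [|n IH] /=; first by right; field.
  case: (nextP (Ts n)) => h _; apply: Rle_trans h.
  apply: Rle_trans (Rmult_le_compat_r (/ 4) _ _ ltac:(lra) IH); right; field; have := p2 n; lra.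
have pT : forall S0, 0 <= perim S0.
  by case=> -[p q] r; rewrite /perim; have := Cmod_ge_0 (q - p)%C; have := Cmod_ge_0 (r - q)%C; have := Cmod_ge_0 (p - r)%C; lra.
have [c Hcv] := geometric_cv (fun n => vert (Ts n)) (perim T) (pT T)
  (fun n => eq_ind _ (fun r => _ <= r) (proj2 (proj2 (nextP (Ts n)))) _ (HP n)).
have [l Hl] := Hf c.
set s := perim T in HP Hcv *.
have ps : 0 <= s := pT T.
(* The [n]-th triangle lies within [5 s / 2^n] of [c]: [4 s / 2^n] for its marked vertex and
   [s / 2^n] for its perimeter. The final estimate is thus [|tri f T| <= eps * 5 s^2], which this
   tolerance contradicts; the [+ 1] covers [s = 0]. *)
have [d [Hd Hd']] := Hl (Cmod (tri f T) / (5 * s * s + 1) / 2) ltac:(apply: Rdiv_lt_0_compat; [apply: Rdiv_lt_0_compat; nra|lra]).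
set eps := _ / 2 in Hd'.
have Heps : 0 < eps by apply: Rdiv_lt_0_compat; [apply: Rdiv_lt_0_compat; nra|lra].
have [n Hn] : exists n, 5 * s / 2 ^ n < d.
  have [n HN] := pow_lt_1_zero (/ 2) ltac:(rewrite Rabs_pos_eq; lra) (d / (5 * s + 1)) ltac:(apply: Rdiv_lt_0_compat; lra).
  exists n; have := HN n (Nat.le_refl n).
  rewrite Rabs_pos_eq; last by apply: pow_le; lra.
  rewrite pow_inv => h.
  have h3 : / 2 ^ n * (5 * s + 1) < d.
    have -> : d = d / (5 * s + 1) * (5 * s + 1) by field; lra.
    apply: Rmult_lt_compat_r; lra.
  have : 0 < / 2 ^ n by apply: Rinv_0_lt_compat.
  rewrite /Rdiv; nra.
have := HT n; have := HP n; have := Hcv n.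
case: (Ts n) => -[p q] r h1 h2 h3.
change (Cmod (p - c)%C <= 4 * s / 2 ^ n) in h1.
have q1 : Cmod (q - p)%C + Cmod (r - q)%C + Cmod (p - r)%C = s / 2 ^ n := h2.
have g1 := Cmod_ge_0 (q - p)%C; have g2 := Cmod_ge_0 (r - q)%C; have g3 := Cmod_ge_0 (p - r)%C.
have i1 : Cmod (q - c)%C <= 5 * s / 2 ^ n.
  have := Cmod_triangle (q - p)%C (p - c)%C; replace (q - p + (p - c))%C with (q - c)%C by ring.
  rewrite /Rdiv in q1 h1 *; lra.
have i2 : Cmod (r - c)%C <= 5 * s / 2 ^ n.
  have := Cmod_triangle (r - p)%C (p - c)%C; replace (r - p + (p - c))%C with (r - c)%C by ring.
  rewrite (Cmod_minus_sym r p).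
  rewrite /Rdiv in q1 h1 *; lra.
have p2i : 0 < / 2 ^ n by apply: Rinv_0_lt_compat.
have i0 : Cmod (p - c)%C <= 5 * s / 2 ^ n by rewrite /Rdiv in h1 *; nra.
have Hloc : forall z, Cmod (z - c)%C <= 5 * s / 2 ^ n -> Cmod (f z - (f c + l * (z - c)))%C <= eps * Cmod (z - c)%C.
  move=> z Hz; have := Hd' (z - c)%C ltac:(lra).
  replace (c + (z - c))%C with z by ring.
  by replace (f z - f c - l * (z - c))%C with (f z - (f c + l * (z - c)))%C by ring.
have := tri_local f p q r c l eps _ Hf (Rlt_le _ _ Heps) Hloc i0 i1 i2.
rewrite h2 => h4.
have h5 := Rle_trans _ _ _ h3 h4.
have h6 : Cmod (tri f T) <= eps * (5 * s * s).
  apply: (Rmult_le_reg_r (/ (2 ^ n * 2 ^ n))); first by apply: Rinv_0_lt_compat; apply: Rmult_lt_0_compat.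
  apply: Rle_trans h5 _; right; field; have := p2 n; lra.
have h7 : eps * (5 * s * s + 1) = Cmod (tri f T) / 2 by rewrite /eps; field; nra.
nra.
Qed.

Lemma seg_diag f p q r : holo f -> (seg f p q + seg f q r)%C = seg f p r.
Proof.
move=> Hf; have := goursat f (p, q, r) Hf; rewrite /tri.
rewrite (seg_rev f p r); last by move=> z; exact: holo_ccont.
move=> E.
have -> : (seg f p q + seg f q r)%C = (seg f p q + seg f q r + - seg f p r + seg f p r)%C by ring.
by rewrite E; ring.
Qed.

(** * Integrals over circles and Cauchy's formula for the derivative *)

Definition eU (t : R) : C := Cexp (0%R, (2 * PI * t)%R).

Lemma Cmod_eU t : Cmod (eU t) = 1.
Proof. by rewrite /eU Cmod_Cexp /= exp_0. Qed.

Lemma eU_nz t : eU t <> RtoC 0.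
Proof. exact: Cexp_nz. Qed.

Lemma pcontall_eU : pcontall eU.
Proof.
move=> s; apply: (pcont_ccont Cexp).
  have := pdiff_cont _ _ _ (pdiff_affine (RtoC 0) (0%R, (2 * PI)%R) s).
  have -> // : (fun t : R => (0 + t * (0%R, (2 * PI)%R))%C) = (fun t : R => (0%R, (2 * PI * t)%R)).
  by apply: functional_extensionality => t; apply: injective_projections => /=; ring.
by apply: cdiff_cont; exact: cdiff_Cexp.
Qed.

(** This is the contour integral of [F z / z] over the circle, divided by [2 i PI]: in this
    parametrization [dz / z] is [2 i PI dt]. *)
Definition circ (F : C -> C) (rho : R) : C := cint (fun t => F (rho * eU t)%C).

Lemma pcontall_circ F rho : 0 < rho -> (forall z, z <> RtoC 0 -> ccont F z) ->
  pcontall (fun t => F (rho * eU t)%C).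
Proof.
move=> Hr HF s; apply: (pcont_ccont F (fun t => rho * eU t)%C).
  by apply: pcontall_scal; exact: pcontall_eU.
by apply: HF; apply: Cmult_neq_0; [move=> E; have := RtoC_inj _ _ E; lra|exact: eU_nz].
Qed.

(* Pull back by exp: the annulus between the two circles is the image of a
   rectangle of height 2 PI, on whose horizontal sides the contributions cancel. *)
Lemma circ_indep F r1 r2 : (forall z, z <> RtoC 0 -> exists l, cdiff F z l) ->
  0 < r1 -> 0 < r2 -> circ F r1 = circ F r2.
Proof.
move=> HF H1 H2.
pose h w := F (Cexp w).
have Hh : holo h.
  move=> w; case: (HF (Cexp w) (Cexp_nz w)) => l Hl; exists (l * Cexp w)%C.
  by apply: cdiff_comp => //; exact: cdiff_Cexp.
have Hc : forall z, ccont h z by move=> z; exact: holo_ccont.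
pose s1 := RtoC (ln r1); pose s2 := RtoC (ln r2).
pose T := ((0%R, (2 * PI)%R) : C).
have per : seg h (s1 + T)%C (s2 + T)%C = seg h s1 s2.
  rewrite /seg; congr Cmult; first by ring.
  apply: cint_ext => t _; rewrite /h -(Cexp_2PI (s1 + _)%C); congr F; congr Cexp; rewrite -/T; ring.
have E : seg h s1 (s1 + T)%C = seg h s2 (s2 + T)%C.
  have e1 := seg_diag h s1 s2 (s2 + T)%C Hh.
  have e2 := seg_diag h s1 (s1 + T)%C (s2 + T)%C Hh.
  rewrite per -e1 in e2.
  have -> : seg h s1 (s1 + T)%C = (seg h s1 (s1 + T) + seg h s1 s2 - seg h s1 s2)%C by ring.
  by rewrite e2; ring.
have S : forall r, 0 < r -> seg h (ln r) (ln r + T)%C = (T * circ F r)%C.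
  move=> r Hr; rewrite /seg; congr Cmult; first by ring.
  apply: cint_ext => t _; rewrite /h; congr F.
  rewrite /eU; have -> : (r * Cexp (0%R, (2 * PI * t)%R))%C = (Cexp (ln r) * Cexp (0%R, (2 * PI * t)%R))%C.
    congr Cmult; rewrite /Cexp /= exp_ln // cos_0 sin_0.
    by apply: injective_projections => /=; ring.
  rewrite -Cexp_plus; congr Cexp; apply: injective_projections => /=; ring.
rewrite !S // in E.
have nT : T <> RtoC 0 by move=> /(f_equal snd) /=; have := PI_RGT_0; lra.
transitivity (/ T * (T * circ F r1))%C; first by field.
by rewrite E; field.
Qed.

Lemma Cmod_circ rho t : 0 < rho -> Cmod (rho * eU t)%C = rho.
Proof. by move=> H; rewrite Cmod_mult Cmod_eU Cmod_R Rabs_pos_eq; lra. Qed.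

Lemma Cmod_eq0_le z : (forall e, 0 < e -> Cmod z <= e) -> z = RtoC 0.
Proof.
move=> H; apply: NNPP => N; have pz : 0 < Cmod z by apply/Cmod_gt_0.
by have := H (Cmod z / 2) ltac:(lra); lra.
Qed.

(** Independence of the radius lets the circle shrink to the possible singularity at 0, where only
    the limit of [F] matters. *)
Lemma circ_limit F L r : (forall z, z <> RtoC 0 -> exists l, cdiff F z l) -> 0 < r ->
  (forall e, 0 < e -> exists d, 0 < d /\ forall z, 0 < Cmod z < d -> Cmod (F z - L)%C <= e) ->
  circ F r = L.
Proof.
move=> HF Hr HL; apply/Ceq_minus; apply: Cmod_eq0_le => e He.
have [d [Hd Hd']] := HL e He.
have Hc : forall z, z <> RtoC 0 -> ccont F z by move=> z /HF [l]; exact: cdiff_cont.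
rewrite (circ_indep F r (d / 2)) //; last lra.
have Hp := pcontall_circ F (d / 2) ltac:(lra) Hc.
rewrite -{1}(cint_const L) -cint_minus //; last exact: pcontall_const.
apply: cint_bound.
  have := pcontall_plus _ _ Hp (pcontall_const (- L)%C).
  by [].
by move=> t _; apply: Hd'; rewrite Cmod_circ; lra.
Qed.

Lemma holo_comp_affine f a b : holo f -> holo (fun z => f (a + b * z)%C).
Proof.
move=> Hf z; case: (Hf (a + b * z)%C) => l Hl; exists (l * (0 + b * 1))%C.
apply: (cdiff_comp f (fun z => a + b * z)%C) => //.
by apply: cdiff_plus; [exact: cdiff_const|apply: cdiff_scal; exact: cdiff_id].
Qed.

Lemma cdiff_shift f z w l : cdiff f (z + w)%C l -> cdiff (fun u => f (z + u)%C) w l.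
Proof.
move=> H; have := cdiff_comp f (fun u => z + u)%C w _ _ H (cdiff_plus _ _ _ _ _ (cdiff_const z w) (cdiff_id w)).
by replace (l * (0 + 1))%C with l by ring.
Qed.

Theorem mean_value f z r : holo f -> 0 < r -> cint (fun t => f (z + r * eU t)%C) = f z.
Proof.
move=> Hf Hr; apply: (circ_limit (fun w => f (z + w)%C)) => //.
  by move=> w _; case: (Hf (z + w)%C) => l /cdiff_shift Hl; exists l.
move=> e He; have [d [Hd Hd']] := holo_ccont f z Hf e He.
by exists d; split=> // w [_ Hw]; apply: Rlt_le; apply: Hd'.
Qed.

(** On the circle of radius [r] the mean of [1 / z] is [1 / r] times this integral, and it does not
    depend on [r]; comparing the radii 1 and 2 gives [x = x / 2]. *)
Lemma cint_eU_inv : cint (fun t => / eU t)%C = RtoC 0.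
Proof.
have HF : forall z, z <> RtoC 0 -> exists l, cdiff Cinv z l.
  by move=> z Hz; eexists; exact: cdiff_inv.
have Hs : forall r, 0 < r -> circ Cinv r = (/ r * cint (fun t => / eU t))%C.
  move=> r Hr; rewrite -cint_scal.
    apply: cint_ext => t _; have := eU_nz t => ne.
    by field; split=> // E; have := RtoC_inj _ _ E; lra.
  have := pcontall_circ Cinv 1 Rlt_0_1 (fun z Hz => cdiff_cont _ _ _ (cdiff_inv z Hz)).
  have -> // : (fun t => / (1 * eU t))%C = (fun t => / eU t)%C.
  by apply: functional_extensionality => t; rewrite Cmult_1_l.
have := circ_indep Cinv 1 2 HF Rlt_0_1 ltac:(lra).
rewrite !Hs; try lra.
move: (cint _) => x E.
have -> : x = (2 * (/ 1 * x - / 2 * x))%C by field.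
by rewrite E; ring.
Qed.

(** The difference quotient at [z] is holomorphic off 0 with limit [l], so its circular mean is [l].
    The subtracted constant [f z] contributes a multiple of the mean of [1 / eU], which is 0. *)
Theorem cauchy_deriv f z l r : holo f -> cdiff f z l -> 0 < r ->
  cint (fun t => f (z + r * eU t) / (r * eU t))%C = l.
Proof.
move=> Hf Hl Hr.
have Hq : forall w, w <> RtoC 0 -> exists m, cdiff (fun w => (f (z + w) - f z) * / w)%C w m.
  move=> w Hw; case: (Hf (z + w)%C) => m /cdiff_shift Hm; eexists.
  apply: cdiff_mult; last exact: cdiff_inv.
  apply: cdiff_minus; [exact: Hm|exact: cdiff_const].
rewrite -(circ_limit (fun w => (f (z + w) - f z) * / w)%C l r Hq Hr).
- have Hn : RtoC r <> RtoC 0 by move=> E; have := RtoC_inj _ _ E; lra.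
  have Hi : pcontall (fun t => / (r * eU t))%C.
    exact: (pcontall_circ Cinv r Hr (fun z Hz => cdiff_cont _ _ _ (cdiff_inv z Hz))).
  have H1 : pcontall (fun t => (f (z + r * eU t) - f z) * / (r * eU t))%C.
    apply: (pcontall_circ (fun w => (f (z + w) - f z) * / w)%C r Hr) => w Hw.
    by case: (Hq w Hw) => m; exact: cdiff_cont.
  transitivity (cint (fun t => (f (z + r * eU t) - f z) * / (r * eU t) + (f z / r) * / eU t)%C).
    apply: cint_ext => t _; have := eU_nz t => ne; by field.
  rewrite cint_plus //.
    rewrite (cint_scal (f z / r)%C).
      by rewrite cint_eU_inv /circ; ring.
    have := pcontall_scal r _ Hi.
    have -> // : (fun t => r * / (r * eU t))%C = (fun t => / eU t)%C.
    by apply: functional_extensionality => t; have := eU_nz t => ne; field.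
  apply: pcontall_scal.
  have := pcontall_scal r _ Hi.
  have -> // : (fun t => r * / (r * eU t))%C = (fun t => / eU t)%C.
  by apply: functional_extensionality => t; have := eU_nz t => ne; field.
- move=> e He; have [d [Hd Hd']] := Hl e He.
  exists d; split=> // w [Hw1 Hw2].
  have nw : w <> RtoC 0 by apply/Cmod_gt_0.
  have -> : ((f (z + w) - f z) * / w - l)%C = ((f (z + w) - f z - l * w) / w)%C by field.
  rewrite Cmod_div //; apply: (Rmult_le_reg_r (Cmod w)) => //.
  by rewrite /Rdiv Rmult_assoc Rinv_l; [rewrite Rmult_1_r; exact: Hd'|lra].
Qed.

(** * Cauchy's estimates and Liouville's theorem *)

Lemma ccont_unif f : (forall z, ccont f z) -> forall r e, 0 < e ->
  exists d, 0 < d /\ forall z w, Cmod z <= r -> Cmod w <= r -> Cmod (z - w)%C < d ->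
    Cmod (f z - f w)%C <= e.
Proof.
move=> Hf r e He.
have Hd : forall u v : R, exists d, 0 < d /\ forall h, Cmod h < d -> Cmod (f ((u, v) + h)%C - f (u, v))%C < e / 2.
  by move=> u v; apply: Hf; lra.
pose del u v := proj1_sig (constructive_indefinite_description _ (Hd u v)).
have delP : forall u v, 0 < del u v /\ forall h, Cmod h < del u v -> Cmod (f ((u, v) + h)%C - f (u, v))%C < e / 2.
  by move=> u v; rewrite /del; case: constructive_indefinite_description.
(* A quarter of the local radius: closeness in each coordinate puts [z] within half of it from
   [(u, v)], and the remaining half absorbs the distance from [z] to [w]. *)
have pos4 : forall u v, 0 < del u v / 4 by move=> u v; case: (delP u v); lra.
have [d Hd'] := compactness_value_2d (- r) r (- r) r (fun u v => mkposreal _ (pos4 u v)).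
exists d; split; first exact: cond_pos.
move=> z w Hz Hw Hzw.
have Hbox : forall z, Cmod z <= r -> - r <= Re z <= r /\ - r <= Im z <= r.
  move=> x Hx; have := re_le_Cmod x; have := im_le_Cmod x => h1 h2.
  by split; apply/Rabs_le_between; lra.
have [b1 b2] := Hbox z Hz.
apply: NNPP => N; apply: (Hd' _ _ b1 b2) => -[u [v [_ [_ [h1 [h2 h3]]]]]]; apply: N.
rewrite /= in h1 h2 h3.
have [dp dq] := delP u v.
have k1 : Cmod (z - (u, v))%C < del u v / 2.
  apply: Rle_lt_trans (Cmod_le_abs _) _; rewrite re_minus im_minus /=; lra.
have k2 : Cmod (w - (u, v))%C < del u v.
  have := Cmod_triangle (w - z)%C (z - (u, v))%C; replace (w - z + (z - (u, v)))%C with (w - (u, v))%C by ring.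
  rewrite (Cmod_minus_sym w z); lra.
have j1 := dq (z - (u, v))%C ltac:(lra); have j2 := dq (w - (u, v))%C k2.
replace ((u, v) + (z - (u, v)))%C with z in j1 by ring.
replace ((u, v) + (w - (u, v)))%C with w in j2 by ring.
have := Cmod_triangle (f z - f (u, v))%C (f (u, v) - f w)%C.
rewrite (Cmod_minus_sym (f (u, v)) (f w)).
replace (f z - f (u, v) + (f (u, v) - f w))%C with (f z - f w)%C by ring; lra.
Qed.

(** Uniform continuity bounds [f] along the segment from 0 to [z]: [N] equal steps, each shorter
    than [d], change the value by at most 1 each. *)
Lemma ccont_bounded f : (forall z, ccont f z) -> forall r,
  exists B, 0 <= B /\ forall z, Cmod z <= r -> Cmod (f z) <= B.
Proof.
move=> Hf r.
have [d [Hd Hd']] := ccont_unif f Hf r 1 Rlt_0_1.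
case: (Rle_lt_dec r 0) => Hr.
  exists (Cmod (f (RtoC 0))); split; first exact: Cmod_ge_0.
  move=> z Hz; have -> : z = RtoC 0 by apply: Cmod_eq_0; have := Cmod_ge_0 z; lra.
  exact: Rle_refl.
have [N [HN1 HN2]] := archimed_cor1 (d / r) ltac:(apply: Rdiv_lt_0_compat; lra).
have pN : 0 < INR N by apply: lt_0_INR.
exists (Cmod (f (RtoC 0)) + INR N); split; first by have := Cmod_ge_0 (f (RtoC 0)); lra.
move=> z Hz.
have key : forall k, (k <= N)%nat -> Cmod (f ((INR k / INR N)%R * z)%C) <= Cmod (f (RtoC 0)) + INR k.
  elim=> [|k IH] Hk.
    rewrite /= /Rdiv Rmult_0_l Cmult_0_l; lra.
  have {IH} IH := IH ltac:(lia).
  have Hk1 : INR k + 1 <= INR N by rewrite -S_INR; apply: le_INR.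
  have pk := pos_INR k.
  have E1 : (INR (S k) / INR N)%R = INR k / INR N + / INR N by rewrite S_INR; field; lra.
  have b0 : 0 <= INR k / INR N by apply: Rmult_le_pos; [|apply: Rlt_le; apply: Rinv_0_lt_compat].
  have b1 : INR (S k) / INR N <= 1.
    by rewrite S_INR; apply: (Rmult_le_reg_r (INR N)) => //; rewrite /Rdiv Rmult_assoc Rinv_l; lra.
  have pin : 0 < / INR N by apply: Rinv_0_lt_compat.
  have g := Cmod_ge_0 z.
  have c1 : Cmod ((INR k / INR N)%R * z)%C <= r by rewrite Cmod_mult Cmod_R Rabs_pos_eq; nra.
  have c2 : Cmod ((INR (S k) / INR N)%R * z)%C <= r by rewrite Cmod_mult Cmod_R Rabs_pos_eq; nra.
  have c3 : Cmod ((INR (S k) / INR N)%R * z - (INR k / INR N)%R * z)%C < d.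
    replace ((INR (S k) / INR N)%R * z - (INR k / INR N)%R * z)%C with (RtoC (/ INR N) * z)%C
      by (rewrite E1 RtoC_plus; ring).
    rewrite Cmod_mult Cmod_R Rabs_pos_eq; last lra.
    apply: (Rle_lt_trans _ (/ INR N * r)); first by apply: Rmult_le_compat_l; lra.
    have -> : d = d / r * r by field; lra.
    exact: Rmult_lt_compat_r.
  have := Hd' _ _ c2 c1 c3.
  have := Cmod_le_plus (f ((INR (S k) / INR N)%R * z)%C) (f ((INR k / INR N)%R * z)%C).
  rewrite (S_INR k); lra.
have := key N (Nat.le_refl N).
have -> : INR N / INR N = 1 by field; lra.
by rewrite Cmult_1_l.
Qed.

Notation Cd := C_derive.

Lemma Cd_unique f z l : cdiff f z l -> Cd f z = l.
Proof. by move=> /is_cderivP; exact: is_C_derive_unique. Qed.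

Lemma cdiff_Cd f z : holo f -> cdiff f z (Cd f z).
Proof. by move=> Hf; case: (Hf z) => l Hl; rewrite (Cd_unique _ _ _ Hl). Qed.

Lemma RtoC_nz x : x <> 0 -> RtoC x <> RtoC 0.
Proof. by move=> H E; apply: H; exact: RtoC_inj. Qed.

Lemma pcontall_on_circle f z r : (forall z, ccont f z) -> pcontall (fun t => f (z + r * eU t)%C).
Proof.
move=> Hf s; apply: (pcont_ccont f (fun t => z + r * eU t)%C) => //.
have := pcontall_plus _ _ (pcontall_const z) (pcontall_scal r _ pcontall_eU); exact.
Qed.

Lemma pcontall_Cinv g : pcontall g -> (forall t, g t <> RtoC 0) -> pcontall (fun t => / g t)%C.
Proof.
move=> Hg nz s; apply: (pcont_ccont Cinv) => //.
by apply: cdiff_cont; exact: cdiff_inv.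
Qed.

Lemma circle_nz r t : 0 < r -> (r * eU t)%C <> RtoC 0.
Proof. by move=> Hr; apply/Cmod_gt_0; rewrite Cmod_circ. Qed.

Lemma pcontall_cauchy f z r : (forall z, ccont f z) -> 0 < r ->
  pcontall (fun t => f (z + r * eU t) / (r * eU t))%C.
Proof.
move=> Hf Hr; apply: pcontall_mult; first exact: pcontall_on_circle.
apply: pcontall_Cinv; first by apply: pcontall_scal; exact: pcontall_eU.
by move=> t; exact: circle_nz.
Qed.

Lemma cauchy_bound f z l r B : holo f -> cdiff f z l -> 0 < r ->
  (forall w, Cmod (w - z)%C = r -> Cmod (f w) <= B) -> Cmod l <= B / r.
Proof.
move=> Hf Hl Hr HB; rewrite -(cauchy_deriv f z l r Hf Hl Hr).
apply: cint_bound.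
  by apply: pcontall_cauchy => // w; exact: holo_ccont.
move=> t _; rewrite Cmod_div; last exact: circle_nz.
rewrite Cmod_circ //; apply: Rmult_le_compat_r; first by apply: Rlt_le; exact: Rinv_0_lt_compat.
by apply: HB; replace (z + r * eU t - z)%C with (r * eU t)%C by ring; exact: Cmod_circ.
Qed.

Lemma Cmod_sum_le z w a b : Cmod z <= a -> Cmod w <= b -> Cmod (z + w)%C <= a + b.
Proof. by move=> h1 h2; have := Cmod_triangle z w; lra. Qed.

Lemma convex_ball z w r s : 0 <= s <= 1 -> Cmod z <= r -> Cmod w <= r ->
  Cmod (z + s * (w - z))%C <= r.
Proof.
move=> Hs Hz Hw; have := convex_dist (RtoC 0) z w r s Hs.
replace (z - 0)%C with z by ring; replace (w - 0)%C with w by ring.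
replace (z + s * (w - z) - 0)%C with (z + s * (w - z))%C by ring.
exact.
Qed.

(** Each stage costs one unit of radius: a bound for [f] on radius [r + 2] bounds the derivative on
    [r + 1], hence [f] is Lipschitz there, and the difference of two Cauchy integrals over unit
    circles transfers the same constant to the derivative on radius [r]. *)
Lemma Cd_lipschitz f : holo f -> forall r, exists B, 0 <= B /\
  forall z w, Cmod z <= r -> Cmod w <= r -> Cmod (Cd f z - Cd f w)%C <= B * Cmod (z - w)%C.
Proof.
move=> Hf r.
have Hc : forall z, ccont f z by move=> z; exact: holo_ccont.
have [B [HB0 HB]] := ccont_bounded f Hc (r + 2).
exists B; split=> // z w Hz Hw.
have H1 : forall z, Cmod z <= r + 1 -> Cmod (Cd f z) <= B.
  move=> x Hx; have := cauchy_bound f x _ 1 B Hf (cdiff_Cd f x Hf) Rlt_0_1; rewrite Rdiv_1_r; apply.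
  move=> y Hy; apply: HB; have := Cmod_sum_le _ _ _ _ Hx (Req_le _ _ Hy).
  by replace (x + (y - x))%C with y by ring; lra.
have H2 : forall z w, Cmod z <= r + 1 -> Cmod w <= r + 1 -> Cmod (f z - f w)%C <= B * Cmod (z - w)%C.
  move=> x y Hx Hy; have := seg_mvi f (Cd f) y (x - y)%C B.
  replace (y + (x - y))%C with x by ring; apply.
    by move=> s _; exact: cdiff_Cd.
  by move=> s Hs; apply: H1; exact: convex_ball.
have e1 := cauchy_deriv f z _ 1 Hf (cdiff_Cd f z Hf) Rlt_0_1.
have e2 := cauchy_deriv f w _ 1 Hf (cdiff_Cd f w Hf) Rlt_0_1.
have p1 := pcontall_cauchy f z 1 Hc Rlt_0_1.
have p2 := pcontall_cauchy f w 1 Hc Rlt_0_1.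
rewrite -e1 -e2 -cint_minus //; apply: cint_bound.
  have := pcontall_plus _ _ p1 (pcontall_scal (- (1))%C _ p2).
  have -> // : (fun t => f (z + 1 * eU t) / (1 * eU t) + - (1) * (f (w + 1 * eU t) / (1 * eU t)))%C =
            (fun t => f (z + 1 * eU t) / (1 * eU t) - f (w + 1 * eU t) / (1 * eU t))%C.
  by apply: functional_extensionality => t; ring.
move=> t _.
have nz := eU_nz t.
have -> : (f (z + 1 * eU t) / (1 * eU t) - f (w + 1 * eU t) / (1 * eU t))%C =
  ((f (z + eU t) - f (w + eU t)) / eU t)%C by rewrite !Cmult_1_l; field.
rewrite Cmod_div // Cmod_eU Rdiv_1_r.
have := H2 (z + eU t)%C (w + eU t)%C.
replace (z + eU t - (w + eU t))%C with (z - w)%C by ring; apply;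
  by apply: Cmod_sum_le => //; rewrite Cmod_eU; lra.
Qed.

Lemma ccont_Cd f z : holo f -> ccont (Cd f) z.
Proof.
move=> Hf e He; have [B [HB0 HB]] := Cd_lipschitz f Hf (Cmod z + 1).
exists (Rmin 1 (e / (B + 1))); split.
  by apply: Rmin_pos; [lra|apply: Rdiv_lt_0_compat; lra].
move=> h Hh.
have [h1 h2] := Rmin_Rgt_l _ _ _ Hh.
apply: (Rle_lt_trans _ (B * Cmod h)).
  have := HB (z + h)%C z; replace (z + h - z)%C with h by ring; apply; last lra.
  by apply: Cmod_sum_le; lra.
have -> : e = (B + 1) * (e / (B + 1)) by field; lra.
have := Cmod_ge_0 h; have : 0 < e / (B + 1) by apply: Rdiv_lt_0_compat; lra.
nra.
Qed.

(** The remainder is uniform on discs, which is what differentiation under Cauchy's integral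
    requires. *)
Lemma taylor1 f : holo f -> forall r, exists B, 0 <= B /\
  forall z h, Cmod z <= r -> Cmod (z + h)%C <= r ->
  Cmod (f (z + h) - f z - Cd f z * h)%C <= B * (Cmod h * Cmod h).
Proof.
move=> Hf r; have [B [HB0 HB]] := Cd_lipschitz f Hf r.
exists B; split=> // z h Hz Hzh.
have Hd : forall w, cdiff (fun w => f w - Cd f z * w)%C w (Cd f w - Cd f z)%C.
  move=> w; have := cdiff_minus _ _ _ _ _ (cdiff_Cd f w Hf) (cdiff_scal (Cd f z) _ _ _ (cdiff_id w)).
  by rewrite Cmult_1_r.
have := seg_mvi (fun w => f w - Cd f z * w)%C (fun w => Cd f w - Cd f z)%C z h (B * Cmod h).
replace (f (z + h) - Cd f z * (z + h) - (f z - Cd f z * z))%C with (f (z + h) - f z - Cd f z * h)%C by ring.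
rewrite Rmult_assoc; apply; first by move=> s _; exact: Hd.
move=> s Hs.
have Hb : Cmod (z + s * h)%C <= r.
  by have := convex_ball z (z + h)%C r s Hs Hz Hzh; replace (z + h - z)%C with h by ring.
apply: Rle_trans (HB _ _ Hb Hz) _; apply: Rmult_le_compat_l => //.
replace (z + s * h - z)%C with (s * h)%C by ring.
rewrite Cmod_mult Cmod_R Rabs_pos_eq; last lra.
by have := Cmod_ge_0 h; nra.
Qed.

(** The candidate for the second derivative is Cauchy's integral of the first. The three Cauchy
    integrals combine into one whose integrand is a first-order Taylor remainder of [f]. *)
Theorem holo_Cd f : holo f -> holo (Cd f).
Proof.
move=> Hf z.
have Hc : forall z, ccont f z by move=> w; exact: holo_ccont.
have Hc' : forall z, ccont (Cd f) z by move=> w; exact: ccont_Cd.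
exists (cint (fun t => Cd f (z + 1 * eU t) / (1 * eU t))%C) => e He.
have [B [HB0 HB]] := taylor1 f Hf (Cmod z + 2).
exists (Rmin 1 (e / (B + 1))); split.
  by apply: Rmin_pos; [lra|apply: Rdiv_lt_0_compat; lra].
move=> h Hh.
have [h1 h2] := Rmin_Rgt_l _ _ _ Hh.
have e1 := cauchy_deriv f z _ 1 Hf (cdiff_Cd f z Hf) Rlt_0_1.
have e2 := cauchy_deriv f (z + h)%C _ 1 Hf (cdiff_Cd f (z + h)%C Hf) Rlt_0_1.
have p1 := pcontall_cauchy f z 1 Hc Rlt_0_1.
have p2 := pcontall_cauchy f (z + h)%C 1 Hc Rlt_0_1.
have p3 := pcontall_cauchy (Cd f) z 1 Hc' Rlt_0_1.
have p4 : pcontall (fun t => f (z + h + 1 * eU t) / (1 * eU t) + (- (1)) * (f (z + 1 * eU t) / (1 * eU t)))%C.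
  by apply: pcontall_plus => //; exact: pcontall_scal.
have E : (Cd f (z + h) - Cd f z - cint (fun t => Cd f (z + 1 * eU t) / (1 * eU t)) * h)%C =
  cint (fun t => (f (z + h + 1 * eU t) / (1 * eU t) + (- (1)) * (f (z + 1 * eU t) / (1 * eU t))) +
    (- h) * (Cd f (z + 1 * eU t) / (1 * eU t)))%C.
  rewrite cint_plus //; last exact: pcontall_scal.
  rewrite cint_plus //; last exact: pcontall_scal.
  rewrite !cint_scal // -{1}e1 -{1}e2; ring.
rewrite E; apply: (Rle_trans _ (B * (Cmod h * Cmod h))).
  apply: cint_bound.
    by apply: pcontall_plus => //; exact: pcontall_scal.
  move=> t _; have nz := eU_nz t.
  have -> : (f (z + h + 1 * eU t) / (1 * eU t) + - (1) * (f (z + 1 * eU t) / (1 * eU t)) +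
     - h * (Cd f (z + 1 * eU t) / (1 * eU t)))%C =
     ((f (z + eU t + h) - f (z + eU t) - Cd f (z + eU t) * h) / eU t)%C.
    rewrite !Cmult_1_l; replace (z + eU t + h)%C with (z + h + eU t)%C by ring; field => //.
  rewrite Cmod_div // Cmod_eU Rdiv_1_r; apply: HB.
    by apply: Cmod_sum_le; rewrite ?Cmod_eU; lra.
  replace (z + eU t + h)%C with (z + (eU t + h))%C by ring.
  apply: Cmod_sum_le; first lra.
  by replace 2 with (1 + 1) by ring; apply: Cmod_sum_le; rewrite ?Cmod_eU; lra.
have g := Cmod_ge_0 h.
have -> : e = (B + 1) * (e / (B + 1)) by field; lra.
have : 0 < e / (B + 1) by apply: Rdiv_lt_0_compat; lra.
move: (e / (B + 1)) h2 => k h2 pk.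
have k1 : Cmod h * Cmod h <= k * Cmod h by apply: Rmult_le_compat_r; lra.
have k2 : 0 <= k * Cmod h by nra.
nra.
Qed.

Lemma Cd0_const f : holo f -> (forall z, Cd f z = RtoC 0) -> forall z, f z = f (RtoC 0).
Proof.
move=> Hf H0 z.
have := seg_mvi f (Cd f) (RtoC 0) z 0; rewrite Cplus_0_l Rmult_0_l => H.
apply/Ceq_minus; apply: Cmod_eq_0; apply: Rle_antisym; last exact: Cmod_ge_0.
apply: H; first by move=> s _; exact: cdiff_Cd.
by move=> s _; rewrite H0 Cmod_0; lra.
Qed.

Lemma liouville f B : holo f -> (forall z, Cmod (f z) <= B) -> forall z, f z = f (RtoC 0).
Proof.
move=> Hf HB; apply: Cd0_const => // z; apply: Cmod_eq0_le => e He.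
have pB : 0 <= B by apply: Rle_trans (HB z); exact: Cmod_ge_0.
have Hr : 0 < (B + 1) / e by apply: Rdiv_lt_0_compat; lra.
apply: Rle_trans (cauchy_bound f z _ _ B Hf (cdiff_Cd f z Hf) Hr (fun w _ => HB w)) _.
have -> : B / ((B + 1) / e) = e * (B / (B + 1)) by field; lra.
have : B / (B + 1) <= 1 by apply: (Rmult_le_reg_r (B + 1)); [lra|rewrite /Rdiv Rmult_assoc Rinv_l; lra].
by nra.
Qed.

(** Cauchy's estimate on discs of radius [|z| + 1] bounds the derivative, which is then constant by
    Liouville's theorem. *)
Lemma liouville_linear f A B : holo f -> 0 <= A -> 0 <= B -> (forall z, Cmod (f z) <= A + B * Cmod z) ->
  exists a, forall z, f z = (a * z + f (RtoC 0))%C.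
Proof.
move=> Hf HA HB H.
have H1 : forall z, Cmod (Cd f z) <= A + 2 * B.
  move=> z; have g := Cmod_ge_0 z.
  apply: Rle_trans (cauchy_bound f z _ (Cmod z + 1) (A + B * (Cmod z + (Cmod z + 1))) Hf (cdiff_Cd f z Hf) ltac:(lra) _) _.
    move=> w Hw; apply: Rle_trans (H w) _; apply: Rplus_le_compat_l; apply: Rmult_le_compat_l => //.
    by rewrite -Hw; exact: Cmod_le_plus.
  apply: (Rmult_le_reg_r (Cmod z + 1)); first lra.
  by rewrite /Rdiv Rmult_assoc Rinv_l; nra.
have H2 := liouville (Cd f) _ (holo_Cd f Hf) H1.
exists (Cd f (RtoC 0)) => z.
have Hd : forall w, cdiff (fun w => f w - Cd f (RtoC 0) * w)%C w (RtoC 0).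
  move=> w; have := cdiff_minus _ _ _ _ _ (cdiff_Cd f w Hf) (cdiff_scal (Cd f (RtoC 0)) _ _ _ (cdiff_id w)).
  by rewrite Cmult_1_r H2; replace (Cd f 0 - Cd f 0)%C with (RtoC 0) by ring.
have := Cd0_const (fun w => f w - Cd f (RtoC 0) * w)%C (fun w => ex_intro _ _ (Hd w)) (fun w => Cd_unique _ _ _ (Hd w)) z.
rewrite Cmult_0_r => E.
have -> : f z = (f z - Cd f 0 * z + Cd f 0 * z)%C by ring.
rewrite E; ring.
Qed.

(** Division by [z] with the removable singularity filled in. Away from 0 this is the quotient rule;
    at 0 the derivative of the quotient is half the second derivative of [f]. *)
Lemma holo_slope0 f : holo f -> exists q, holo q /\ forall z, f z = (f (RtoC 0) + q z * z)%C.
Proof.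
move=> Hf.
pose l0 := Cd f (RtoC 0); pose l1 := Cd (Cd f) (RtoC 0).
pose q z := if Ceq_dec z (RtoC 0) then l0 else ((f z - f (RtoC 0)) / z)%C.
have q0 : q (RtoC 0) = l0 by rewrite /q; case: Ceq_dec.
have qn : forall z, z <> RtoC 0 -> q z = ((f z - f (RtoC 0)) * / z)%C by move=> z Hz; rewrite /q; case: Ceq_dec.
exists q; split; last first.
  move=> z; case: (Ceq_dec z (RtoC 0)) => [->|Hz]; first by ring.
  by rewrite qn //; field.
move=> z; case: (Ceq_dec z (RtoC 0)) => [->|Hz]; last first.
  have pz : 0 < Cmod z by apply/Cmod_gt_0.
  exists (Cd f z * / z + (f z - f (RtoC 0)) * (- (/ z * / z)))%C.
  apply: (cdiff_ext_loc (fun z => (f z - f (RtoC 0)) * / z)%C _ z _ (Cmod z)) => //.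
    move=> w Hw; rewrite qn //; apply/Cmod_gt_0.
    by have := Cmod_le_plus z w; rewrite Cmod_minus_sym; lra.
  apply: cdiff_mult; last exact: cdiff_inv.
  have := cdiff_minus _ _ _ _ _ (cdiff_Cd f z Hf) (cdiff_const (f (RtoC 0)) z).
  by replace (Cd f z - 0)%C with (Cd f z) by ring.
exists (l1 / 2)%C => e He.
have [d [Hd Hd']] := cdiff_Cd (Cd f) (RtoC 0) (holo_Cd f Hf) e He.
exists d; split=> // h Hh; rewrite Cplus_0_l q0.
case: (Ceq_dec h (RtoC 0)) => [->|Hh0].
  by rewrite q0; replace (l0 - l0 - l1 / 2 * 0)%C with (RtoC 0) by ring; rewrite Cmod_0; lra.
have ph : 0 < Cmod h by apply/Cmod_gt_0.
(* Subtracting the second-order Taylor part leaves a derivative of size [o(w)], hence [g h - g 0] of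
   size [o(h^2)], and dividing by [h] gives the expansion of [q]. *)
pose g w := (f w - (l0 * w + l1 / 2 * (w * w)))%C.
have Hg : forall w, cdiff g w (Cd f w - (l0 + l1 * w))%C.
  move=> w; apply: cdiff_minus; first exact: cdiff_Cd.
  have := cdiff_plus _ _ _ _ _ (cdiff_scal l0 _ _ _ (cdiff_id w))
    (cdiff_scal (l1 / 2)%C _ _ _ (cdiff_mult _ _ _ _ _ (cdiff_id w) (cdiff_id w))).
  by replace (l0 * 1 + l1 / 2 * (1 * w + w * 1))%C with (l0 + l1 * w)%C by field.
have := seg_mvi g (fun w => Cd f w - (l0 + l1 * w))%C (RtoC 0) h (e * Cmod h).
rewrite Cplus_0_l => /(_ _ _) H.
have {H} : Cmod (g h - g (RtoC 0))%C <= e * Cmod h * Cmod h.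
  apply: H; first by move=> s _; exact: Hg.
  move=> s Hs; rewrite Cplus_0_l.
  have hs : Cmod (s * h)%C <= Cmod h by rewrite Cmod_mult Cmod_R Rabs_pos_eq; nra.
  have := Hd' (s * h)%C ltac:(lra); rewrite Cplus_0_l -/l0 -/l1.
  replace (Cd f (s * h) - l0 - l1 * (s * h))%C with (Cd f (s * h) - (l0 + l1 * (s * h)))%C by ring.
  by move=> h1; apply: Rle_trans h1 _; apply: Rmult_le_compat_l; lra.
rewrite qn //.
have -> : (g h - g (RtoC 0))%C = (((f h - f (RtoC 0)) * / h - l0 - l1 / 2 * h) * h)%C by rewrite /g; field.
rewrite Cmod_mult => H1.
by apply: (Rmult_le_reg_r (Cmod h)).
Qed.

Lemma holo_slope f c : holo f -> exists q, holo q /\ forall z, f z = (f c + q z * (z - c))%C.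
Proof.
move=> Hf; have [q [Hq E]] := holo_slope0 _ (holo_comp_affine f c (RtoC 1) Hf).
exists (fun z => q (- c + 1 * z)%C); split; first exact: holo_comp_affine.
move=> z; have := E (- c + 1 * z)%C.
have -> : (c + 1 * (- c + 1 * z))%C = z by ring.
have -> : (c + 1 * 0)%C = c by ring.
by move=> ->; ring.
Qed.

(** * Cauchy's formula at an arbitrary point of a disc and the identity principle *)

Definition cauchy_kernel (rho : R) (h : C) (t : R) : C := (rho * eU t / (rho * eU t - h))%C.

Lemma cauchy_kernel_nz rho h t : Cmod h < rho -> (rho * eU t - h)%C <> RtoC 0.
Proof.
move=> Hh E; have p := Cmod_ge_0 h.
have := Cmod_circ rho t ltac:(lra).
have -> : (rho * eU t)%C = (rho * eU t - h + h)%C by ring.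
by rewrite E Cplus_0_l; lra.
Qed.

Lemma pcontall_cauchy_kernel rho h : Cmod h < rho -> pcontall (cauchy_kernel rho h).
Proof.
move=> Hh; have pe := pcontall_scal rho _ pcontall_eU.
apply: pcontall_mult => //; apply: pcontall_Cinv; last by move=> t; exact: cauchy_kernel_nz.
exact: (pcontall_plus _ _ pe (pcontall_const (- h)%C)).
Qed.

Lemma Cmod_cauchy_kernel rho h t : Cmod h < rho -> Cmod (cauchy_kernel rho h t) <= rho / (rho - Cmod h).
Proof.
move=> Hh; have p := Cmod_ge_0 h.
rewrite /cauchy_kernel Cmod_div ?Cmod_circ; [|lra|exact: cauchy_kernel_nz].
apply: Rmult_le_compat_l; first lra.
apply: Rinv_le_contravar; first lra.
have := Cmod_le_plus (rho * eU t)%C h; rewrite Cmod_circ; lra.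
Qed.

(* The integral is in fact 1; Re (1 / (1 - w)) >= 1 / 2 for |w| < 1 gives a sufficient bound. *)
Lemma cint_cauchy_kernel_ge rho h : Cmod h < rho -> / 2 <= Cmod (cint (cauchy_kernel rho h)).
Proof.
move=> Hh; have p := Cmod_ge_0 h.
have Hk := pcontall_cauchy_kernel rho h Hh.
suff H : / 2 <= Re (cint (cauchy_kernel rho h)).
  by have := re_le_Cmod (cint (cauchy_kernel rho h)); have := Rle_abs (Re (cint (cauchy_kernel rho h))); lra.
have -> : / 2 = RInt (fun=> / 2) 0 1.
  by rewrite RInt_const /scal /= /mult /=; field.
apply: RInt_le; [lra|exact: ex_RInt_const|exact: ex_RInt_re|].
move=> t _.
have nk := cauchy_kernel_nz rho h t Hh.
set u := (rho * eU t - h)%C in nk.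
have E : cauchy_kernel rho h t = ((rho * eU t * Cconj u) * / RtoC (Cmod u ^ 2))%C.
  rewrite Cmod2_conj /cauchy_kernel -/u; field; split => //.
  by apply/Cmod_gt_0; rewrite Cmod_conj; apply/Cmod_gt_0.
have pu : 0 < Cmod u by apply/Cmod_gt_0.
have pu2 : 0 < Cmod u ^ 2 by nra.
rewrite E -RtoC_inv; last lra.
rewrite re_scal_r.
apply: (Rmult_le_reg_r (Cmod u ^ 2)) => //; rewrite Rmult_assoc Rinv_l; last lra.
have e1 : Cmod u ^ 2 = Re u ^ 2 + Im u ^ 2 := Cmod2_alt u.
have e2 : Cmod (rho * eU t)%C ^ 2 = Re (rho * eU t)%C ^ 2 + Im (rho * eU t)%C ^ 2 := Cmod2_alt _.
have e3 : Cmod h ^ 2 = Re h ^ 2 + Im h ^ 2 := Cmod2_alt _.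
rewrite Cmod_circ in e2; last lra.
have e4 : Re u = Re (rho * eU t)%C - Re h by rewrite /u re_minus.
have e5 : Im u = Im (rho * eU t)%C - Im h by rewrite /u im_minus.
rewrite re_mult re_conj im_conj.
move: (Re (rho * eU t)%C) (Im (rho * eU t)%C) (Re u) (Im u) (Re h) (Im h) e1 e2 e3 e4 e5 => a b c d x y e1 e2 e3 e4 e5.
have : Cmod h ^ 2 <= rho ^ 2 by nra.
subst c d; nra.
Qed.

(** The kernel is [z / (z - h)]. With [f z = f h + q z * (z - h)], the second part contributes the
    circular mean of [q z * z], which is its value 0 at the centre. The mean of the kernel itself
    stays as a factor. *)
Lemma cauchy_formula f rho h : holo f -> Cmod h < rho ->
  cint (fun t => f (rho * eU t) * cauchy_kernel rho h t)%C = (f h * cint (cauchy_kernel rho h))%C.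
Proof.
move=> Hf Hh; have ph := Cmod_ge_0 h; have Hk := pcontall_cauchy_kernel rho h Hh.
have r0 : 0 < rho by lra.
have [q [Hq E]] := holo_slope f h Hf.
have Hg : holo (fun z => q z * z)%C.
  by move=> z; case: (Hq z) => l Hl; eexists; apply: cdiff_mult; [exact: Hl|exact: cdiff_id].
have pg : pcontall (fun t => q (rho * eU t) * (rho * eU t))%C.
  by apply: (pcontall_circ (fun z => q z * z)%C) => // z _; exact: holo_ccont.
have m0 : cint (fun t => q (rho * eU t) * (rho * eU t))%C = RtoC 0.
  have := mean_value _ (RtoC 0) rho Hg r0; rewrite Cmult_0_r => <-.
  by apply: cint_ext => t _; rewrite Cplus_0_l.
rewrite -[RHS]Cplus_0_r -m0 -cint_scal // -cint_plus //; last exact: pcontall_scal.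
apply: cint_ext => t _; rewrite E /cauchy_kernel; field; exact: cauchy_kernel_nz.
Qed.

(** A crude maximum principle; the factor 2 is the inverse of the lower bound [1 / 2] for the mean
    of the kernel. *)
Lemma sup_circle_bound f rho h B : holo f -> Cmod h < rho ->
  (forall z, Cmod z = rho -> Cmod (f z) <= B) ->
  Cmod (f h) <= 2 * (rho / (rho - Cmod h)) * B.
Proof.
move=> Hf Hh HB; have ph := Cmod_ge_0 h.
have Hc : forall z, ccont f z by move=> w; exact: holo_ccont.
have Hk := pcontall_cauchy_kernel rho h Hh.
have h1 : Cmod (f h * cint (cauchy_kernel rho h))%C <= B * (rho / (rho - Cmod h)).
  rewrite -cauchy_formula //; apply: cint_bound.
    apply: pcontall_mult => //.
    have := pcontall_on_circle f (RtoC 0) rho Hc.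
    have -> // : (fun t => f (0 + rho * eU t)%C) = (fun t => f (rho * eU t)%C).
    by apply: functional_extensionality => t; rewrite Cplus_0_l.
  move=> t _; rewrite Cmod_mult; apply: Rmult_le_compat; try exact: Cmod_ge_0.
    by apply: HB; apply: Cmod_circ; lra.
  exact: Cmod_cauchy_kernel.
rewrite Cmod_mult in h1.
have h2 := cint_cauchy_kernel_ge rho h Hh.
have := Cmod_ge_0 (f h); nra.
Qed.

(** Since [f] vanishes near 0, every quotient [f z / z^n] is entire. Comparing its value at [h] with
    its size on the circle of radius [2 |h|] gains a factor [1 / 2^n], and [n] is arbitrary. *)
Theorem identity_principle f r : holo f -> 0 < r -> (forall z, Cmod z < r -> f z = RtoC 0) ->
  forall z, f z = RtoC 0.
Proof.
move=> Hf Hr H0 h.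
case: (Ceq_dec h (RtoC 0)) => [->|Hh]; first by apply: H0; rewrite Cmod_0.
have ph : 0 < Cmod h by apply/Cmod_gt_0.
have Hc : forall z, ccont f z by move=> w; exact: holo_ccont.
have [B [HB0 HB]] := ccont_bounded f Hc (2 * Cmod h).
pose Q n z := (f z * (/ z) ^ n)%C.
have HQ : forall n, holo (Q n).
  move=> n z; case: (Ceq_dec z (RtoC 0)) => Hz.
    exists (RtoC 0); apply: (cdiff_ext_loc (fun=> RtoC 0) _ z _ r Hr); last exact: cdiff_const.
    by move=> w; rewrite Hz => Hw; rewrite /Q H0 ?Cmult_0_l //; replace w with (w - 0)%C by ring.
  have [l Hl] : exists l, cdiff (fun z => (/ z) ^ n)%C z l.
    elim: n => [|n [l Hl]]; first by exists (RtoC 0); exact: cdiff_const.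
    by eexists; apply: (cdiff_mult Cinv (fun z => (/ z) ^ n)%C); [exact: cdiff_inv|exact: Hl].
  by eexists; apply: cdiff_mult; [exact: cdiff_Cd|exact: Hl].
have p2 : forall n, 0 < 2 ^ n by move=> n; apply: pow_lt; lra.
have key : forall n, Cmod (f h) <= 4 * B / 2 ^ n.
  move=> n.
  have := sup_circle_bound (Q n) (2 * Cmod h) h (B * / (2 * Cmod h) ^ n) (HQ n) ltac:(lra).
  have -> : 2 * (2 * Cmod h / (2 * Cmod h - Cmod h)) = 4 by field; lra.
  rewrite /Q Cmod_mult Cmod_pow Cmod_inv // pow_inv => H.
  have pn : 0 < Cmod h ^ n by apply: pow_lt.
  apply: (Rmult_le_reg_r (/ Cmod h ^ n)); first exact: Rinv_0_lt_compat.
  have -> : 4 * B / 2 ^ n * / Cmod h ^ n = 4 * (B * / (2 * Cmod h) ^ n).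
    by rewrite Rpow_mult_distr; field; split; [lra|have := p2 n; lra].
  apply: H => z Hz.
  have nz : z <> RtoC 0 by apply/Cmod_gt_0; lra.
  rewrite Cmod_mult Cmod_pow Cmod_inv // Hz pow_inv; apply: Rmult_le_compat_r; last by apply: HB; lra.
  by apply: Rlt_le; apply: Rinv_0_lt_compat; apply: pow_lt; lra.
apply: Cmod_eq0_le => e He.
have [n HN] := pow_lt_1_zero (/ 2) ltac:(rewrite Rabs_pos_eq; lra) (e / (4 * B + 1)) ltac:(apply: Rdiv_lt_0_compat; lra).
have := HN n (Nat.le_refl n).
rewrite Rabs_pos_eq; last by apply: pow_le; lra.
rewrite pow_inv => h1.
have h3 : / 2 ^ n * (4 * B + 1) < e.
  have -> : e = e / (4 * B + 1) * (4 * B + 1) by field; lra.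
  by apply: Rmult_lt_compat_r; lra.
have := key n; have : 0 < / 2 ^ n by apply: Rinv_0_lt_compat.
rewrite /Rdiv; nra.
Qed.

(** * Transport equations and one-sided growth bounds *)

(** A form of [(1 + 1 / n)^n <= exp 1 <= 3]. It measures the loss in the weight [(1 - |z|)^n] when
    [z] moves by [(1 - |z|) / (n + 1)], and is the source of the 3 in the next lemma. *)
Lemma three_pow_ratio n : 1 <= 3 * (INR n / (INR n + 1)) ^ n.
Proof.
case: n => [|n]; first by simpl; lra.
set m := S n.
have pm : 0 < INR m by apply: lt_0_INR; rewrite /m; lia.
have pq : 0 < INR m / (INR m + 1) by apply: Rdiv_lt_0_compat; lra.
have H : (/ (INR m / (INR m + 1))) ^ m <= 3.
  apply: (Rle_trans _ (exp (/ INR m) ^ m)).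
    apply: pow_incr; split; first by apply: Rlt_le; exact: Rinv_0_lt_compat.
    have -> : / (INR m / (INR m + 1)) = 1 + / INR m by field; lra.
    exact: exp_ineq1_le.
  have -> : forall k x, exp x ^ k = exp (INR k * x).
    elim=> [|k IH] x; first by rewrite /= Rmult_0_l exp_0.
    by rewrite S_INR /= IH -exp_plus; congr exp; ring.
  rewrite Rinv_r; last lra.
  exact: exp_le_3.
rewrite pow_inv in H.
have pp := pow_lt _ m pq.
apply: (Rmult_le_reg_r (/ (INR m / (INR m + 1)) ^ m)); first exact: Rinv_0_lt_compat.
by rewrite Rmult_assoc Rinv_r; lra.
Qed.

(* Cauchy's estimate on discs of radius (1 - |z|) / (n + 1) gains a factor
   3 K t / (1 - |z|) at each integration in time. *)
Lemma transport_unique (w : R -> C -> C) (G : C -> C) K B tau :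
  0 <= K -> 0 <= B ->
  (forall t, 0 < t < tau -> holo (w t)) ->
  (forall t z, 0 < t < tau -> pdiff (fun s => w s z) t (G z * Cd (w t) z)%C) ->
  (forall z, Cmod z <= 1 -> Cmod (G z) <= K) ->
  (forall t z, 0 < t < tau -> Cmod z <= 1 -> Cmod (w t z) <= B) ->
  (forall z, Cmod z <= 1 -> forall e, 0 < e -> exists d, 0 < d /\ forall t, 0 < t < d -> t < tau -> Cmod (w t z) <= e) ->
  forall t z, 0 < t < tau -> Cmod z < 1 -> 3 * K * t < 1 - Cmod z -> w t z = RtoC 0.
Proof.
move=> HK HB Hw Hd HG Hb H0.
have key : forall n t z, 0 < t < tau -> Cmod z <= 1 ->
    Cmod (w t z) * (1 - Cmod z) ^ n <= B * (3 * K * t) ^ n.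
  elim=> [|n IH] t z Ht Hz; first by rewrite /= !Rmult_1_r; exact: Hb.
  have gz := Cmod_ge_0 z.
  have K3 : 0 <= B * (3 * K * t) ^ S n by apply: Rmult_le_pos => //; apply: pow_le; nra.
  set a := 1 - Cmod z; case: (Req_dec a 0) => [->|na]; first by rewrite pow_i ?Rmult_0_r //; lia.
  have pa : 0 < a by rewrite /a in na *; lra.
  have pn := pos_INR n.
  set A := B * (3 * K) ^ S n / a ^ S n.
  have pan := pow_lt a n pa.
  have pA : 0 <= A.
    apply: Rmult_le_pos; first by apply: Rmult_le_pos => //; apply: pow_le; lra.
    by apply: Rlt_le; apply: Rinv_0_lt_compat; exact: pow_lt.
  have Hder : forall s, 0 < s < tau -> Cmod (G z * Cd (w s) z)%C <= A * (INR (S n) * s ^ n).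
    move=> s Hs; rewrite Cmod_mult.
    set d := a / (INR n + 1); set X := (INR n / (INR n + 1)) ^ n.
    have h3 : 1 <= 3 * X := three_pow_ratio n.
    have pd : 0 < d by apply: Rdiv_lt_0_compat; lra.
    have da : a * (INR n / (INR n + 1)) = a - d by rewrite /d; field; lra.
    have q0 : 0 <= a - d.
      by rewrite -da; repeat apply: Rmult_le_pos; try lra; apply: Rlt_le; apply: Rinv_0_lt_compat; lra.
    have aX : 0 < a ^ n * X by apply: Rmult_lt_0_compat; lra.
    have ks : 0 <= B * (3 * K * s) ^ n by apply: Rmult_le_pos => //; apply: pow_le; nra.
    have HC : Cmod (Cd (w s) z) <= B * (3 * K * s) ^ n / (a ^ n * X) / d.
      apply: (cauchy_bound (w s) z _ d _ (Hw s Hs) (cdiff_Cd _ _ (Hw s Hs)) pd) => y Hy.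
      have Hy1 : a - d <= 1 - Cmod y by rewrite /a -Hy; have := Cmod_le_plus y z; lra.
      apply: (Rmult_le_reg_r (a ^ n * X)) => //.
      rewrite /Rdiv Rmult_assoc Rinv_l ?Rmult_1_r; last lra.
      apply: Rle_trans (IH s y Hs ltac:(lra)); apply: Rmult_le_compat_l; first exact: Cmod_ge_0.
      by rewrite -Rpow_mult_distr da; apply: pow_incr.
    apply: Rle_trans (Rmult_le_compat _ _ _ _ (Cmod_ge_0 _) (Cmod_ge_0 _) (HG z Hz) HC) _.
    have -> : K * (B * (3 * K * s) ^ n / (a ^ n * X) / d) =
        K * (B * (3 * K * s) ^ n) * (INR n + 1) / (a ^ n * a) * / X by rewrite /d; field; lra.
    have -> : A * (INR (S n) * s ^ n) = K * (B * (3 * K * s) ^ n) * (INR n + 1) / (a ^ n * a) * 3.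
      by rewrite /A S_INR (Rpow_mult_distr (3 * K) s) /=; field; lra.
    apply: Rmult_le_compat_l.
      apply: Rmult_le_pos; first by repeat apply: Rmult_le_pos => //; lra.
      by apply: Rlt_le; apply: Rinv_0_lt_compat; exact: Rmult_lt_0_compat.
    by apply: (Rmult_le_reg_r X); [lra|rewrite Rinv_l; lra].
  have Hst : forall s, 0 < s <= t -> Cmod (w t z - w s z)%C <= A * t ^ S n.
    move=> s Hs.
    have h0 : 0 <= A * s ^ S n by apply: Rmult_le_pos => //; apply: pow_le; lra.
    apply: (Rle_trans _ (A * t ^ S n - A * s ^ S n)); last lra.
    apply: (path_mvi (fun s => w s z) (fun s => G z * Cd (w s) z)%C (fun s => A * s ^ S n)
      (fun s => A * (INR (S n) * s ^ n)) s t (proj2 Hs)) => r Hr.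
    - by apply: Hd; lra.
    - by apply/is_derive_Reals; apply: derivable_pt_lim_scal; exact: derivable_pt_lim_pow.
    - by apply: Hder; lra.
  have -> : B * (3 * K * t) ^ S n = A * t ^ S n * a ^ S n.
    by rewrite (Rpow_mult_distr (3 * K) t) /A; field; have := pow_lt a (S n) pa; lra.
  apply: Rmult_le_compat_r; first by apply: pow_le; lra.
  apply: Rnot_lt_le => Hlt.
  have [d [pd Hdd]] := H0 z Hz ((Cmod (w t z) - A * t ^ S n) / 2) ltac:(lra).
  have pm : 0 < Rmin t (d / 2) by apply: Rmin_pos; lra.
  have m1 := Rmin_l t (d / 2); have m2 := Rmin_r t (d / 2).
  have h1 := Hst (Rmin t (d / 2)) ltac:(lra).
  have h2 := Hdd (Rmin t (d / 2)) ltac:(lra) ltac:(lra).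
  have := Cmod_le_plus (w t z) (w (Rmin t (d / 2)) z); lra.
move=> t z Ht Hz Hk.
have gz := Cmod_ge_0 z; set a := 1 - Cmod z in Hk.
set q := 3 * K * t / a.
have q0 : 0 <= q by apply: Rmult_le_pos; [nra|apply: Rlt_le; apply: Rinv_0_lt_compat; rewrite /a; lra].
have q1 : q < 1.
  by apply: (Rmult_lt_reg_r a); [rewrite /a; lra|rewrite /q /Rdiv Rmult_assoc Rinv_l; rewrite /a in Hk *; lra].
apply: Cmod_eq0_le => e He.
have [n HN] := pow_lt_1_zero q ltac:(rewrite Rabs_pos_eq; lra) (e / (B + 1)) ltac:(apply: Rdiv_lt_0_compat; lra).
have := HN n (Nat.le_refl n); have pq := pow_le q n q0; rewrite Rabs_pos_eq // => h.
have pan : 0 < a ^ n by apply: pow_lt; rewrite /a; lra.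
have h1 : Cmod (w t z) <= B * q ^ n.
  apply: (Rmult_le_reg_r (a ^ n)) => //; apply: Rle_trans (key n t z Ht (Rlt_le _ _ Hz)) _.
  have -> : 3 * K * t = q * a by rewrite /q; field; rewrite /a; lra.
  by rewrite Rpow_mult_distr; lra.
have -> : e = e / (B + 1) * (B + 1) by field; lra.
have : q ^ n * (B + 1) <= e / (B + 1) * (B + 1) by apply: Rmult_le_compat_r; lra.
lra.
Qed.

Lemma holo_Cexp_comp f : holo f -> holo (fun z => Cexp (f z)).
Proof.
move=> Hf z; case: (Hf z) => l Hl; exists (Cexp (f z) * l)%C.
by apply: cdiff_comp => //; exact: cdiff_Cexp.
Qed.

(** The function [exp f] is entire and bounded, hence constant; its derivative [exp f * f']
    vanishes, and the exponential has no zero. *)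
Lemma re_liouville f A : holo f -> (forall z, Re (f z) <= A) -> forall z, f z = f (RtoC 0).
Proof.
move=> Hf HA; apply: Cd0_const => // z.
have He := holo_Cexp_comp f Hf.
have Hb : forall z, Cmod (Cexp (f z)) <= exp A.
  move=> w; rewrite Cmod_Cexp; case: (HA w) => [h|->]; [apply: Rlt_le; exact: exp_increasing|exact: Rle_refl].
have Hc := liouville _ _ He Hb.
have h1 : cdiff (fun z => Cexp (f z)) z (Cexp (f z) * Cd f z)%C.
  by apply: cdiff_comp; [exact: cdiff_Cexp|exact: cdiff_Cd].
have h2 : cdiff (fun z => Cexp (f z)) z (RtoC 0).
  by rewrite (functional_extensionality _ _ Hc); exact: cdiff_const.
have E := cdiff_unique _ _ _ _ h1 h2.
have nz := Cexp_nz (f z).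
have -> : Cd f z = (/ Cexp (f z) * (Cexp (f z) * Cd f z))%C by field.
by rewrite E; ring.
Qed.

Lemma re_growth_affine G r0 A : holo G ->
  (forall z, r0 < Cmod z -> Re (Cconj z * G z)%C <= A) ->
  exists a, forall z, G z = (a * z + G (RtoC 0))%C.
Proof.
move=> HG HA.
have [q [Hq HGq]] := holo_slope0 G HG.
have [B [HB0 HB]] := ccont_bounded q (fun z => holo_ccont q z Hq) (Rmax r0 1).
set b := G (RtoC 0) in HGq *.
(* Inside the disc compactness gives [B]. Outside, the hypothesis bounds [|z|^2 Re (q z)] by
   [A + |z| |b|], and [1 <= |z| <= |z|^2] there. *)
have HQ : forall z, Re (q z) <= Rmax B (Rmax A 0 + Cmod b).
  move=> z; case: (Rle_lt_dec (Cmod z) (Rmax r0 1)) => Hz.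
    apply: Rle_trans (Rle_abs _) _; apply: Rle_trans (re_le_Cmod _) _.
    by apply: Rle_trans (HB z Hz) (Rmax_l _ _).
  apply: Rle_trans (Rmax_r _ _).
  have z1 := Rle_lt_trans _ _ _ (Rmax_r r0 1) Hz.
  have z0 := Rle_lt_trans _ _ _ (Rmax_l r0 1) Hz.
  have := HA z z0; rewrite (HGq z).
  have -> : (Cconj z * (b + q z * z))%C = (Cconj z * b + RtoC (Cmod z ^ 2) * q z)%C by rewrite Cmod2_conj; ring.
  rewrite re_plus re_scal_l => h.
  have h1 := re_le_Cmod (Cconj z * b)%C; rewrite Cmod_mult Cmod_conj in h1.
  have h2 : - (Cmod z * Cmod b) <= Re (Cconj z * b)%C by have := Rle_abs (- Re (Cconj z * b)%C); rewrite Rabs_Ropp; lra.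
  have m1 := Rmax_l A 0; have m2 := Rmax_r A 0.
  have pb := Cmod_ge_0 b.
  have h3 : Cmod z ^ 2 * Re (q z) <= Cmod z ^ 2 * (Rmax A 0 + Cmod b).
    have z2 : Cmod z <= Cmod z ^ 2 by nra.
    have : 1 * Rmax A 0 <= Cmod z ^ 2 * Rmax A 0 by apply: Rmult_le_compat_r; lra.
    have : Cmod z * Cmod b <= Cmod z ^ 2 * Cmod b by apply: Rmult_le_compat_r.
    lra.
  by apply: (Rmult_le_reg_l (Cmod z ^ 2)) => //; nra.
exists (q (RtoC 0)) => z; rewrite (HGq z) (re_liouville q _ Hq HQ z); ring.
Qed.

(** * Integration over the plane *)

Module PlaneIntegral.

Import all_boot all_order all_algebra all_classical all_reals all_analysis.
Import measurable_realfun mathcomp.algebra_tactics.ring mathcomp.algebra_tactics.lra.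
Import Order.TTheory GRing.Theory Num.Theory numFieldNormedType.Exports.
Set Implicit Arguments.
Unset Strict Implicit.
Local Open Scope classical_set_scope.
Local Open Scope ring_scope.

Section plane.
Context {R : realType}.
Let mu := @lebesgue_measure R.
Let TR := measurableTypeR R.

(** Continuity in coordinates, stated by hand so that it can be supplied from the epsilon-delta
    estimates on complex functions. *)
Definition cont2 (F : R * R -> R) : Prop := forall p e, 0 < e ->
  exists2 d, 0 < d & forall q : R * R, `|q.1 - p.1| < d -> `|q.2 - p.2| < d -> `|F q - F p| < e.

Definition open2 (U : set (R * R)) : Prop := forall p, U p ->
  exists2 d, 0 < d & forall q : R * R, `|q.1 - p.1| < d -> `|q.2 - p.2| < d -> U q.

Lemma rat_approx (x e : R) : 0 < e -> exists q : rat, `|x - ratr q| < e.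
Proof.
move=> e0.
have : x - e < x + e by lra.
move=> /rat_in_itvoo[q]; rewrite in_itv/= => /andP[h1 h2].
exists q; rewrite ltr_norml; lra.
Qed.

(** An open set is the countable union of the rational boxes it contains, and boxes are measurable
    in the product sigma-algebra. *)
Lemma measurable_open2 (U : set (R * R)) : open2 U ->
  measurable (U : set (measurableTypeR R * measurableTypeR R)).
Proof.
move=> oU.
pose box (t : rat * rat * rat) : set (R * R) :=
  ball (ratr t.1.1 : R) (ratr t.2 : R) `*` ball (ratr t.1.2 : R) (ratr t.2 : R).
pose F t : set (R * R) := if `[< box t `<=` U >] then box t else set0.
have -> : U = \bigcup_t F t.
  apply/seteqP; split=> [p Up|p [t _]]; last first.
    by rewrite /F; case: asboolP => // h /h.
  have [d d0 dU] := oU p Up.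
  have d4 : 0 < d / 4 by lra.
  have [a ha] := @rat_approx p.1 (d / 4) d4.
  have [b hb] := @rat_approx p.2 (d / 4) d4.
  have [e he] := @rat_approx (d / 2) (d / 4) d4.
  have he1 : d / 4 < ratr e by move: he; rewrite ltr_norml; lra.
  have he2 : ratr e < d * 3 / 4 by move: he; rewrite ltr_norml; lra.
  exists (a, b, e) => //; rewrite /F; case: asboolP => [_|[]].
    by split; rewrite /ball/= distrC; lra.
  move=> q [/= h1 h2]; rewrite /ball/= in h1 h2.
  apply: dU; move: ha hb h1 h2; rewrite !ltr_norml; lra.
apply: countable_bigcupT_measurable => // t.
rewrite /F; case: ifP => _; last exact: measurable0.
apply: measurableX; apply: open_measurable; exact: ball_open.
Qed.

Lemma measurable_cont2 (F : R * R -> R) : cont2 F ->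
  measurable_fun setT (F : measurableTypeR R * measurableTypeR R -> measurableTypeR R).
Proof.
move=> cF; apply: (measurability _ (RGenOInfty.measurableE R)).
move=> /= _ [_ [x ->]] <-; rewrite setTI; apply: measurable_open2 => p /=.
rewrite in_itv/= andbT => xp.
have e0 : 0 < F p - x by lra.
have [d d0 dF] := cF p _ e0; exists d => // q h1 h2 /=.
by have := dF q h1 h2; rewrite in_itv/= andbT ltr_norml; lra.
Qed.

(** Substitution along an increasing map settles [a > 0]; the case [a < 0] reduces to it by the
    invariance of Lebesgue measure under reflection. *)
Lemma integral_affine (G : R -> R) (a b : R) : continuous G -> (forall x, 0 <= G x) -> a != 0 ->
  (\int[mu]_x (G (a * x + b))%:E = (`|a|^-1)%:E * \int[mu]_x (G x)%:E)%E.
Proof.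
have pos : forall (G : R -> R) (a b : R), continuous G -> (forall x, 0 <= G x) -> 0 < a ->
  (\int[mu]_x (G (a * x + b))%:E = (a^-1)%:E * \int[mu]_x (G x)%:E)%E.
  move=> {}G {}a {}b cG G0 a0.
  pose F (x : R) := a * x + b.
  have dF x : is_derive x (1 : R) F a.
    rewrite /F; apply: is_derive_eq.
    by rewrite /GRing.scale/= ?scaler0 ?add0r ?addr0 ?mulr1.
  have FE : derive1 F = cst a.
    by apply/funext => x; rewrite derive1E; apply: derive_val.
  have cF : continuous (fun x => G (F x)).
    move=> x; apply: continuous_comp; last exact: cG.
    by apply: differentiable_continuous; apply/derivable1_diffP; apply: ex_derive.
  rewrite (@increasing_ge0_integration_by_substitutionT R F G) //.
  - rewrite FE [X in (_ * X)%E](_ : _ = \int[mu]_x (a%:E * (EFin \o (G \o F)) x))%E; last first.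
      by apply: eq_integral => x _; rewrite /= mulrC EFinM.
    rewrite ge0_integralZl//=.
    + by rewrite muleA -EFinM mulVf ?mul1e// gt_eqF.
    + apply/measurable_EFinP; exact: continuous_measurable_fun.
    + by move=> x _; rewrite lee_fin.
    + by rewrite lee_fin ltW.
  - by move=> x y xy; rewrite /F ltrD2r ltr_pM2l.
  - by rewrite FE; exact: cst_continuous.
  - by rewrite FE; exact: is_cvg_cst.
  - by rewrite FE; exact: is_cvg_cst.
  - apply/cvgrNyPle => A; exists ((A - b) / a); split; first exact: num_real.
    by move=> x; rewrite ltr_pdivlMr// /F => /ltW; rewrite lerBrDr mulrC.
  - apply/cvgryPge => A; exists ((A - b) / a); split; first exact: num_real.
    by move=> x; rewrite ltr_pdivrMr// /F => /ltW; rewrite lerBlDr mulrC.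
move=> cG G0; case: (ltgtP a 0) => // a0 _; last by rewrite pos// gtr0_norm.
have cGN : continuous (fun x => G (- x)).
  by move=> x; apply: continuous_comp; [exact: opp_continuous|exact: cG].
have E : (\int[mu]_x (G (- x))%:E = \int[mu]_x (G x)%:E)%E.
  have mG : measurable_fun [set: measurableTypeR R] (EFin \o G).
    by apply/measurable_EFinP; exact: continuous_measurable_fun.
  have mN : measurable_fun [set: measurableTypeR R] (-%R : measurableTypeR R -> measurableTypeR R).
    by apply: continuous_measurable_fun; exact: opp_continuous.
  rewrite -[LHS](@ge0_integral_pushforward _ _ (measurableTypeR R) (measurableTypeR R) R _ mN mu setT (EFin \o G))//.
  - by apply: eq_measure_integral => A mA _; exact: lebesgue_measureN.
  - by move=> x _; rewrite /= lee_fin.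
have aN0 : 0 < - a by lra.
transitivity (\int[mu]_x ((fun x => G (- x)) ((- a) * x + (- b)))%:E)%E.
  by apply: eq_integral => x _; congr (G _)%:E; ring.
have := pos (fun x => G (- x)) (- a) (- b) cGN (fun x => G0 _) aN0.
by rewrite E ltr0_norm.
Qed.

Notation leb2 := (mu \x mu)%E.

Definition planar (F : R * R -> R) : \bar R := (\int[leb2]_p (F p)%:E)%E.

Lemma cont2_slice1 (F : R * R -> R) y : cont2 F -> continuous (fun x => F (x, y)).
Proof.
move=> cF x; apply/cvgrPdist_lt => e e0.
have [d d0 dF] := cF (x, y) e e0.
near=> t; rewrite distrC; apply: dF => /=; last by rewrite subrr normr0.
rewrite distrC; near: t; exact: cvgr_dist_lt.
Unshelve. all: end_near. Qed.

Lemma cont2_slice2 (F : R * R -> R) x : cont2 F -> continuous (fun y => F (x, y)).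
Proof.
move=> cF y; apply/cvgrPdist_lt => e e0.
have [d d0 dF] := cF (x, y) e e0.
near=> t; rewrite distrC; apply: dF => /=; first by rewrite subrr normr0.
rewrite distrC; near: t; exact: cvgr_dist_lt.
Unshelve. all: end_near. Qed.

Lemma measurable_planar (F : R * R -> R) : cont2 F ->
  measurable_fun [set: measurableTypeR R * measurableTypeR R] (fun p => (F p)%:E).
Proof. by move=> cF; apply/measurable_EFinP; exact: measurable_cont2. Qed.

Lemma planar12 (F : R * R -> R) : cont2 F -> (forall p, 0 <= F p) ->
  (planar F = \int[mu]_x \int[mu]_y (F (x, y))%:E)%E.
Proof.
move=> cF F0; rewrite /planar (fubini_tonelli1 (fun p : TR * TR => (F p)%:E))//.
exact: measurable_planar.
Qed.

Lemma planar21 (F : R * R -> R) : cont2 F -> (forall p, 0 <= F p) ->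
  (planar F = \int[mu]_y \int[mu]_x (F (x, y))%:E)%E.
Proof.
move=> cF F0; rewrite /planar (fubini_tonelli2 (fun p : TR * TR => (F p)%:E))//.
exact: measurable_planar.
Qed.

Lemma integral_slice_measurable (F : R * R -> R) : cont2 F -> (forall p, 0 <= F p) ->
  measurable_fun [set: measurableTypeR R] (fun x => \int[mu]_y (F (x, y))%:E)%E.
Proof.
move=> cF F0; apply: (measurable_fun_fubini_tonelli_F (fun p : TR * TR => (F p)%:E)).
- exact: measurable_planar.
- by move=> x; rewrite lee_fin.
Qed.

Lemma integral_slice_measurable2 (F : R * R -> R) : cont2 F -> (forall p, 0 <= F p) ->
  measurable_fun [set: measurableTypeR R] (fun y => \int[mu]_x (F (x, y))%:E)%E.
Proof.
move=> cF F0; apply: (measurable_fun_fubini_tonelli_G (fun p : TR * TR => (F p)%:E)).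
- exact: measurable_planar.
- by move=> x; rewrite lee_fin.
Qed.

Lemma cont2_affine (F : R * R -> R) (a b c a' b' c' : R) : cont2 F ->
  cont2 (fun p => F (a * p.1 + b * p.2 + c, a' * p.1 + b' * p.2 + c')).
Proof.
move=> cF p e e0.
have [d d0 dF] := cF (a * p.1 + b * p.2 + c, a' * p.1 + b' * p.2 + c') e e0.
pose M := `|a| + `|b| + `|a'| + `|b'| + 1.
have M0 : 0 < M by rewrite /M; have := normr_ge0 a; have := normr_ge0 b; have := normr_ge0 a'; have := normr_ge0 b'; lra.
exists (d / M); first by rewrite divr_gt0.
have key (u v x y : R) : `|u| + `|v| < M -> `|x| < d / M -> `|y| < d / M -> `|u * x + v * y| < d.
  move=> uv hx hy.
  apply: (le_lt_trans (ler_normD _ _)); rewrite !normrM.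
  apply: (@le_lt_trans _ _ ((`|u| + `|v|) * (d / M))).
    by rewrite mulrDl lerD// ler_wpM2l// ltW.
  apply: (@lt_le_trans _ _ (M * (d / M))); first by rewrite ltr_pM2r// divr_gt0.
  by rewrite mulrC divfK// gt_eqF.
have nn (x : R) : 0 <= `|x| by exact: normr_ge0.
move=> q h1 h2; apply: dF => /=.
- rewrite (_ : _ - _ = a * (q.1 - p.1) + b * (q.2 - p.2)); last by ring.
  by apply: key => //; rewrite /M; have := nn a'; have := nn b'; lra.
- rewrite (_ : _ - _ = a' * (q.1 - p.1) + b' * (q.2 - p.2)); last by ring.
  by apply: key => //; rewrite /M; have := nn a; have := nn b; lra.
Qed.

(* For p <> 0 the map factors through the two shears (x, y) -> (p x - q y + c, y)
   and (x', y) -> (x', (q (x' - c) + (p^2 + q^2) y) / p + c'). *)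
Lemma planar_conformal (F : R * R -> R) (p q c c' : R) : cont2 F -> (forall z, 0 <= F z) ->
  p ^+ 2 + q ^+ 2 != 0 ->
  (planar (fun z => F (p * z.1 - q * z.2 + c, q * z.1 + p * z.2 + c')%R) =
   ((p ^+ 2 + q ^+ 2)^-1)%:E * planar F)%E.
Proof.
move=> cF F0 pq0.
have cF' : cont2 (fun z => F (p * z.1 - q * z.2 + c, q * z.1 + p * z.2 + c')).
  have := @cont2_affine F p (- q) c q p c' cF.
  by under eq_fun do rewrite mulNr.
rewrite planar21//.
(* For [p = 0] the shears degenerate, but the map then merely exchanges the scaled coordinates, so
   exchanging the order of integration replaces them. *)
have [p0|p0] := eqVneq p 0.
  have q0 : q != 0 by apply: contraNneq pq0 => ->; rewrite p0 expr0n addr0.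
  transitivity (\int[mu]_y ((`|q|^-1)%:E * \int[mu]_x (F (- q * y + c, x))%:E))%E.
    apply: eq_integral => y _.
    rewrite -(@integral_affine (fun x => F (- q * y + c, x)) q c')//; last exact: cont2_slice2.
    by apply: eq_integral => x _; rewrite p0 /= !mul0r add0r addr0 mulNr.
  have cF2 : cont2 (fun z => F (- q * z.1 + c, z.2)).
    have := @cont2_affine F (- q) 0 c 0 1 0 cF.
    by under eq_fun do rewrite !mul0r mul1r !addr0 add0r.
  rewrite ge0_integralZl//; last 2 first.
    - exact: (integral_slice_measurable cF2).
    - by move=> y _; apply: integral_ge0 => x _; rewrite lee_fin.
  rewrite -(fubini_tonelli (fun z : TR * TR => (F (- q * z.2 + c, z.1))%:E)); last 2 first.
    - apply: measurable_planar.
      have := @cont2_affine F 0 (- q) c 1 0 0 cF.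
      by under eq_fun do rewrite !mul0r mul1r !addr0 add0r.
    - by move=> z; rewrite lee_fin.
  transitivity ((`|q|^-1)%:E * \int[mu]_x ((`|q|^-1)%:E * \int[mu]_y (F (y, x))%:E))%E.
    congr (_ * _)%E; apply: eq_integral => x _.
    rewrite -(normrN q) -(@integral_affine (fun y => F (y, x)) (- q) c)//.
    - exact: cont2_slice1.
    - by rewrite oppr_eq0.
  rewrite ge0_integralZl//; last 2 first.
    - exact: (integral_slice_measurable2 cF).
    - by move=> y _; apply: integral_ge0 => x _; rewrite lee_fin.
  rewrite muleA -EFinM -planar21//; congr (_%:E * _)%E.
  by rewrite p0 expr0n add0r -invfM -expr2 real_normK// num_real.
pose H z := F (z.1, (q * (z.1 - c) + (p ^+ 2 + q ^+ 2) * z.2) / p + c').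
have cH : cont2 H.
  have := @cont2_affine F 1 0 0 (q / p) ((p ^+ 2 + q ^+ 2) / p) (c' - q * c / p) cF.
  rewrite (_ : (fun _ => _) = H)//; apply/funext => z; rewrite /H; congr (F (_, _)); first by ring.
  by field.
have H0 z : 0 <= H z by exact: F0.
transitivity (\int[mu]_y ((`|p|^-1)%:E * \int[mu]_x (H (x, y))%:E))%E.
  apply: eq_integral => y _.
  rewrite -(@integral_affine (fun x => H (x, y)) p (- q * y + c))//; last exact: cont2_slice1.
  apply: eq_integral => x _; rewrite /H /=; congr (F (_, _))%:E; first by ring.
  by field.
rewrite ge0_integralZl//; last 2 first.
  - exact: (integral_slice_measurable2 cH).
  - by move=> y _; apply: integral_ge0 => x _; rewrite lee_fin.
rewrite -planar21// planar12//.
transitivity ((`|p|^-1)%:E * \int[mu]_x ((`|(p ^+ 2 + q ^+ 2) / p|^-1)%:E * \int[mu]_y (F (x, y))%:E))%E.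
  congr (_ * _)%E; apply: eq_integral => x _.
  rewrite -(@integral_affine (fun y => F (x, y)) ((p ^+ 2 + q ^+ 2) / p) (q * (x - c) / p + c'))//.
  - by apply: eq_integral => y _; rewrite /H /=; congr (F (_, _))%:E; field.
  - exact: cont2_slice2.
  - by rewrite mulf_neq0// invr_eq0.
rewrite ge0_integralZl//; last 2 first.
  - exact: (integral_slice_measurable cF).
  - by move=> y _; apply: integral_ge0 => x _; rewrite lee_fin.
rewrite muleA -EFinM -planar12//; congr (_%:E * _)%E.
have pq : 0 < p ^+ 2 + q ^+ 2 by rewrite lt_neqAle eq_sym pq0 addr_ge0 ?sqr_ge0.
rewrite normrM normfV gtr0_norm//.
by field; rewrite normr_eq0 p0 pq0.
Qed.

Lemma cont2_scal (F : R * R -> R) (k : R) : cont2 F -> cont2 (fun p => k * F p).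
Proof.
move=> cF p e e0.
have k0 : 0 < `|k| + 1 by rewrite ltr_wpDl.
have [d d0 dF] := cF p (e / (`|k| + 1)) (divr_gt0 e0 k0).
exists d => // q h1 h2; rewrite -mulrBr normrM.
apply: (@le_lt_trans _ _ ((`|k| + 1) * `|F q - F p|)).
  by rewrite ler_wpM2r// lerDl.
by rewrite -ltr_pdivlMl// mulrC; exact: dF.
Qed.

Lemma cont2_add (F G : R * R -> R) : cont2 F -> cont2 G -> cont2 (fun p => F p + G p).
Proof.
move=> cF cG p e e0.
have e2 : 0 < e / 2 by rewrite divr_gt0.
have [d d0 dF] := cF p _ e2; have [d' d0' dG] := cG p _ e2.
exists (Num.min d d'); first by rewrite lt_min d0.
move=> q; rewrite !lt_min => /andP[h1 h1'] /andP[h2 h2'].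
rewrite opprD addrACA (splitr e) (le_lt_trans (ler_normD _ _))// ltrD//; [exact: dF|exact: dG].
Qed.

Lemma planar_ge0 (F : R * R -> R) : (forall p, 0 <= F p) -> (0 <= planar F)%E.
Proof. by move=> F0; apply: integral_ge0 => p _; rewrite lee_fin. Qed.

Lemma planar_le (F G : R * R -> R) : cont2 F -> cont2 G -> (forall p, 0 <= F p) ->
  (forall p, F p <= G p) -> (planar F <= planar G)%E.
Proof.
move=> cF cG F0 FG; apply: ge0_le_integral => //.
- by move=> p _; rewrite lee_fin.
- exact: (measurable_planar cF).
- exact: (measurable_planar cG).
- by move=> p _; rewrite lee_fin.
Qed.

Lemma planar_add (F G : R * R -> R) : cont2 F -> cont2 G -> (forall p, 0 <= F p) ->
  (forall p, 0 <= G p) -> (planar (fun p => F p + G p)%R = planar F + planar G)%E.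
Proof.
move=> cF cG F0 G0; rewrite /planar -ge0_integralD//.
- by move=> p _; rewrite lee_fin.
- exact: (measurable_planar cF).
- by move=> p _; rewrite lee_fin.
- exact: (measurable_planar cG).
Qed.

Lemma planar_scal (F : R * R -> R) (k : R) : cont2 F -> (forall p, 0 <= F p) -> 0 <= k ->
  (planar (fun p => k * F p)%R = k%:E * planar F)%E.
Proof.
move=> cF F0 k0; rewrite /planar -ge0_integralZl//.
- exact: (measurable_planar cF).
- by move=> p _; rewrite lee_fin.
Qed.

Lemma planar_fatou (Fn : nat -> R * R -> R) (F : R * R -> R) (K : \bar R) :
  (forall n, cont2 (Fn n)) -> (forall n p, 0 <= Fn n p) ->
  (forall p, Fn n p @[n --> \oo] --> F p) ->
  (forall n, (planar (Fn n) <= K)%E) -> (planar F <= K)%E.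
Proof.
move=> cFn Fn0 FnF FnK.
have -> : planar F = (\int[leb2]_p (limn_einf (fun n => (Fn n p)%:E)))%E.
  apply: eq_integral => p _; apply/esym.
  rewrite limn_einf_lim; apply: cvg_lim => //; apply: cvg_einfs.
  by apply: cvg_EFin; [exact: nearW|exact: FnF].
apply: (@le_trans _ _ (limn_einf (fun n => planar (Fn n)))).
  apply: (@fatou _ _ _ leb2 setT measurableT (fun n p => (Fn n p)%:E)).
  - by move=> n; exact: (measurable_planar (cFn n)).
  - by move=> n p _; rewrite lee_fin.
rewrite limn_einf_lim; apply: lime_le; first exact: is_cvg_einfs.
apply: nearW => n; apply: (@le_trans _ _ (planar (Fn n))) => //.
by apply: ereal_inf_lbound; exists n => /=.
Qed.

(** Tonelli reduces this to the square of the one-dimensional Gauss integral. Continuity is taken as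
    a hypothesis because it comes for free once the integrand is recognized as the weighted square
    of the constant 1. *)
Lemma planar_gauss : cont2 (fun p : R * R => expR (- (p.1 ^+ 2 + p.2 ^+ 2))) ->
  planar (fun p : R * R => expR (- (p.1 ^+ 2 + p.2 ^+ 2))) = (@pi R)%:E.
Proof.
move=> cg.
have mg : measurable_fun [set: TR] (EFin \o @gauss_fun R).
  by apply/measurable_EFinP; exact: measurable_gauss_fun.
have g0 x : (0 <= (EFin \o @gauss_fun R) x)%E by rewrite lee_fin gauss_fun_ge0.
rewrite planar12; [|exact: cg|by move=> p; exact: expR_ge0].
transitivity (\int[mu]_x ((Num.sqrt pi)%:E * (gauss_fun x)%:E))%E.
  apply: eq_integral => x _.
  rewrite muleC -integralT_gauss -ge0_integralZl//; last 2 first.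
  - by move=> y _; exact: g0.
  - exact: g0.
  by apply: eq_integral => y _; rewrite -EFinM /= /gauss_fun -expRD opprD.
rewrite (ge0_integralZl mu measurableT mg); last 2 first.
- by move=> x _; exact: g0.
- by rewrite lee_fin sqrtr_ge0.
rewrite integralT_gauss -EFinM -expr2 sqr_sqrtr//.
exact: pi_ge0.
Qed.

End plane.

End PlaneIntegral.

(** * The Fock norm as an integral over the plane *)

Module FockIntegral.

Import all_boot all_order all_algebra all_classical all_reals all_analysis Rstruct Rstruct_topology.
Import PlaneIntegral.
Import Order.TTheory GRing.Theory Num.Theory numFieldNormedType.Exports.
Import Coquelicot.Complex.
Local Open Scope R_scope.

Definition fockF (f : C -> C) (p : R * R) : R :=
  (pow (Cmod (f p)) 2 * Rtrigo_def.exp (- pow (Cmod p) 2)).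

Lemma fock_integralE f : fock_integral f = planar (fockF f).
Proof. by []. Qed.

Lemma ccont_Cconj z : ccont Cconj z.
Proof.
by move=> e He; exists e; split=> // h; rewrite -Cminus_conj Cmod_conj; replace (z + h - z)%C with h by ring.
Qed.

Lemma cont2R (F : R * R -> R) : (forall (p : R * R) (e : R), 0 < e -> exists d : R, 0 < d /\
    forall q : R * R, Rabs (q.1 - p.1) < d -> Rabs (q.2 - p.2) < d -> Rabs (F q - F p) < e) ->
  cont2 F.
Proof.
move=> H p e /RltP e0; have [d [d0 Hd]] := H p e e0.
exists d; first exact/RltP.
move=> q /RltP h1 /RltP h2; apply/RltP; rewrite -!RabsE in h1 h2 *; exact: Hd.
Qed.

Lemma EFinR (a b : R) : a = b -> a%:E = b%:E :> \bar R.
Proof. by move->. Qed.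

Lemma ccont_cont2 (u : C -> C) : (forall z, ccont u z) -> cont2 (fun p : R * R => Re (u p)).
Proof.
move=> Hu; apply: cont2R => p e e0.
have [d [Hd Hd']] := Hu p e e0.
exists (d / 2); split; first lra.
move=> q h1 h2.
have h3 : Cmod (q - p)%C < d.
  apply: Rle_lt_trans (Cmod_le_abs _) _; rewrite re_minus im_minus /Re /Im; lra.
have := Hd' _ h3; have -> : (p + (q - p))%C = q by apply: injective_projections => /=; ring.
move=> h4; apply: Rle_lt_trans h4; rewrite -re_minus; exact: re_le_Cmod.
Qed.

(** The integrand is [g * conj g] for the continuous complex function
    [g z = f z * exp (- |z|^2 / 2)], so the calculus of [ccont] applies. *)
Lemma cont2_fockF f : (forall z, ccont f z) -> cont2 (fockF f).
Proof.
move=> Hf.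
pose g z := (f z * Cexp (- (/ 2) * (z * Cconj z)))%C.
have Hg z : ccont g z.
  apply: ccont_mult => //; apply: (@ccont_comp Cexp (fun z => - / 2 * (z * Cconj z))%C); last first.
    by apply: cdiff_cont; exact: cdiff_Cexp.
  apply: ccont_mult; first exact: ccont_const.
  by apply: ccont_mult; [exact: ccont_id|exact: ccont_Cconj].
have Hu z : ccont (fun z => g z * Cconj (g z))%C z.
  by apply: ccont_mult => //; apply: (@ccont_comp Cconj) => //; exact: ccont_Cconj.
have := ccont_cont2 _ Hu; congr cont2; apply: functional_extensionality => p.
rewrite -Cmod2_conj re_RtoC /g /fockF Cmod_mult Cmod_Cexp Rpow_mult_distr; congr Rmult.
rewrite -Cmod2_conj -RtoC_inv; last lra.
rewrite -RtoC_opp re_scal_l re_RtoC /= !Rmult_1_r -exp_plus; congr Rtrigo_def.exp; field.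
Qed.

Lemma fockF_ge0 f p : Order.le (0%R : R) (fockF f p).
Proof.
apply/RleP; apply: Rmult_le_pos; first by apply: pow_le; exact: Cmod_ge_0.
exact: Rlt_le (exp_pos _).
Qed.

Lemma entireP f : entire f <-> holo f.
Proof. by split=> H z; case: (H z) => l /is_cderivP Hl; exists l. Qed.

Lemma cont2_fockF_holo f : holo f -> cont2 (fockF f).
Proof. by move=> Hf; apply: cont2_fockF => z; exact: holo_ccont. Qed.

Lemma Fock_holo f : Fock f -> holo f.
Proof. by case=> /entireP. Qed.

Lemma PI_pos : 0 < PI. Proof. exact: PI_RGT_0. Qed.

Lemma fnorm_ge0 f : 0 <= fnorm f.
Proof. exact: sqrt_pos. Qed.

Lemma fock_integral_bound f (v : R) : holo f -> (planar (fockF f) <= v%:E)%E ->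
  Fock f /\ pow (fnorm f) 2 <= v / PI.
Proof.
move=> Hf Hv; have p := PI_pos.
have pl0 : (0%:E <= planar (fockF f))%E by apply: planar_ge0 => q; exact: fockF_ge0.
split.
  split; first exact/entireP.
  by rewrite fock_integralE; apply: le_lt_trans Hv _; rewrite ltry.
rewrite /fnorm fock_integralE.
move: Hv pl0; case: (planar (fockF f)) => [r| |] //=.
rewrite !lee_fin => /RleP Hr /RleP r0.
rewrite Rmult_1_r sqrt_sqrt.
  by apply: Rmult_le_compat_r => //; apply: Rlt_le; exact: Rinv_0_lt_compat.
by apply: Rmult_le_pos => //; apply: Rlt_le; exact: Rinv_0_lt_compat.
Qed.

Lemma sqrt_div_PI (r : R) : 0 <= r -> r = PI * pow (sqrt (r / PI)) 2.
Proof.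
move=> r0; have p := PI_pos.
have h : 0 <= r / PI by apply: Rmult_le_pos => //; apply: Rlt_le; exact: Rinv_0_lt_compat.
by rewrite /= Rmult_1_r sqrt_sqrt //; field; lra.
Qed.

Lemma EFin_lin_comb (a b x y : R) :
  (a%:E * (PI * x)%coqR%:E + b%:E * (PI * y)%coqR%:E)%E = (PI * (a * x + b * y))%coqR%:E.
Proof. by rewrite -!EFinM -EFinD; apply: EFinR; rewrite -RplusE -!RmultE; ring. Qed.

Lemma Fock_planar f : Fock f -> planar (fockF f) = (PI * pow (fnorm f) 2)%coqR%:E.
Proof.
case=> /entireP Hf; rewrite fock_integralE => Hlt; have p := PI_pos.
have pl0 : (0%:E <= planar (fockF f))%E by apply: planar_ge0 => q; exact: fockF_ge0.
rewrite /fnorm fock_integralE.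
move: Hlt pl0; case: (planar (fockF f)) => [r| |] //= _.
rewrite lee_fin => /RleP r0.
by apply: EFinR; exact: sqrt_div_PI.
Qed.

Lemma planar_lin_comb f g a b : Fock f -> Fock g -> 0 <= a -> 0 <= b ->
  planar (fun p => GRing.add (GRing.mul a (fockF f p)) (GRing.mul b (fockF g p))) =
  (PI * (a * pow (fnorm f) 2 + b * pow (fnorm g) 2))%coqR%:E.
Proof.
move=> Hf Hg a0 b0.
have cf := cont2_fockF_holo _ (Fock_holo _ Hf); have cg := cont2_fockF_holo _ (Fock_holo _ Hg).
have af p : Order.le (0%R : R) (GRing.mul a (fockF f p)).
  by apply: mulr_ge0; [exact/RleP|exact: fockF_ge0].
have ag p : Order.le (0%R : R) (GRing.mul b (fockF g p)).
  by apply: mulr_ge0; [exact/RleP|exact: fockF_ge0].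
rewrite planar_add //; try exact: cont2_scal.
rewrite !planar_scal //; try (exact/RleP); try exact: fockF_ge0.
rewrite !Fock_planar //; exact: EFin_lin_comb.
Qed.

(** The entry point for norm inequalities between combinations: a pointwise inequality between
    squared moduli yields membership and a bound on squared norms at once. *)
Lemma Fock_dominated h f g a b : holo h -> Fock f -> Fock g -> 0 <= a -> 0 <= b ->
  (forall z, pow (Cmod (h z)) 2 <= a * pow (Cmod (f z)) 2 + b * pow (Cmod (g z)) 2) ->
  Fock h /\ pow (fnorm h) 2 <= a * pow (fnorm f) 2 + b * pow (fnorm g) 2.
Proof.
move=> Hh Hf Hg a0 b0 Hd; have pp := PI_pos.
have cf := cont2_fockF_holo _ (Fock_holo _ Hf); have cg := cont2_fockF_holo _ (Fock_holo _ Hg).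
have [] := fock_integral_bound h (PI * (a * pow (fnorm f) 2 + b * pow (fnorm g) 2)) Hh.
  rewrite -planar_lin_comb //; apply: planar_le.
  - exact: cont2_fockF_holo.
  - by apply: cont2_add; exact: cont2_scal.
  - exact: fockF_ge0.
  - move=> p; apply/RleP; rewrite -RplusE -!RmultE /fockF.
    have := Hd p; have := exp_pos (- pow (Cmod p) 2); nra.
move=> FH hle; split=> //; apply: Rle_trans hle _; right; field; lra.
Qed.

Lemma parallelogram f g : Fock f -> Fock g ->
  pow (fnorm (fun z => f z + g z)%C) 2 + pow (fnorm (fun z => f z - g z)%C) 2 =
  2 * pow (fnorm f) 2 + 2 * pow (fnorm g) 2.
Proof.
move=> Hf Hg; have pp := PI_pos.
have hf := Fock_holo _ Hf; have hg := Fock_holo _ Hg.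
have hp : holo (fun z => f z + g z)%C.
  by move=> z; case: (hf z) (hg z) => l Hl [m Hm]; exists (l + m)%C; exact: cdiff_plus.
have hm : holo (fun z => f z - g z)%C.
  by move=> z; case: (hf z) (hg z) => l Hl [m Hm]; exists (l - m)%C; exact: cdiff_minus.
have E z : pow (Cmod (f z + g z)%C) 2 + pow (Cmod (f z - g z)%C) 2 =
    2 * pow (Cmod (f z)) 2 + 2 * pow (Cmod (g z)) 2.
  rewrite !Cmod2_alt re_minus im_minus re_plus im_plus; ring.
have Fp : Fock (fun z => f z + g z)%C.
  have [] := Fock_dominated _ f g 2 2 hp Hf Hg; try lra.
    by move=> z; have := E z; have := pow2_ge_0 (Cmod (f z - g z)%C); lra.
  by [].
have Fm : Fock (fun z => f z - g z)%C.
  have [] := Fock_dominated _ f g 2 2 hm Hf Hg; try lra.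
    by move=> z; have := E z; have := pow2_ge_0 (Cmod (f z + g z)%C); lra.
  by [].
have e1 := planar_lin_comb _ _ 1 1 Fp Fm Rle_0_1 Rle_0_1.
have e2 := planar_lin_comb _ _ 2 2 Hf Hg ltac:(lra) ltac:(lra).
have : Some (PI * (1 * pow (fnorm (fun z => f z + g z)%C) 2 + 1 * pow (fnorm (fun z => f z - g z)%C) 2)) = 
  Some (PI * (2 * pow (fnorm f) 2 + 2 * pow (fnorm g) 2)).
  congr Some; apply: EFin_inj; rewrite -e1 -e2; congr planar.
  apply: functional_extensionality => p; rewrite -!RplusE -!RmultE /fockF.
  have aux : forall a b c d x : R, a + b = 2 * c + 2 * d -> 1 * (a * x) + 1 * (b * x) = 2 * (c * x) + 2 * (d * x).
    move=> a b c d x h; transitivity ((a + b) * x); first by ring.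
    by rewrite h; ring.
  exact: (aux _ _ _ _ _ (E p)).
by case=> h; apply: (Rmult_eq_reg_l PI); lra.
Qed.

Lemma Fock_fatou (u : nat -> C -> C) (v : C -> C) K : 0 <= K -> (forall n, Fock (u n)) ->
  (forall n, fnorm (u n) <= K) -> holo v ->
  (forall z e, 0 < e -> exists N : nat, forall n, (N <= n)%coq_nat -> Cmod (u n z - v z)%C < e) ->
  Fock v /\ fnorm v <= K.
Proof.
move=> K0 Hu HK Hv Hcv; have pp := PI_pos.
have [] := fock_integral_bound v (PI * pow K 2) Hv.
  apply: (@planar_fatou R (fun n => fockF (u n))).
  - by move=> n; apply: cont2_fockF_holo; exact: Fock_holo.
  - by move=> n p; exact: fockF_ge0.
  - move=> p; apply/cvgrPdist_lt => e /RltP e0.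
    set b := Cmod (v p); have b0 : 0 <= b := Cmod_ge_0 _.
    set x := Rtrigo_def.exp (- pow (Cmod p) 2); have x0 : 0 < x := exp_pos _.
    have m0 : 0 < e / (x * (2 * b + 1)) by apply: Rdiv_lt_0_compat => //; nra.
    (* For [d <= 1] the difference of squared moduli is at most [d * (2 b + 1)]; the tolerance
       divides [e] by this factor and by the weight [x]. *)
    have [N HN] := Hcv p (Rmin 1 (e / (x * (2 * b + 1)))) ltac:(apply: Rmin_pos => //; lra).
    exists N => // n /= /ssrnat.leP Hn.
    have h := HN n Hn.
    have h1 := Rlt_le_trans _ _ _ h (Rmin_l _ _); have h2 := Rlt_le_trans _ _ _ h (Rmin_r _ _).
    apply/RltP; rewrite -RabsE; change (Rabs (fockF v p - fockF (u n) p) < e).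
    rewrite /fockF -/b -/x; set a := Cmod (u n p).
    have a0 : 0 <= a := Cmod_ge_0 _.
    set d := Cmod (u n p - v p)%C in h h1 h2.
    have d0 : 0 <= d := Cmod_ge_0 _.
    have ab : a <= b + d by exact: Cmod_le_plus.
    have ba : b <= a + d by rewrite /d Cmod_minus_sym; exact: Cmod_le_plus.
    have -> : pow b 2 * x - pow a 2 * x = x * ((b - a) * (b + a)) by simpl; ring.
    rewrite !Rabs_mult (Rabs_pos_eq x); last lra.
    rewrite (Rabs_pos_eq (b + a)); last lra.
    have bd : Rabs (b - a) <= d by apply: Rabs_le; lra.
    have q : d * (x * (2 * b + 1)) < e.
      have aux : forall y m k : R, 0 < m -> y < k / m -> y * m < k.
        move=> y m k m1 h3; have -> : k = k / m * m by field; lra.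
        exact: Rmult_lt_compat_r.
      by apply: aux h2; nra.
    apply: Rle_lt_trans q.
    have -> : d * (x * (2 * b + 1)) = x * (d * (2 * b + 1)) by ring.
    apply: Rmult_le_compat_l; first lra.
    by apply: Rmult_le_compat => //; [exact: Rabs_pos|lra|lra].
  - move=> n; rewrite Fock_planar // lee_fin; apply/RleP.
    apply: Rmult_le_compat_l; first lra.
    by apply: pow_incr; split; [exact: fnorm_ge0|exact: HK].
move=> Fv h; split=> //.
have h2 : pow (fnorm v) 2 <= pow K 2.
  by apply: Rle_trans h _; right; field; lra.
have := fnorm_ge0 v; nra.
Qed.

(** The hypothesis compares [g] with [f] along [z -> lam z + w], weights included; the factor
    [|lam|^2] is the Jacobian of this map. *)
Lemma Fock_affine f g (lam w : C) c : holo g -> Fock f -> lam <> RtoC 0 -> 0 <= c ->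
  (forall z, pow (Cmod (g z)) 2 * Rtrigo_def.exp (- pow (Cmod z) 2) <=
    c * (pow (Cmod (f (lam * z + w)%C)) 2 * Rtrigo_def.exp (- pow (Cmod (lam * z + w)%C) 2))) ->
  Fock g /\ pow (fnorm g) 2 <= c / pow (Cmod lam) 2 * pow (fnorm f) 2.
Proof.
move=> Hg Hf lam0 c0 Hd; have pp := PI_pos.
have pl : 0 < Cmod lam by apply/Cmod_gt_0.
have pl2 : 0 < pow (Cmod lam) 2 by nra.
have cf := cont2_fockF_holo _ (Fock_holo _ Hf).
have lam2 : GRing.add (GRing.exp (lam.1 : R) 2) (GRing.exp (lam.2 : R) 2) = pow (Cmod lam) 2.
  by rewrite Cmod2_alt /Re /Im -!RpowE.
have hol : holo (fun z => f (lam * z + w)%C).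
  move=> z; case: (holo_comp_affine f w lam (Fock_holo _ Hf) z) => l Hl; exists l.
  by apply: cdiff_ext Hl => x; congr f; ring.
pose H p := fockF f (GRing.add (GRing.add (GRing.mul lam.1 p.1) (GRing.opp (GRing.mul lam.2 p.2))) w.1,
   GRing.add (GRing.add (GRing.mul lam.2 p.1) (GRing.mul lam.1 p.2)) w.2).
have HE p : H p = fockF f (lam * p + w)%C.
  by rewrite /H; congr (fockF f (_, _)); rewrite -!RplusE -?RoppE -!RmultE /=; ring.
have cH : cont2 H.
  have := @cont2_affine _ (fockF f) lam.1 (GRing.opp lam.2) w.1 lam.2 lam.1 w.2 cf.
  congr cont2; apply: functional_extensionality => p; rewrite /H; congr (fockF f (_, _)).
  by rewrite mulNr.
have nz : GRing.add (GRing.exp (lam.1 : R) 2) (GRing.exp (lam.2 : R) 2) != GRing.zero.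
  by rewrite lam2; apply/eqP; change (pow (Cmod lam) 2 <> 0); lra.
have EH : planar H = (/ pow (Cmod lam) 2 * (PI * pow (fnorm f) 2))%:E.
  have := @planar_conformal _ (fockF f) lam.1 lam.2 w.1 w.2 cf (fockF_ge0 f) nz.
  rewrite lam2 Fock_planar // -EFinM; exact.
have [] := fock_integral_bound g (c * (/ pow (Cmod lam) 2 * (PI * pow (fnorm f) 2))) Hg.
  rewrite EFinM -EH -planar_scal //; last 2 first.
  - by move=> p; exact: fockF_ge0.
  - exact/RleP.
  apply: planar_le.
  - exact: cont2_fockF_holo.
  - exact: cont2_scal.
  - exact: fockF_ge0.
  - by move=> p; apply/RleP; rewrite -RmultE HE; exact: Hd.
move=> Fg h; split=> //; apply: Rle_trans h _; right; field; lra.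
Qed.

Lemma Fock_1 : Fock (fun=> RtoC 1) /\ 0 < fnorm (fun=> RtoC 1).
Proof.
have H1 : holo (fun=> RtoC 1) by move=> z; exists (RtoC 0); exact: cdiff_const.
have E : fockF (fun=> RtoC 1) = (fun p : R * R => expR (GRing.opp (GRing.add (GRing.exp p.1 2) (GRing.exp p.2 2)))).
  apply: functional_extensionality => p; rewrite /fockF Cmod_1 pow1 Rmult_1_l -RexpE Cmod2_alt /Re /Im.
  by rewrite -!RpowE.
have := cont2_fockF_holo _ H1; rewrite E => /planar_gauss; rewrite -E => Ep.
have [F1 _] := fock_integral_bound _ _ H1 (eq_ind _ (fun x => (x <= _)%E) (lexx _) _ (esym Ep)).
split=> //.
have h : @pi R = (PI * pow (fnorm (fun=> RtoC 1)) 2)%coqR by have := Fock_planar _ F1; rewrite Ep; case.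
have /RltP : Order.lt (0%R : R) (@pi R) by exact: pi_gt0.
rewrite h => h2; have pp := PI_pos.
have := fnorm_ge0 (fun=> RtoC 1) => h3.
apply: Rnot_le_lt => h4; have h5 : fnorm (fun=> RtoC 1) = 0 by lra.
rewrite h5 /= in h2; change (0 < PI * (0 * (0 * 1))) in h2; lra.
Qed.

End FockIntegral.

Import FockIntegral.

(** * The Fock space *)

Lemma holo_plus f g : holo f -> holo g -> holo (fun z => f z + g z)%C.
Proof. by move=> Hf Hg z; case: (Hf z) (Hg z) => l Hl [m Hm]; exists (l + m)%C; exact: cdiff_plus. Qed.

Lemma holo_minus f g : holo f -> holo g -> holo (fun z => f z - g z)%C.
Proof. by move=> Hf Hg z; case: (Hf z) (Hg z) => l Hl [m Hm]; exists (l - m)%C; exact: cdiff_minus. Qed.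

Lemma holo_scal c f : holo f -> holo (fun z => c * f z)%C.
Proof. by move=> Hf z; case: (Hf z) => l Hl; exists (c * l)%C; exact: cdiff_scal. Qed.

Lemma holo_mult f g : holo f -> holo g -> holo (fun z => f z * g z)%C.
Proof. by move=> Hf Hg z; case: (Hf z) (Hg z) => l Hl [m Hm]; eexists; apply: cdiff_mult; [exact: Hl|exact: Hm]. Qed.

Lemma holo_comp f g : holo f -> holo g -> holo (fun z => f (g z)).
Proof. by move=> Hf Hg z; case: (Hg z) => m Hm; case: (Hf (g z)) => l Hl; eexists; apply: cdiff_comp; [exact: Hl|exact: Hm]. Qed.

Lemma holo_const c : holo (fun=> c).
Proof. by move=> z; exists (RtoC 0); exact: cdiff_const. Qed.

Lemma holo_id : holo (fun z => z).
Proof. by move=> z; exists (RtoC 1); exact: cdiff_id. Qed.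

Lemma Fock_scal_bound c f : Fock f ->
  Fock (fun z => c * f z)%C /\ fnorm (fun z => c * f z)%C <= Cmod c * fnorm f.
Proof.
move=> Hf; have p := pow2_ge_0 (Cmod c).
have [] := Fock_dominated (fun z => c * f z)%C f f (Cmod c ^ 2) 0 (holo_scal c f (Fock_holo _ Hf)) Hf Hf p (Rle_refl 0).
  by move=> z; rewrite Cmod_mult Rpow_mult_distr; lra.
move=> Fc h; split=> //.
have h1 := fnorm_ge0 (fun z => c * f z)%C; have h2 := fnorm_ge0 f; have h3 := Cmod_ge_0 c.
have h4 : 0 <= Cmod c * fnorm f by nra.
apply: Rnot_lt_le => h5.
have : (Cmod c * fnorm f) * (Cmod c * fnorm f) < fnorm (fun z => c * f z)%C * fnorm (fun z => c * f z)%C by nra.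
rewrite /= in h; nra.
Qed.

Lemma Fock_scal c f : Fock f -> Fock (fun z => c * f z)%C.
Proof. by move=> /(Fock_scal_bound c) []. Qed.

Lemma fnorm_scal_le c f : Fock f -> fnorm (fun z => c * f z)%C <= Cmod c * fnorm f.
Proof. by move=> /(Fock_scal_bound c) []. Qed.

Lemma Fock_plus_bound f g s : Fock f -> Fock g -> 0 < s ->
  Fock (fun z => f z + g z)%C /\
  fnorm (fun z => f z + g z)%C ^ 2 <= (1 + s) * fnorm f ^ 2 + (1 + / s) * fnorm g ^ 2.
Proof.
move=> Hf Hg Hs; have Hi : 0 < / s by apply: Rinv_0_lt_compat.
apply: Fock_dominated => //; try lra.
  by apply: holo_plus; exact: Fock_holo.
move=> z; have := Cmod_triangle (f z) (g z); have := Cmod_ge_0 (f z + g z)%C.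
have := Cmod_ge_0 (f z); have := Cmod_ge_0 (g z).
move: (Cmod (f z)) (Cmod (g z)) (Cmod (f z + g z)%C) => a b c b0 a0 c0 h.
have h1 : c ^ 2 <= (a + b) ^ 2 by apply: pow_incr.
have h2 : 0 <= / s * (s * a - b) ^ 2 by apply: Rmult_le_pos; [lra|exact: pow2_ge_0].
have h3 : / s * (s * a - b) ^ 2 = s * a ^ 2 - 2 * a * b + / s * b ^ 2 by field; lra.
simpl in *; nra.
Qed.

Lemma Fock_plus f g : Fock f -> Fock g -> Fock (fun z => f z + g z)%C.
Proof. by move=> Hf Hg; case: (Fock_plus_bound f g 1 Hf Hg Rlt_0_1). Qed.

Lemma fnorm_triangle f g : Fock f -> Fock g ->
  fnorm (fun z => f z + g z)%C <= fnorm f + fnorm g.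
Proof.
move=> Hf Hg; apply: Rnot_lt_le => Hlt.
have a0 := fnorm_ge0 f; have b0 := fnorm_ge0 g.
set a := fnorm f in Hlt a0 *; set b := fnorm g in Hlt b0 *.
set c := fnorm (fun z => f z + g z)%C in Hlt.
(* The optimal parameter in the weighted inequality would be [b / a]. Adding [e] to both keeps the
   ratio defined when a norm vanishes, and a third of the supposed excess leaves room for the two
   perturbations: [c = a + b + 3 e] against [c^2 <= (a + b + 2 e) (a + b)]. *)
pose e := (c - (a + b)) / 3.
have e0 : 0 < e by rewrite /e; lra.
have := Fock_plus_bound f g ((b + e) / (a + e)) Hf Hg ltac:(apply: Rdiv_lt_0_compat; lra).
rewrite -/a -/b -/c => -[_ h].
have h1 : (1 + (b + e) / (a + e)) * a ^ 2 <= (a + b + 2 * e) * a.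
  have -> : (1 + (b + e) / (a + e)) * a ^ 2 = (a + b + 2 * e) * a * (a / (a + e)) by field; lra.
  have q : a / (a + e) <= 1 by apply: (Rmult_le_reg_r (a + e)); [lra|rewrite /Rdiv Rmult_assoc Rinv_l; lra].
  have : 0 <= (a + b + 2 * e) * a by nra.
  nra.
have h2 : (1 + / ((b + e) / (a + e))) * b ^ 2 <= (a + b + 2 * e) * b.
  have -> : (1 + / ((b + e) / (a + e))) * b ^ 2 = (a + b + 2 * e) * b * (b / (b + e)) by field; lra.
  have q : b / (b + e) <= 1 by apply: (Rmult_le_reg_r (b + e)); [lra|rewrite /Rdiv Rmult_assoc Rinv_l; lra].
  have : 0 <= (a + b + 2 * e) * b by nra.
  nra.
have : c = a + b + 3 * e by rewrite /e; field.
move=> E; rewrite E /= in h; nra.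
Qed.

Lemma Fock_minus_bound f g : Fock f -> Fock g ->
  Fock (fun z => f z - g z)%C /\ fnorm (fun z => f z - g z)%C <= fnorm f + fnorm g.
Proof.
move=> Hf Hg.
have -> : (fun z => f z - g z)%C = (fun z => f z + (- (1)) * g z)%C.
  by apply: functional_extensionality => z; ring.
have Hm := Fock_scal (- (1))%C _ Hg.
split; first exact: Fock_plus.
apply: Rle_trans (fnorm_triangle _ _ Hf Hm) _; apply: Rplus_le_compat_l.
by have := fnorm_scal_le (- (1))%C _ Hg; rewrite Cmod_opp Cmod_1 Rmult_1_l.
Qed.

Lemma Fock_minus f g : Fock f -> Fock g -> Fock (fun z => f z - g z)%C.
Proof. by move=> Hf Hg; case: (Fock_minus_bound f g Hf Hg). Qed.

Lemma fnorm_0 : Fock (fun=> RtoC 0) /\ fnorm (fun=> RtoC 0) = 0.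
Proof.
have [F1 _] := Fock_1.
have := Fock_scal_bound (RtoC 0) _ F1.
have -> : (fun _ : C => 0 * 1)%C = (fun=> RtoC 0) by apply: functional_extensionality => z; ring.
rewrite Cmod_0 Rmult_0_l => -[h1 h2]; split=> //.
by have := fnorm_ge0 (fun=> RtoC 0); lra.
Qed.

Lemma Fock_rsum (H : R -> C -> C) K n : (0 < n)%nat ->
  (forall t, 0 <= t <= 1 -> Fock (H t)) -> (forall t, 0 <= t <= 1 -> fnorm (H t) <= K) ->
  Fock (fun z => rsum (fun t => H t z) n) /\ fnorm (fun z => rsum (fun t => H t z) n) <= K.
Proof.
move=> Hn HF HK.
have pn : 0 < INR n by apply: lt_0_INR.
have key : forall k, (k <= n)%nat -> Fock (fun z => csum (fun j => H (INR j / INR n)%R z) k) /\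
    fnorm (fun z => csum (fun j => H (INR j / INR n)%R z) k) <= INR k * K.
  elim=> [|k IH] Hk.
    by have [h1 h2] := fnorm_0; split=> //=; rewrite h2; lra.
  have [h1 h2] := IH ltac:(lia).
  have hk : 0 <= INR k / INR n <= 1.
    split; first by apply: Rmult_le_pos; [exact: pos_INR|apply: Rlt_le; exact: Rinv_0_lt_compat].
    apply: (Rmult_le_reg_r (INR n)) => //; rewrite /Rdiv Rmult_assoc Rinv_l; last lra.
    by rewrite Rmult_1_r Rmult_1_l; apply: le_INR; lia.
  split; first by apply: Fock_plus => //; exact: HF.
  apply: Rle_trans (fnorm_triangle _ _ h1 (HF _ hk)) _.
  by rewrite S_INR; have := HK _ hk; lra.
have [h1 h2] := key n (Nat.le_refl n).
have [h3 h4] := Fock_scal_bound (/ INR n)%C _ h1.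
split=> //; apply: Rle_trans h4 _.
rewrite Cmod_inv; last by apply: RtoC_nz; lra.
rewrite Cmod_R Rabs_pos_eq; last lra.
apply: (Rmult_le_reg_l (INR n)) => //; rewrite -Rmult_assoc Rinv_r; lra.
Qed.

(** Riemann sums inherit the bound by the triangle inequality, and Fatou's lemma passes it to their
    pointwise limit. Holomorphy of the integral is a hypothesis because each use knows the integral
    in closed form. *)
Lemma Fock_cint (H : R -> C -> C) K : 0 <= K ->
  (forall t, 0 <= t <= 1 -> Fock (H t)) -> (forall t, 0 <= t <= 1 -> fnorm (H t) <= K) ->
  (forall z, pcontall (fun t => H t z)) -> holo (fun z => cint (fun t => H t z)) ->
  Fock (fun z => cint (fun t => H t z)) /\ fnorm (fun z => cint (fun t => H t z)) <= K.
Proof.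
move=> K0 HF HK Hc Hh.
apply: (Fock_fatou (fun n z => rsum (fun t => H t z) (S n))) => //.
- by move=> n; case: (Fock_rsum H K (S n) ltac:(lia) HF HK).
- by move=> n; case: (Fock_rsum H K (S n) ltac:(lia) HF HK).
- move=> z e e0; have [N [_ HN]] := cint_riemann _ (Hc z) (e / 2) ltac:(lra).
  by exists N => n Hn; apply: Rle_lt_trans (HN (S n) _) _; [lia|lra].
Qed.

Lemma Fock_rotation f t : Fock f ->
  Fock (fun z => f (eU t * z)%C) /\ fnorm (fun z => f (eU t * z)%C) <= fnorm f.
Proof.
move=> Hf.
have [] := Fock_affine f (fun z => f (eU t * z)%C) (eU t) (RtoC 0) 1 _ Hf (eU_nz t) Rle_0_1.
- by apply: (holo_comp f (fun z => eU t * z)%C); [exact: Fock_holo|apply: holo_scal; exact: holo_id].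
- by move=> z; rewrite Cplus_0_r !Cmod_mult Cmod_eU !Rmult_1_l; lra.
rewrite Cmod_eU => h1 h2; split=> //.
have := fnorm_ge0 f; have := fnorm_ge0 (fun z => f (eU t * z)%C).
rewrite /= in h2; move=> h3 h4; have {h2} h2 : fnorm (fun z => f (eU t * z)%C) * fnorm (fun z => f (eU t * z)%C) <= fnorm f * fnorm f.
  by have := h2; have -> : 1 / (1 * (1 * 1)) = 1 by [field]; lra.
nra.
Qed.

Lemma exp_le_compat x y : x <= y -> exp x <= exp y.
Proof. by case=> [h|->]; [apply: Rlt_le; exact: exp_increasing|exact: Rle_refl]. Qed.

Definition norm_one : R := fnorm (fun=> RtoC 1).

Lemma norm_one_pos : 0 < norm_one.
Proof. by case: Fock_1. Qed.

(* The rotation averages of f converge to the constant f(0). *)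
Lemma Fock_eval0 f : Fock f -> Cmod (f (RtoC 0)) * norm_one <= fnorm f.
Proof.
move=> Hf; have hf := Fock_holo _ Hf.
have E : forall z, cint (fun t => f (eU t * z)%C) = f (RtoC 0).
  move=> z; have hg : holo (fun w => f (w * z)%C).
    apply: (holo_comp f (fun w => w * z)%C) => //; apply: holo_mult; [exact: holo_id|exact: holo_const].
  have := mean_value _ (RtoC 0) 1 hg Rlt_0_1; rewrite Cmult_0_l => <-.
  by apply: cint_ext => t _; congr f; ring.
have [] := Fock_cint (fun t z => f (eU t * z)%C) (fnorm f) (fnorm_ge0 f).
- by move=> t _; case: (Fock_rotation f t Hf).
- by move=> t _; case: (Fock_rotation f t Hf).
- move=> z s; apply: (pcont_ccont (fun w => f (w * z)%C) eU); first exact: pcontall_eU.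
  apply: holo_ccont; apply: (holo_comp f (fun w => w * z)%C) => //; apply: holo_mult; [exact: holo_id|exact: holo_const].
- by rewrite (functional_extensionality _ _ E); exact: holo_const.
rewrite (functional_extensionality _ _ E) => h1 h2.
case: (Ceq_dec (f (RtoC 0)) (RtoC 0)) => [->|nz].
  by rewrite Cmod_0 Rmult_0_l; exact: fnorm_ge0.
have pz : 0 < Cmod (f (RtoC 0)) by apply/Cmod_gt_0.
have [_ h3] := Fock_scal_bound (/ f (RtoC 0))%C _ h1.
have E2 : (fun _ : C => / f (RtoC 0) * f (RtoC 0))%C = (fun=> RtoC 1).
  by apply: functional_extensionality => z; field.
rewrite E2 -/norm_one Cmod_inv // in h3.
apply: Rle_trans h2; apply: (Rmult_le_reg_l (/ Cmod (f (RtoC 0)))); first exact: Rinv_0_lt_compat.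
by rewrite -Rmult_assoc Rinv_l; lra.
Qed.

(** The Weyl translation, up to its normalizing factor: [|exp (- w conj z)|^2 exp (- |w|^2)] equals
    [exp (|z|^2) exp (- |w + z|^2)]. *)
Lemma Fock_shift f z : Fock f ->
  Fock (fun w => f (w + z)%C * Cexp (- (w * Cconj z)))%C /\
  fnorm (fun w => f (w + z)%C * Cexp (- (w * Cconj z)))%C <= exp (Cmod z ^ 2 / 2) * fnorm f.
Proof.
move=> Hf.
have p := exp_pos (Cmod z ^ 2 / 2); have p2 := exp_pos (Cmod z ^ 2).
have [] := Fock_affine f (fun w => f (w + z)%C * Cexp (- (w * Cconj z)))%C (RtoC 1) z (exp (Cmod z ^ 2)) _ Hf C1_nz (Rlt_le _ _ p2).
- apply: holo_mult.
    apply: (holo_comp f (fun w => w + z)%C); first exact: Fock_holo.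
    by apply: holo_plus; [exact: holo_id|exact: holo_const].
  apply: holo_Cexp_comp.
  have := holo_scal (- (Cconj z))%C _ holo_id.
  by congr holo; apply: functional_extensionality => w; ring.
- move=> w; right; rewrite Cmod_mult Cmod_Cexp Rpow_mult_distr Cmult_1_l.
  transitivity (Cmod (f (w + z)%C) ^ 2 * (exp (Re (- (w * Cconj z))%C) ^ 2 * exp (- Cmod w ^ 2))); first by ring.
  transitivity (Cmod (f (w + z)%C) ^ 2 * (exp (Cmod z ^ 2) * exp (- Cmod (w + z)%C ^ 2))); last by ring.
  congr Rmult; rewrite /= !Rmult_1_r -!exp_plus; congr exp.
  have e1 := Cmod2_alt w; have e2 := Cmod2_alt z; have e3 := Cmod2_alt (w + z)%C.
  rewrite re_plus im_plus in e3; rewrite /= !Rmult_1_r in e1 e2 e3; rewrite e1 e2 e3.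
  by rewrite /Re /Im; ring.
rewrite Cmod_1 => h1 h2; split=> //.
set A := fnorm _ in h2 *.
have a0 : 0 <= A := fnorm_ge0 _; have b0 := fnorm_ge0 f.
have E : exp (Cmod z ^ 2) = exp (Cmod z ^ 2 / 2) * exp (Cmod z ^ 2 / 2) by rewrite -exp_plus; congr exp; field.
have h3 : A * A <= (exp (Cmod z ^ 2 / 2) * fnorm f) * (exp (Cmod z ^ 2 / 2) * fnorm f).
  have -> : (exp (Cmod z ^ 2 / 2) * fnorm f) * (exp (Cmod z ^ 2 / 2) * fnorm f) = exp (Cmod z ^ 2) / 1 ^ 2 * fnorm f ^ 2 by rewrite E; field.
  by rewrite /= in h2 *; lra.
have : 0 <= exp (Cmod z ^ 2 / 2) * fnorm f by nra.
nra.
Qed.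

(** The norm of evaluation at a point of modulus [r]. The norm of the constant 1 is kept as a
    symbol; only its positivity enters. *)
Definition eval_norm (r : R) : R := exp (r ^ 2 / 2) / norm_one.

Lemma eval_norm_pos r : 0 < eval_norm r.
Proof. by apply: Rdiv_lt_0_compat; [exact: exp_pos|exact: norm_one_pos]. Qed.

Lemma eval_norm_le x y : 0 <= x -> x <= y -> eval_norm x <= eval_norm y.
Proof.
move=> x0 xy; apply: Rmult_le_compat_r.
  by apply: Rlt_le; apply: Rinv_0_lt_compat; exact: norm_one_pos.
by apply: exp_le_compat; simpl; nra.
Qed.

(** A Weyl translation moves [z] to the origin, where the rotation averages give the estimate. *)
Theorem Fock_eval f z : Fock f -> Cmod (f z) <= eval_norm (Cmod z) * fnorm f.
Proof.
move=> Hf; have [h1 h2] := Fock_shift f z Hf; have pc := norm_one_pos.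
have := Fock_eval0 _ h1; rewrite Cplus_0_l Cmod_mult Cmod_Cexp Cmult_0_l.
have -> : Re (- 0)%C = 0 by rewrite /=; ring.
rewrite exp_0 Rmult_1_r => h3.
apply: (Rmult_le_reg_r norm_one) => //.
have -> : eval_norm (Cmod z) * fnorm f * norm_one = exp (Cmod z ^ 2 / 2) * fnorm f by rewrite /eval_norm; field; lra.
lra.
Qed.

(** The reproducing kernel at [w] is the Weyl translate by [- w] of the constant 1. *)
Lemma Fock_kernel w : Fock (fun z => Cexp (z * Cconj w))%C /\
  fnorm (fun z => Cexp (z * Cconj w))%C <= exp (Cmod w ^ 2 / 2) * norm_one.
Proof.
have [F1 _] := Fock_1.
have := Fock_shift _ (- w)%C F1.
have -> : (fun z => 1 * Cexp (- (z * Cconj (- w))))%C = (fun z => Cexp (z * Cconj w))%C.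
  apply: functional_extensionality => z; rewrite Cmult_1_l Copp_conj; congr Cexp; ring.
by rewrite Cmod_opp.
Qed.

(* z is the derivative at 0 of w |-> exp(w z), hence a Cauchy integral of kernels *)
Lemma Fock_id : Fock (fun z => z).
Proof.
have E : forall z, cint (fun t => Cexp (eU t * z) * / eU t)%C = z.
  move=> z.
  have hz : holo (fun w => Cexp (w * z)).
    by apply: holo_Cexp_comp; apply: holo_mult; [exact: holo_id|exact: holo_const].
  have hd : cdiff (fun w => Cexp (w * z)) (RtoC 0) z.
    have := cdiff_comp Cexp (fun w => w * z)%C (RtoC 0) _ _ (cdiff_Cexp (0 * z)%C) (cdiff_mult _ _ _ _ _ (cdiff_id (RtoC 0)) (cdiff_const z (RtoC 0))).
    by rewrite Cmult_0_l Cexp_0 !Cmult_1_l Cmult_0_r Cplus_0_r.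
  rewrite -[RHS](cauchy_deriv _ _ _ 1 hz hd Rlt_0_1).
  by apply: cint_ext => t _; rewrite Cplus_0_l !Cmult_1_l.
have pc := norm_one_pos.
have [] := Fock_cint (fun t z => Cexp (eU t * z) * / eU t)%C (exp (1 / 2) * norm_one).
- by have := exp_pos (1 / 2); nra.
- move=> t _; have [h _] := Fock_kernel (Cconj (eU t)).
  have := Fock_scal (/ eU t)%C _ h; congr Fock; apply: functional_extensionality => z.
  by rewrite Cconj_conj Cmult_comm; congr Cmult; congr Cexp; ring.
- move=> t _; have [h h2] := Fock_kernel (Cconj (eU t)).
  have := fnorm_scal_le (/ eU t)%C _ h; rewrite Cmod_inv; last exact: eU_nz.
  rewrite Cmod_eU Rinv_1 Rmult_1_l => h3.
  rewrite Cmod_conj Cmod_eU pow1 in h2; apply: Rle_trans h2; apply: Rle_trans h3; right.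
  congr fnorm; apply: functional_extensionality => z.
  by rewrite Cconj_conj Cmult_comm; congr Cmult; congr Cexp; ring.
- move=> z; apply: pcontall_mult.
    move=> s; apply: (pcont_ccont (fun w => Cexp (w * z))%C eU); first exact: pcontall_eU.
    by apply: holo_ccont; apply: holo_Cexp_comp; apply: holo_mult; [exact: holo_id|exact: holo_const].
  by apply: pcontall_Cinv; [exact: pcontall_eU|exact: eU_nz].
- by rewrite (functional_extensionality _ _ E); exact: holo_id.
by rewrite (functional_extensionality _ _ E).
Qed.

(** * Sectors and affine flows *)

(** In Cartesian form the sector is a convex cone given by linear inequalities, from which sums,
    dilations and openness follow by linear arithmetic. *)
Lemma sectorP th xi : 0 < th < PI / 2 ->
  (sector th xi <-> 0 < Re xi /\ Rabs (Im xi) < Re xi * tan th).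
Proof.
move=> [th0 th1]; split.
- case=> r [al [r0 [/Rabs_def2 [al1 al2] ->]]] /=.
  have ca : 0 < cos al by apply: cos_gt_0; lra.
  split; first by apply: Rmult_lt_0_compat.
  have t1 : tan al < tan th by apply: tan_increasing; lra.
  have t2 : tan (- th) < tan al by apply: tan_increasing; lra.
  rewrite tan_neg in t2.
  have sa : sin al = cos al * tan al by rewrite /tan; field; lra.
  have rc : 0 < r * cos al by apply: Rmult_lt_0_compat.
  rewrite sa; apply: Rabs_def1; nra.
- case: xi => x y /= [x0 xy].
  set u := y / x.
  have yu : y = x * u by rewrite /u; field; lra.
  have ut : Rabs u < tan th.
    apply: (Rmult_lt_reg_l x) => //.
    by rewrite -{1}(Rabs_pos_eq x); [rewrite -Rabs_mult -yu|lra].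
  have [u1 u2] := Rabs_def2 _ _ ut.
  have s0 : 0 < 1 + u²  by have := Rle_0_sqr u; lra.
  have ss : 0 < sqrt (1 + u²) by apply: sqrt_lt_R0.
  exists (x * sqrt (1 + u²)), (atan u); split; first by apply: Rmult_lt_0_compat.
  split.
    have at1 : atan (tan th) = th by apply: atan_tan; lra.
    apply: Rabs_def1.
      by rewrite -at1; exact: atan_increasing.
    by rewrite -at1 -atan_opp; apply: atan_increasing; lra.
  rewrite cos_atan sin_atan; congr pair; first by field; lra.
  by rewrite {1}yu; field; lra.
Qed.

Lemma tan_pos th : 0 < th < PI / 2 -> 0 < tan th.
Proof. by move=> H; apply: tan_gt_0; lra. Qed.

Lemma sector_real th t : 0 < th < PI / 2 -> 0 < t -> sector th (RtoC t).
Proof.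
move=> H t0; apply/sectorP => //=; rewrite Rabs_R0; split=> //.
by apply: Rmult_lt_0_compat => //; exact: tan_pos.
Qed.

Lemma sector_add th xi eta : 0 < th < PI / 2 -> sector th xi -> sector th eta -> sector th (xi + eta)%C.
Proof.
move=> H /(sectorP _ _ H) [h1 h2] /(sectorP _ _ H) [h3 h4]; apply/(sectorP _ _ H).
rewrite re_plus im_plus; split; first lra.
by have := Rabs_triang (Im xi) (Im eta); lra.
Qed.

Lemma sector_scal th xi s : 0 < th < PI / 2 -> sector th xi -> 0 < s -> sector th (s * xi)%C.
Proof.
move=> H /(sectorP _ _ H) [h1 h2] s0; apply/(sectorP _ _ H).
rewrite re_scal_l im_scal_l Rabs_mult (Rabs_pos_eq s); last lra.
by split; nra.
Qed.

(** A closed disc is provided so that circles of radius exactly [r] around [xi] can serve as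
    contours in time. *)
Lemma sector_open th xi : 0 < th < PI / 2 -> sector th xi ->
  exists r, 0 < r /\ forall h, Cmod h <= r -> sector th (xi + h)%C.
Proof.
move=> H /(sectorP _ _ H) [h1 h2].
have tp := tan_pos _ H.
pose m := Re xi * tan th - Rabs (Im xi).
have m0 : 0 < m / (2 * (1 + tan th)) by apply: Rdiv_lt_0_compat; rewrite /m; lra.
exists (Rmin (Re xi / 2) (m / (2 * (1 + tan th)))); split; first by apply: Rmin_pos; lra.
move=> h Hh; apply/(sectorP _ _ H); rewrite re_plus im_plus.
have r1 := Rle_trans _ _ _ Hh (Rmin_l _ _); have r2 := Rle_trans _ _ _ Hh (Rmin_r _ _).
have := re_le_Cmod h; have := im_le_Cmod h => i1 i2.
have i3 := Rle_abs (- Re h); rewrite Rabs_Ropp in i3.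
split; first lra.
have r3 : Cmod h * (1 + tan th) < m.
  apply: (Rle_lt_trans _ (m / (2 * (1 + tan th)) * (1 + tan th))).
    by apply: Rmult_le_compat_r; lra.
  by have -> : m / (2 * (1 + tan th)) * (1 + tan th) = m / 2 by [field; lra]; rewrite /m; lra.
have := Rabs_triang (Im xi) (Im h); rewrite /m in r3; nra.
Qed.

(* The integral of [Cexp (a * s)] for [s] from [0] to [xi]. *)
Definition drift (a xi : C) : C := if Ceq_dec a (RtoC 0) then xi else ((Cexp (a * xi) - 1) / a)%C.

Lemma drift_0l xi : drift (RtoC 0) xi = xi.
Proof. by rewrite /drift; case: Ceq_dec. Qed.

Lemma drift_nz a xi : a <> RtoC 0 -> drift a xi = ((Cexp (a * xi) - 1) / a)%C.
Proof. by rewrite /drift; case: Ceq_dec. Qed.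

Lemma drift_eq a xi : (a * drift a xi + 1)%C = Cexp (a * xi).
Proof.
case: (Ceq_dec a (RtoC 0)) => [->|H]; first by rewrite !Cmult_0_l Cexp_0; ring.
by rewrite drift_nz //; field.
Qed.

Lemma drift_0 a : drift a (RtoC 0) = RtoC 0.
Proof.
case: (Ceq_dec a (RtoC 0)) => [->|H]; first by rewrite drift_0l.
by rewrite drift_nz // Cmult_0_r Cexp_0; field.
Qed.

Lemma drift_add a xi eta : drift a (xi + eta)%C = (drift a eta + Cexp (a * eta) * drift a xi)%C.
Proof.
case: (Ceq_dec a (RtoC 0)) => [->|H]; first by rewrite !drift_0l Cmult_0_l Cexp_0; ring.
rewrite !drift_nz //; have -> : (a * (xi + eta))%C = (a * xi + a * eta)%C by ring.
by rewrite Cexp_plus; field.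
Qed.

Lemma cdiff_Cexp_lin a xi : cdiff (fun u => Cexp (a * u)) xi (a * Cexp (a * xi))%C.
Proof.
have := cdiff_comp Cexp (fun u => a * u)%C xi _ _ (cdiff_Cexp _) (cdiff_scal a _ _ _ (cdiff_id xi)).
by replace (Cexp (a * xi) * (a * 1))%C with (a * Cexp (a * xi))%C by ring.
Qed.

Lemma cdiff_drift a xi : cdiff (drift a) xi (Cexp (a * xi)).
Proof.
case: (Ceq_dec a (RtoC 0)) => H.
  rewrite H Cmult_0_l Cexp_0.
  apply: (cdiff_ext (fun u => u)); last exact: cdiff_id.
  by move=> w; rewrite drift_0l.
apply: (cdiff_ext (fun u => / a * (Cexp (a * u) - 1))%C).
  by move=> w; rewrite drift_nz // /Cdiv; ring.
have := cdiff_scal (/ a)%C _ _ _ (cdiff_minus _ _ _ _ _ (cdiff_Cexp_lin a xi) (cdiff_const (RtoC 1) xi)).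
have -> // : (/ a * (a * Cexp (a * xi) - 0))%C = Cexp (a * xi).
by move: (Cexp _) => w; field.
Qed.

(** The value at complex time [xi] of the solution of [y' = a y + b] starting from [z]. *)
Definition flow (a b xi z : C) : C := (Cexp (a * xi) * z + b * drift a xi)%C.

Lemma flow_0 a b z : flow a b (RtoC 0) z = z.
Proof. by rewrite /flow drift_0 Cmult_0_r Cexp_0; ring. Qed.

Lemma flow_add a b xi eta z : flow a b (xi + eta)%C z = flow a b eta (flow a b xi z).
Proof.
rewrite /flow drift_add; have -> : (a * (xi + eta))%C = (a * xi + a * eta)%C by ring.
by rewrite Cexp_plus; ring.
Qed.

Lemma flow_opp a b xi z : flow a b (- xi)%C (flow a b xi z) = z.
Proof. by rewrite -flow_add Cplus_opp_r flow_0. Qed.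

Lemma cdiff_flow_time a b xi z : cdiff (fun u => flow a b u z) xi (a * flow a b xi z + b)%C.
Proof.
have := cdiff_plus _ _ _ _ _ (cdiff_mult _ _ _ _ _ (cdiff_Cexp_lin a xi) (cdiff_const z xi))
  (cdiff_scal b _ _ _ (cdiff_drift a xi)).
have -> // : (a * Cexp (a * xi) * z + Cexp (a * xi) * 0 + b * Cexp (a * xi))%C = (a * flow a b xi z + b)%C.
by rewrite /flow -{3}drift_eq; ring.
Qed.

Lemma holo_flow_time a b z : holo (fun u => flow a b u z).
Proof. by move=> u; eexists; exact: cdiff_flow_time. Qed.

Lemma cdiff_flow_space a b xi z : cdiff (flow a b xi) z (Cexp (a * xi)).
Proof.
have := cdiff_plus _ _ _ _ _ (cdiff_scal (Cexp (a * xi)) _ _ _ (cdiff_id z)) (cdiff_const (b * drift a xi)%C z).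
by rewrite Cmult_1_r Cplus_0_r.
Qed.

Lemma holo_flow_space a b xi : holo (flow a b xi).
Proof. by move=> u; eexists; exact: cdiff_flow_space. Qed.

(** * The generator of an analytic semigroup *)

(** For a real increment [t] the semigroup law turns the difference quotient of [T] at [xi] into
    that of [T_t] at 0 applied to [T xi f]. The derivative in operator norm is thus the generator
    applied to [T xi f], and it also governs complex increments. *)
Lemma op_deriv th T G xi : analytic_semigroup th T -> generated_by T G -> sector th xi ->
  (forall f, Fock f -> Fock (fun z => G z * Cd (T xi f) z)%C) /\
  forall eps, 0 < eps -> exists d, 0 < d /\ forall h, h <> RtoC 0 -> Cmod h < d -> sector th (xi + h)%C ->
    forall f, Fock f ->
    fnorm (fun z => (T (xi + h)%C f z - T xi f z) / h - G z * Cd (T xi f) z)%C <= eps * fnorm f.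
Proof.
case=> Hth [Hb [Ha [Hs _]]] HG Hxi.
have [D [[HD _] Hlim]] := Ha xi Hxi.
have [HT _] := Hb xi Hxi.
have E : forall f, Fock f -> D f = (fun z => G z * Cd (T xi f) z)%C.
  move=> f Hf; apply: functional_extensionality => z.
  have [H _] := HG (T xi f) (D f) (HT f Hf) (HD f Hf).
  have p := fnorm_ge0 f.
  have [] := H _ z; last by move=> l [/is_cderivP /Cd_unique -> ->].
  move=> eps e0; have [d [d0 Hd]] := Hlim (eps / (fnorm f + 1)) ltac:(apply: Rdiv_lt_0_compat; lra).
  exists d; split=> // t [t0 td].
  have st := sector_real th t Hth t0.
  rewrite -(Hs _ _ st Hxi f Hf) Cplus_comm.
  apply: Rle_trans (Hd (RtoC t) _ _ _ f Hf) _.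
  - by apply: RtoC_nz; lra.
  - by rewrite Cmod_R Rabs_pos_eq; lra.
  - exact: sector_add.
  - have -> : eps / (fnorm f + 1) * fnorm f = eps * (fnorm f / (fnorm f + 1)) by field; lra.
    have : fnorm f / (fnorm f + 1) <= 1.
      by apply: (Rmult_le_reg_r (fnorm f + 1)); [lra|rewrite /Rdiv Rmult_assoc Rinv_l; lra].
    nra.
split; first by move=> f Hf; rewrite -E //; exact: HD.
move=> eps e0; have [d [d0 Hd]] := Hlim eps e0.
exists d; split=> // h h0 hd hs f Hf.
have := Hd h h0 hd hs f Hf; rewrite E //.
Qed.

(** The radius [d] depends neither on [f] nor on [z]. Uniformity in [z] is what later allows the
    evaluation point to move together with time. *)
Lemma op_deriv_pt th T G xi : analytic_semigroup th T -> generated_by T G -> sector th xi ->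
  forall eps, 0 < eps -> exists d, 0 < d /\ forall h, Cmod h < d -> sector th (xi + h)%C ->
    forall f z, Fock f ->
    Cmod (T (xi + h)%C f z - T xi f z - h * (G z * Cd (T xi f) z))%C <= Cmod h * (eps * (eval_norm (Cmod z) * fnorm f)).
Proof.
move=> HA HG Hxi eps e0.
have [HF Hd] := op_deriv th T G xi HA HG Hxi.
have [d [d0 Hd']] := Hd eps e0.
case: HA => Hth [Hb _].
exists d; split=> // h hd hs f z Hf.
case: (Ceq_dec h (RtoC 0)) => [->|h0].
  rewrite Cplus_0_r; replace (T xi f z - T xi f z - 0 * (G z * Cd (T xi f) z))%C with (RtoC 0) by ring.
  by rewrite Cmod_0 Rmult_0_l; exact: Rle_refl.
have [T1 _] := Hb _ Hxi; have [T2 _] := Hb _ hs.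
have F1 : Fock (fun z => (T (xi + h)%C f z - T xi f z) / h - G z * Cd (T xi f) z)%C.
  apply: (Fock_minus (fun z => (T (xi + h)%C f z - T xi f z) / h)%C); last exact: HF.
  have := Fock_scal (/ h)%C _ (Fock_minus _ _ (T2 f Hf) (T1 f Hf)).
  by congr Fock; apply: functional_extensionality => w; rewrite /Cdiv; ring.
have := Fock_eval _ z F1.
have -> : (T (xi + h) f z - T xi f z - h * (G z * Cd (T xi f) z))%C =
   (h * ((T (xi + h) f z - T xi f z) / h - G z * Cd (T xi f) z))%C by field.
rewrite Cmod_mult => h1; apply: Rmult_le_compat_l; first exact: Cmod_ge_0.
apply: Rle_trans h1 _; have := Hd' h h0 hd hs f Hf; have := eval_norm_pos (Cmod z); nra.
Qed.

Lemma orbit_pdiff th T G f t z : analytic_semigroup th T -> generated_by T G -> Fock f -> 0 < t ->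
  pdiff (fun s => T (RtoC s) f z) t (G z * Cd (T (RtoC t) f) z)%C.
Proof.
move=> HA HG Hf t0; have Hth : 0 < th < PI / 2 by case: HA.
move=> e e0; have p := eval_norm_pos (Cmod z); have q := fnorm_ge0 f.
have K0 : 0 <= eval_norm (Cmod z) * fnorm f by nra.
have [d [d0 Hd]] := op_deriv_pt th T G (RtoC t) HA HG (sector_real th t Hth t0)
  (e / (eval_norm (Cmod z) * fnorm f + 1)) ltac:(apply: Rdiv_lt_0_compat; lra).
exists (Rmin d t); split; first exact: Rmin_pos.
move=> h Hh.
have [h1 h2] := Rmin_Rgt_l _ _ _ Hh.
have [h3 h4] := Rabs_def2 _ _ h2.
have := Hd (RtoC h); rewrite Cmod_R -RtoC_plus => /(_ h1 (sector_real th (t + h) Hth ltac:(lra)) f z Hf).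
rewrite (Cmult_comm (RtoC h)) => h5; apply: Rle_trans h5 _.
have -> : e / (eval_norm (Cmod z) * fnorm f + 1) * (eval_norm (Cmod z) * fnorm f) = e * (eval_norm (Cmod z) * fnorm f / (eval_norm (Cmod z) * fnorm f + 1)) by field; lra.
have : eval_norm (Cmod z) * fnorm f / (eval_norm (Cmod z) * fnorm f + 1) <= 1.
  by apply: (Rmult_le_reg_r (eval_norm (Cmod z) * fnorm f + 1)); [lra|rewrite /Rdiv Rmult_assoc Rinv_l; lra].
move: (_ / _) => x hx; have := Rabs_pos h => hp.
rewrite Rmult_comm; apply: Rmult_le_compat_r => //; nra.
Qed.

Lemma orbit_lim th T f r : analytic_semigroup th T -> Fock f -> forall e, 0 < e ->
  exists d, 0 < d /\ forall xi, sector th xi -> Cmod xi < d -> forall z, Cmod z <= r ->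
   Cmod (T xi f z - f z)%C <= e.
Proof.
case=> Hth [Hb [_ [_ [_ [Hc _]]]]] Hf e e0.
set K := eval_norm r.
have K0 : 0 < K := eval_norm_pos r.
have [d [d0 Hd]] := Hc f Hf (e / K) ltac:(apply: Rdiv_lt_0_compat; lra).
exists d; split=> // xi Hxi xid z Hz.
have [T1 _] := Hb _ Hxi.
apply: Rle_trans (Fock_eval _ z (Fock_minus _ _ (T1 f Hf) Hf)) _.
have := Hd xi Hxi xid; have := eval_norm_le _ r (Cmod_ge_0 z) Hz; rewrite -/K.
have := fnorm_ge0 (fun z => T xi f z - f z)%C; have := eval_norm_pos (Cmod z).
move: (eval_norm (Cmod z)) (fnorm _) => x y x0 y0 xK yK.
apply: (Rle_trans _ (K * (e / K))); first by apply: Rmult_le_compat; lra.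
by right; field; lra.
Qed.

Lemma pdiff_scal c g s l : pdiff g s l -> pdiff (fun t => c * g t)%C s (c * l)%C.
Proof.
move=> H; apply: (pdiff_comp (fun z => c * z)%C g) => //.
by have := cdiff_scal c _ _ _ (cdiff_id (g s)); rewrite Cmult_1_r.
Qed.

Lemma pdiff_zero_loc g s l r : 0 < r -> pdiff g s l -> (forall t, Rabs (t - s) < r -> g t = RtoC 0) -> l = RtoC 0.
Proof.
move=> r0 Hg H0; apply: Cmod_eq0_le => e e0.
have [d [d0 Hd]] := Hg e e0.
pose h := Rmin (d / 2) (r / 2).
have m1 : h <= d / 2 := Rmin_l _ _; have m2 : h <= r / 2 := Rmin_r _ _.
have h0 : 0 < h by apply: Rmin_pos; lra.
have := Hd h; rewrite Rabs_pos_eq; last lra.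
rewrite !H0; last 2 first.
- by rewrite Rminus_diag Rabs_R0.
- by have -> : s + h - s = h by [ring]; rewrite Rabs_pos_eq; lra.
have -> : (0 - 0 - l * h)%C = (- (l * h))%C by ring.
rewrite Cmod_opp Cmod_mult Cmod_R Rabs_pos_eq; last lra.
move=> /(_ ltac:(lra)); exact: Rmult_le_reg_r.
Qed.

(** Uniqueness for the transport equation holds only while [3 K t < 1 - |z|], so it yields equality
    near 0 for short times; the identity principle then extends it to all [z]. *)
Lemma composition_small th T G : entire G -> analytic_semigroup th T -> generated_by T G ->
  exists t0, 0 < t0 /\ forall t, 0 < t < t0 -> forall f, Fock f -> forall z,
    T (RtoC t) f z = f (T (RtoC t) (fun z => z) z).
Proof.
move=> /entireP HGh HA HG.
have Hid := Fock_id.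
have [K [K0 HK]] := ccont_bounded G (fun z => holo_ccont G z HGh) 1.
(* Below this time [3 K t <= 1 / 2], which leaves the disc [|y| < 1 / 2]; the time is also below 1,
   where the local bound [M] is available. *)
have t00 : 0 < / (6 * K + 6) by apply: Rinv_0_lt_compat; lra.
have t01 : / (6 * K + 6) < 1.
  by rewrite -Rinv_1; apply: Rinv_lt_contravar; lra.
exists (/ (6 * K + 6)); split=> // t Ht f Hf z.
have HA' := HA.
case: HA' => Hth [Hb [_ [_ [_ [_ [M HM]]]]]].
have Fk : forall s g, 0 < s -> Fock g -> Fock (T (RtoC s) g).
  by move=> s g s0 Hg; case: (Hb _ (sector_real th s Hth s0)) => H _; exact: H.
pose p s := T (RtoC s) (fun z => z).
pose w s z := (T (RtoC s) f z - f (p s z))%C.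
have hp : forall s, 0 < s -> holo (p s) by move=> s s0; exact: Fock_holo (Fk s _ s0 Hid).
have hf := Fock_holo _ Hf.
have hw : forall s, 0 < s -> holo (w s).
  move=> s s0; apply: holo_minus; first exact: Fock_holo (Fk s f s0 Hf).
  by apply: (holo_comp f (p s)) => //; exact: hp.
pose Mp := Rmax M 0.
have Mp0 : 0 <= Mp := Rmax_r _ _.
have bd : forall g s z, Fock g -> 0 < s < 1 -> Cmod z <= 1 ->
    Cmod (T (RtoC s) g z) <= eval_norm 1 * (Mp * fnorm g).
  move=> g s y Hg s0 Hy; have q := fnorm_ge0 g.
  apply: Rle_trans (Fock_eval _ y (Fk s g ltac:(lra) Hg)) _.
  apply: Rmult_le_compat; [exact: Rlt_le (eval_norm_pos (Cmod y))|exact: fnorm_ge0|by apply: eval_norm_le => //; exact: Cmod_ge_0|].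
  apply: Rle_trans (HM (RtoC s) (sector_real th s Hth ltac:(lra)) _ g Hg) _.
    by rewrite Cmod_R Rabs_pos_eq; lra.
  by apply: Rmult_le_compat_r => //; exact: Rmax_l.
have [B1 [B10 HB1]] := ccont_bounded f (fun z => holo_ccont f z hf) (eval_norm 1 * (Mp * fnorm (fun z => z))).
have ec := eval_norm_pos 1.
have key : forall y, Cmod y < / 2 -> w t y = RtoC 0.
  move=> y Hy.
  apply: (transport_unique w G K (eval_norm 1 * (Mp * fnorm f) + B1) 1 K0) => //; try lra.
  - by apply: Rplus_le_le_0_compat => //; apply: Rmult_le_pos; [lra|apply: Rmult_le_pos => //; exact: fnorm_ge0].
  - by move=> s Hs; apply: hw; lra.
  - move=> s x Hs.
    have s0 : 0 < s by lra.
    have d1 := orbit_pdiff th T G f s x HA HG Hf s0.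
    have d2 := orbit_pdiff th T G (fun z => z) s x HA HG Hid s0.
    have d3 := pdiff_comp f (fun s => T (RtoC s) (fun z => z) x) s _ _ (cdiff_Cd f _ hf) d2.
    have := pdiff_minus _ _ _ _ _ d1 d3.
    have -> // : (G x * Cd (T (RtoC s) f) x - Cd f (T (RtoC s) (fun z => z) x) * (G x * Cd (T (RtoC s) (fun z => z)) x))%C =
      (G x * Cd (w s) x)%C.
    have -> : Cd (w s) x = (Cd (T (RtoC s) f) x - Cd f (p s x) * Cd (p s) x)%C.
      apply: Cd_unique; apply: cdiff_minus; first exact: cdiff_Cd (Fock_holo _ (Fk s f s0 Hf)).
      by apply: (cdiff_comp f (p s)); apply: cdiff_Cd => //; exact: hp.
    by rewrite /p; ring.
  - move=> s x Hs Hx; rewrite /w.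
    apply: Rle_trans (Cmod_triangle _ _) _; rewrite Cmod_opp.
    apply: Rplus_le_compat; first exact: bd.
    by apply: HB1; exact: bd.
  - move=> x Hx e e0.
    have [d [d0 Hd]] := holo_ccont f x hf (e / 2) ltac:(lra).
    have [d1 [d10 H1]] := orbit_lim th T f 1 HA Hf (e / 2) ltac:(lra).
    have [d2 [d20 H2]] := orbit_lim th T (fun z => z) 1 HA Hid (d / 2) ltac:(lra).
    exists (Rmin d1 d2); split; first exact: Rmin_pos.
    move=> s [s0 s1] _.
    have [h1 h2] := Rmin_Rgt_l _ _ _ s1.
    have ss := sector_real th s Hth s0.
    have j1 := H1 _ ss ltac:(rewrite Cmod_R Rabs_pos_eq; lra) x ltac:(lra).
    have j2 := H2 _ ss ltac:(rewrite Cmod_R Rabs_pos_eq; lra) x ltac:(lra).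
    have j3 := Hd (p s x - x)%C ltac:(rewrite /p; lra).
    replace (x + (p s x - x))%C with (p s x) in j3 by ring.
    have -> : w s x = ((T (RtoC s) f x - f x) + - (f (p s x) - f x))%C by rewrite /w; ring.
    by apply: Rle_trans (Cmod_triangle _ _) _; rewrite Cmod_opp; lra.
  - have : 3 * K * t <= 3 * K * / (6 * K + 6) by apply: Rmult_le_compat_l; lra.
    have : 3 * K * / (6 * K + 6) <= / 2.
      apply: (Rmult_le_reg_r (6 * K + 6)); first lra.
      by rewrite Rmult_assoc Rinv_l; lra.
    lra.
have := identity_principle (w t) (/ 2) (hw t (proj1 Ht)) ltac:(lra) key z.
by rewrite /w -/(p t) => E; apply/Ceq_minus.
Qed.

(** For [w = phi z], the image of the kernel at [w] takes the value [exp (|w|^2)] at [z], whereas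
    the norms allow only a multiple of [exp (|z|^2 / 2) exp (|w|^2 / 2)]; half of the exponent
    cancels. *)
Lemma composition_growth (S : op) (phi : C -> C) M :
  (forall f, Fock f -> Fock (S f)) -> (forall f, Fock f -> fnorm (S f) <= M * fnorm f) ->
  (forall f, Fock f -> forall z, S f z = f (phi z)) ->
  exists A, 0 <= A /\ forall z, Cmod (phi z) ^ 2 <= Cmod z ^ 2 + A.
Proof.
move=> HF HM Hphi; have pc := norm_one_pos.
pose M1 := Rmax M 1.
have M11 : 1 <= M1 := Rmax_r _ _.
have lnM : 0 <= ln M1 by rewrite -ln_1; case: M11 => [h|<-]; [apply: Rlt_le; apply: ln_increasing; lra|exact: Rle_refl].
exists (2 * ln M1); split; first lra.
move=> z; set w := phi z.
have [k1 k2] := Fock_kernel w.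
have := Fock_eval _ z (HF _ k1); rewrite /eval_norm Hphi // Cmod_Cexp -Cmod2_conj re_RtoC -/w => h1.
have h2 : fnorm (S (fun z => Cexp (z * Cconj w))%C) <= M1 * (exp (Cmod w ^ 2 / 2) * norm_one).
  apply: Rle_trans (HM _ k1) _; apply: (Rle_trans _ (M1 * fnorm (fun z => Cexp (z * Cconj w))%C)).
    by apply: Rmult_le_compat_r; [exact: fnorm_ge0|exact: Rmax_l].
  by apply: Rmult_le_compat_l; lra.
have ez := exp_pos (Cmod z ^ 2 / 2); have ew := exp_pos (Cmod w ^ 2 / 2).
have h3 : exp (Cmod w ^ 2) <= M1 * exp (Cmod z ^ 2 / 2) * exp (Cmod w ^ 2 / 2).
  apply: Rle_trans h1 _; apply: (Rle_trans _ (exp (Cmod z ^ 2 / 2) / norm_one * (M1 * (exp (Cmod w ^ 2 / 2) * norm_one)))).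
    by apply: Rmult_le_compat_l => //; apply: Rlt_le; apply: Rdiv_lt_0_compat.
  by right; field; lra.
have h4 : exp (Cmod w ^ 2 / 2) <= M1 * exp (Cmod z ^ 2 / 2).
  apply: (Rmult_le_reg_r (exp (Cmod w ^ 2 / 2))) => //.
  by rewrite -exp_plus; have -> : Cmod w ^ 2 / 2 + Cmod w ^ 2 / 2 = Cmod w ^ 2 by field.
rewrite -(exp_ln M1) -?exp_plus in h4; last lra.
have h5 : Cmod w ^ 2 / 2 <= ln M1 + Cmod z ^ 2 / 2.
  by apply: Rnot_lt_le => /exp_increasing; lra.
lra.
Qed.

(** The deviation of [T_s id] from affinity vanishes for all small [s]. Its time derivative at one
    such [t] is the same expression in [G], multiplied by the constant slope [al] of [T_t id];
    dividing by [al] makes [G] affine. *)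
Lemma generator_affine th T G : entire G -> analytic_semigroup th T -> generated_by T G ->
  exists a b, forall z, G z = (a * z + b)%C.
Proof.
move=> HGe HA HG.
have Hid := Fock_id.
have [t0 [t00 Hcomp]] := composition_small th T G HGe HA HG.
have [Hth [Hb _]] := HA.
pose p s := T (RtoC s) (fun z => z).
have Haff : forall s, 0 < s < t0 -> forall z, p s z = (p s (RtoC 0) + (p s (RtoC 1) - p s (RtoC 0)) * z)%C.
  move=> s Hs z.
  have [T1 [_ [_ [M HM]]]] := Hb _ (sector_real th s Hth (proj1 Hs)).
  have [A [A0 HAg]] := composition_growth (T (RtoC s)) (p s) M T1 HM (Hcomp s Hs).
  have Hgr : forall z, Cmod (p s z) <= (A + 1) + 1 * Cmod z.
    move=> y; have h := HAg y; have q := Cmod_ge_0 y; have q2 := Cmod_ge_0 (p s y).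
    simpl in h; nra.
  have [al Hal] := liouville_linear (p s) (A + 1) 1 (Fock_holo _ (T1 _ Hid)) ltac:(lra) ltac:(lra) Hgr.
  by rewrite (Hal z) (Hal (RtoC 1)); ring.
(* With both [T_t id] at 0 and at 1 within [1 / 4] of their initial values, the slope differs from 1
   by at most [1 / 2] and is not 0. *)
have [d1 [d10 H1]] := orbit_lim th T (fun z => z) 1 HA Hid (/ 4) ltac:(lra).
pose t := Rmin (d1 / 2) (t0 / 2).
have m1 : t <= d1 / 2 := Rmin_l _ _; have m2 : t <= t0 / 2 := Rmin_r _ _.
have tp : 0 < t by apply: Rmin_pos; lra.
have Ht : 0 < t < t0 by lra.
have st := sector_real th t Hth tp.
have j0 := H1 _ st ltac:(rewrite Cmod_R Rabs_pos_eq; lra) (RtoC 0) ltac:(rewrite Cmod_0; lra).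
have j1 := H1 _ st ltac:(rewrite Cmod_R Rabs_pos_eq; lra) (RtoC 1) ltac:(rewrite Cmod_1; lra).
set al := (p t (RtoC 1) - p t (RtoC 0))%C.
have al0 : al <> RtoC 0.
  move=> E; have := Cmod_triangle (- (p t (RtoC 1) - 1))%C (p t (RtoC 0) - 0)%C.
  rewrite Cmod_opp.
  have -> : (- (p t 1 - 1) + (p t 0 - 0))%C = (1 - al)%C by rewrite /al; ring.
  rewrite E; replace (1 - 0)%C with (RtoC 1) by ring; rewrite Cmod_1 /p; lra.
have hp : holo (p t) by case: (Hb _ st) => T1 _; exact: Fock_holo (T1 _ Hid).
have Cdp : forall z, Cd (p t) z = al.
  move=> z; apply: Cd_unique; rewrite (functional_extensionality _ _ (Haff t Ht)).
  have := cdiff_plus _ _ _ _ _ (cdiff_const (p t (RtoC 0)) z) (cdiff_scal al _ _ _ (cdiff_id z)).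
  by replace (0 + al * 1)%C with al by ring.
exists (G (RtoC 1) - G (RtoC 0))%C, (G (RtoC 0)) => z.
have dz : forall y, pdiff (fun s => p s y) t (G y * al)%C.
  by move=> y; have := orbit_pdiff th T G (fun z => z) t y HA HG Hid tp; rewrite -/(p t) Cdp.
pose g s := (p s z - p s (RtoC 0) - z * (p s (RtoC 1) - p s (RtoC 0)))%C.
have dg : pdiff g t (G z * al - G (RtoC 0) * al - z * (G (RtoC 1) * al - G (RtoC 0) * al))%C.
  apply: pdiff_minus; first by apply: pdiff_minus; exact: dz.
  by apply: pdiff_scal; apply: pdiff_minus; exact: dz.
have E := pdiff_zero_loc g t _ (Rmin t (t0 - t)) ltac:(apply: Rmin_pos; lra) dg _.
have {E} E : (G z * al - G (RtoC 0) * al - z * (G (RtoC 1) * al - G (RtoC 0) * al))%C = RtoC 0.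
  apply: E => s Hs.
  have [h1 h2] := Rmin_Rgt_l _ _ _ Hs.
  have [h3 h4] := Rabs_def2 _ _ h1; have [h5 h6] := Rabs_def2 _ _ h2.
  by rewrite /g (Haff s ltac:(lra) z); ring.
apply/Ceq_minus.
have -> : (G z - ((G 1 - G 0) * z + G 0))%C = ((G z * al - G 0 * al - z * (G 1 * al - G 0 * al)) / al)%C by field.
by rewrite E /Cdiv; ring.
Qed.

(* Along a ray of the sector, T(s xi) f evaluated on the backward flow is constant. *)
Theorem semigroup_flow th T G a b : (forall z, G z = (a * z + b)%C) ->
  analytic_semigroup th T -> generated_by T G ->
  forall xi, sector th xi -> forall f, Fock f -> forall z, T xi f z = f (flow a b xi z).
Proof.
move=> HGa HA HG xi Hxi f Hf.
suff key : forall z, T xi f (flow a b (- xi)%C z) = f z.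
  move=> z; rewrite -key; congr (T xi f _).
  by rewrite flow_opp.
move=> z.
have [Hth [Hb _]] := HA.
pose y s := flow a b (- (RtoC s * xi))%C z.
have dy : forall s, pdiff y s (- (xi * G (y s)))%C.
  move=> s.
  have h1 := pdiff_affine (RtoC 0) (- xi)%C s.
  have := pdiff_comp (fun u => flow a b u z) (fun t => 0 + t * - xi)%C s _ _ (cdiff_flow_time a b _ z) h1.
  have -> : (fun t : R => flow a b (0 + t * - xi)%C z) = y.
    by apply: functional_extensionality => t; rewrite /y; congr flow; ring.
  have -> // : ((a * flow a b (0 + s * - xi) z + b) * - xi)%C = (- (xi * G (y s)))%C.
  rewrite HGa /y; have -> : (0 + s * - xi)%C = (- (s * xi))%C by ring.
  by ring.
have cy : forall s, pcont y s by move=> s; exact: pdiff_cont (dy s).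
pose v s := T (RtoC s * xi)%C f (y s).
have dv : forall s, 0 < s -> pdiff v s (RtoC 0).
  move=> s s0 e e0.
  have ss := sector_scal th xi s Hth Hxi s0.
  have [T1 _] := Hb _ ss.
  have hU := Fock_holo _ (T1 f Hf).
  pose U := T (RtoC s * xi)%C f.
  have FD : Fock (fun z => G z * Cd U z)%C by case: (op_deriv th T G _ HA HG ss) => H _; exact: H.
  pose D z := (G z * Cd U z)%C.
  have dU := pdiff_comp U y s _ _ (cdiff_Cd U (y s) hU) (dy s).
  have px := Cmod_ge_0 xi.
  set r := Cmod (y s) + 1.
  set K := eval_norm r * fnorm f.
  have K0 : 0 <= K.
    by apply: Rmult_le_pos; [exact: Rlt_le (eval_norm_pos r)|exact: fnorm_ge0].
  set m := e / 3 / (Cmod xi * (K + 1) + 1).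
  have den : 0 < Cmod xi * (K + 1) + 1 by nra.
  have m0 : 0 < m by apply: Rdiv_lt_0_compat; lra.
  have mE : m * (Cmod xi * (K + 1) + 1) = e / 3 by rewrite /m; field; lra.
  have [d1 [d10 H1]] := op_deriv_pt th T G _ HA HG ss m m0.
  have [d2 [d20 H2]] := pcont_ccont D y s (cy s) (holo_ccont D (y s) (Fock_holo _ FD)) m m0.
  have [d3 [d30 H3]] := dU (e / 3) ltac:(lra).
  have [d4 [d40 H4]] := cy s 1 Rlt_0_1.
  exists (Rmin (Rmin d2 d3) (Rmin d4 (Rmin s (d1 / (Cmod xi + 1))))); split.
    by repeat apply: Rmin_pos => //; apply: Rdiv_lt_0_compat; lra.
  move=> h Hh.
  have [k1 k2] := Rmin_Rgt_l _ _ _ Hh.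
  have [hd2 hd3] := Rmin_Rgt_l _ _ _ k1.
  have [hd4 k3] := Rmin_Rgt_l _ _ _ k2.
  have [hs hd1] := Rmin_Rgt_l _ _ _ k3.
  have [hs1 hs2] := Rabs_def2 _ _ hs.
  have ph := Rabs_pos h.
  have hxi : Cmod (h * xi)%C < d1.
    rewrite Cmod_mult Cmod_R; apply: (Rle_lt_trans _ (Rabs h * (Cmod xi + 1))); first nra.
    have -> : d1 = d1 / (Cmod xi + 1) * (Cmod xi + 1) by field; lra.
    by apply: Rmult_lt_compat_r; lra.
  have Es : (s * xi + h * xi)%C = (RtoC (s + h)%R * xi)%C by rewrite RtoC_plus; ring.
  have ssh : sector th (s * xi + h * xi)%C by rewrite Es; apply: sector_scal => //; lra.
  have b1 := H1 (h * xi)%C hxi ssh f (y (s + h)%R) Hf.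
  have b2 := H2 h hd2. have b3 := H3 h hd3. have b4 := H4 h hd4.
  have b5 : eval_norm (Cmod (y (s + h)%R)) * fnorm f <= K.
    apply: Rmult_le_compat_r; first exact: fnorm_ge0.
    apply: eval_norm_le; first exact: Cmod_ge_0.
    have := Cmod_le_plus (y (s + h)%R) (y s); rewrite /r; lra.
  rewrite Es in b1; rewrite -/U -/(D (y (s + h)%R)) in b1.
  have E : (v (s + h)%R - v s - 0 * h)%C =
    ((T (RtoC (s + h)%R * xi)%C f (y (s + h)%R) - U (y (s + h)%R) - h * xi * D (y (s + h)%R)) +
     h * xi * (D (y (s + h)%R) - D (y s)) +
     (U (y (s + h)%R) - U (y s) - Cd U (y s) * - (xi * G (y s)) * h))%C.
    by rewrite /v -/U /D; ring.
  rewrite E.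
  apply: Rle_trans (Cmod_triangle _ _) _.
  have c1 : Cmod (T (RtoC (s + h)%R * xi)%C f (y (s + h)%R) - U (y (s + h)%R) - h * xi * D (y (s + h)%R))%C <= Rabs h * Cmod xi * (m * K).
    apply: Rle_trans b1 _; rewrite Cmod_mult Cmod_R.
    apply: Rmult_le_compat_l; first nra.
    by apply: Rmult_le_compat_l; lra.
  have c2 : Cmod (h * xi * (D (y (s + h)%R) - D (y s)))%C <= Rabs h * Cmod xi * m.
    rewrite !Cmod_mult Cmod_R; apply: Rmult_le_compat_l; first nra.
    by apply: Rlt_le; exact: b2.
  have := Cmod_triangle (T (RtoC (s + h)%R * xi)%C f (y (s + h)%R) - U (y (s + h)%R) - h * xi * D (y (s + h)%R))%C
    (h * xi * (D (y (s + h)%R) - D (y s)))%C.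
  have c4 : Rabs h * Cmod xi * (m * K) + Rabs h * Cmod xi * m <= e / 3 * Rabs h.
    rewrite -mE; have : 0 <= m * Rabs h by nra.
    nra.
  have : 0 <= e / 3 * Rabs h by nra.
  lra.
(* Constancy is known for [s > 0] only, so the value at [s = 1] is compared with small [s], where
   strong continuity and the continuity of [f] along [y] give [f z]. *)
apply/Ceq_minus; apply: Cmod_eq0_le => e e0.
have [d1 [d10 H1]] := orbit_lim th T f (Cmod z + 1) HA Hf (e / 2) ltac:(lra).
have y0 : y 0 = z by rewrite /y Cmult_0_l; replace (- 0)%C with (RtoC 0) by ring; rewrite flow_0.
have [d2 [d20 H2]] := cy 0 1 Rlt_0_1.
have cf : ccont f (y 0) := holo_ccont f _ (Fock_holo _ Hf).
have [d3 [d30 H3]] := pcont_ccont f y 0 (cy 0) cf (e / 2) ltac:(lra).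
pose s := Rmin (Rmin 1 (d2 / 2)) (Rmin (d3 / 2) (d1 / 2 / (Cmod xi + 1))).
have px := Cmod_ge_0 xi.
have s0 : 0 < s by repeat apply: Rmin_pos => //; try lra; apply: Rdiv_lt_0_compat; lra.
have q1 : s <= Rmin 1 (d2 / 2) := Rmin_l _ _.
have q2 : s <= Rmin (d3 / 2) (d1 / 2 / (Cmod xi + 1)) := Rmin_r _ _.
have s1 := Rle_trans _ _ _ q1 (Rmin_l _ _); have sd2 := Rle_trans _ _ _ q1 (Rmin_r _ _).
have sd3 := Rle_trans _ _ _ q2 (Rmin_l _ _); have sd1 := Rle_trans _ _ _ q2 (Rmin_r _ _).
have sxi : Cmod (s * xi)%C < d1.
  rewrite Cmod_mult Cmod_R Rabs_pos_eq; last lra.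
  have h : s * (Cmod xi + 1) <= d1 / 2.
    have -> : d1 / 2 = d1 / 2 / (Cmod xi + 1) * (Cmod xi + 1) by field; lra.
    by apply: Rmult_le_compat_r; lra.
  nra.
have b2 := H2 s ltac:(rewrite Rabs_pos_eq; lra); rewrite Rplus_0_l y0 in b2.
have b3 := H3 s ltac:(rewrite Rabs_pos_eq; lra); rewrite Rplus_0_l y0 in b3.
have b1 := H1 _ (sector_scal th xi s Hth Hxi s0) sxi (y s) ltac:(have := Cmod_le_plus (y s) z; lra).
have := path_mvi v (fun=> RtoC 0) (fun=> 0) (fun=> 0) s 1 s1.
have -> : v 1 = T xi f (flow a b (- xi)%C z) by rewrite /v /y Cmult_1_l.
rewrite Rminus_0_r => H.
have {H} H : Cmod (T xi f (flow a b (- xi)%C z) - v s)%C <= 0.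
  apply: H.
  - by move=> t Ht; apply: dv; lra.
  - by move=> t _; exact: is_derive_const.
  - by move=> t _; rewrite Cmod_0; exact: Rle_refl.
have -> : (T xi f (flow a b (- xi) z) - f z)%C =
  ((T xi f (flow a b (- xi) z) - v s) + ((T (s * xi)%C f (y s) - f (y s)) + (f (y s) - f z)))%C by rewrite /v; ring.
apply: Rle_trans (Cmod_triangle _ _) _.
have := Cmod_triangle (T (s * xi)%C f (y s) - f (y s))%C (f (y s) - f z)%C.
lra.
Qed.

(** Large real [z] exclude [|lam| > 1]. When [|lam| = 1], the points [z = n conj(lam) w] are sent to
    [(n + 1) w], and [(2 n + 1) |w|^2 <= A] for every [n] forces [w = 0]. *)
Lemma affine_contraction lam w A : 0 <= A ->
  (forall z, Cmod (lam * z + w)%C ^ 2 <= Cmod z ^ 2 + A) ->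
  Cmod lam <= 1 /\ (Cmod lam = 1 -> w = RtoC 0).
Proof.
move=> A0 H.
have big : forall x B, 0 < x -> exists n : nat, B < INR n * x.
  move=> x B x0; have [n Hn] := INR_unbounded (B / x).
  exists n; have -> : B = B / x * x by field; lra.
  exact: Rmult_lt_compat_r.
split.
- apply: Rnot_lt_le => Hlt.
  have pw := Cmod_ge_0 w.
  pose x := Cmod lam - 1.
  have x0 : 0 < x by rewrite /x; lra.
  have [n Hn] := big x (Cmod w + A + 1) x0.
  have pn := pos_INR n.
  have := H (RtoC (INR n)); rewrite Cmod_R Rabs_pos_eq // => h.
  have h1 : INR n * Cmod lam - Cmod w <= Cmod (lam * INR n + w)%C.
    have := Cmod_le_plus (lam * INR n)%C (lam * INR n + w)%C.
    have -> : (lam * INR n - (lam * INR n + w))%C = (- w)%C by ring.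
    by rewrite Cmod_opp Cmod_mult Cmod_R Rabs_pos_eq //; lra.
  have h2 : INR n + A + 1 <= Cmod (lam * INR n + w)%C by rewrite /x in Hn; lra.
  have : (INR n + A + 1) ^ 2 <= Cmod (lam * INR n + w)%C ^ 2 by apply: pow_incr; lra.
  simpl in *; nra.
- move=> E; apply: NNPP => nw.
  have pw : 0 < Cmod w by apply/Cmod_gt_0.
  have pw2 : 0 < Cmod w ^ 2 by nra.
  have [n Hn] := big (Cmod w ^ 2) A pw2.
  have pn := pos_INR n.
  have := H (INR n * (Cconj lam * w))%C.
  have -> : (lam * (INR n * (Cconj lam * w)) + w)%C = ((INR n + 1) * w)%C.
    have EL : (lam * Cconj lam)%C = RtoC 1 by rewrite -Cmod2_conj E pow1.
    transitivity (INR n * (lam * Cconj lam) * w + w)%C; first by ring.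
    by rewrite EL; ring.
  rewrite -RtoC_plus !Cmod_mult !Cmod_R Cmod_conj E !Rabs_pos_eq; lra.
Qed.

(** What is excluded: nonzero translations ([a = 0], [b <> 0]), which are unbounded, and nonzero [a]
    with [Re a >= 0], for which some times in any sector around the positive axis make the linear
    part expand. *)
Definition admissible (a b : C) : Prop := (a = RtoC 0 /\ b = RtoC 0) \/ Re a < 0.

Theorem semigroup_admissible th T G a b : (forall z, G z = (a * z + b)%C) ->
  analytic_semigroup th T -> generated_by T G -> admissible a b.
Proof.
move=> HGa HA HG.
have Hfl := semigroup_flow th T G a b HGa HA HG.
have [Hth [Hb _]] := HA.
have con : forall xi, sector th xi -> Re (a * xi)%C <= 0 /\ (Re (a * xi)%C = 0 -> (b * drift a xi)%C = RtoC 0).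
  move=> xi Hxi; have [T1 [_ [_ [M HM]]]] := Hb _ Hxi.
  have [A [A0 HAg]] := composition_growth (T xi) (flow a b xi) M T1 HM (Hfl xi Hxi).
  have [h1 h2] := affine_contraction (Cexp (a * xi)) (b * drift a xi)%C A A0 HAg.
  rewrite Cmod_Cexp in h1 h2; split.
    by apply: Rnot_lt_le => h3; have := exp_increasing _ _ h3; rewrite exp_0; lra.
  by move=> h3; apply: h2; rewrite h3 exp_0.
have tp := tan_pos _ Hth.
case: (Ceq_dec a (RtoC 0)) => [a0|an].
  left; split=> //.
  have [_ h] := con (RtoC 1) (sector_real th 1 Hth Rlt_0_1).
  rewrite a0 Cmult_0_l drift_0l in h; rewrite -(h _); first by ring.
  by [].
right.
(* The times [1 + i eta] and [1 - i eta] lie in the sector and give [Re a - eta Im a <= 0] and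
   [Re a + eta Im a <= 0]; [Re a >= 0] would then force [a = 0]. *)
pose eta := tan th / 2.
have s1 : sector th ((1%R, eta) : C).
  by apply/(sectorP _ _ Hth) => /=; rewrite Rabs_pos_eq /eta; lra.
have s2 : sector th ((1%R, (- eta)%R) : C).
  by apply/(sectorP _ _ Hth) => /=; rewrite Rabs_Ropp Rabs_pos_eq /eta; lra.
have [h1 _] := con _ s1; have [h2 _] := con _ s2.
rewrite !re_mult /= in h1 h2.
have e0 : 0 < eta by rewrite /eta; lra.
case: (Rlt_le_dec (Re a) 0) => // ha.
have r0 : Re a = 0 by nra.
have i0 : Im a = 0 by nra.
by case: an; apply: injective_projections.
Qed.

(** * The limsup condition *)

Lemma re_rotated s th W :
  Re ((cos (s * th), sin (s * th)) * W)%C = cos (s * th) * Re W - sin (s * th) * Im W.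
Proof. by rewrite re_mult. Qed.

(** Adding the conditions for the two signs cancels the imaginary part and leaves
    [cos th * Re (conj z G z) <= 1] for large [z], the one-sided growth bound. *)
Lemma limsup_affine G th : holo G -> 0 < th < PI / 2 -> limsup_cond G th 1 -> limsup_cond G th (-1) ->
  exists a b, forall z, G z = (a * z + b)%C.
Proof.
move=> HG Hth H1 H2.
have c0 : 0 < cos th by apply: cos_gt_0; lra.
have [r1 Hr1] := H1 1 Rlt_0_1; have [r2 Hr2] := H2 1 Rlt_0_1.
have [a Ha] := re_growth_affine G (Rmax r1 r2) (/ cos th) HG ltac:(
  move=> z Hz; have h1 := Hr1 z (Rle_lt_trans _ _ _ (Rmax_l _ _) Hz);
  have h2 := Hr2 z (Rle_lt_trans _ _ _ (Rmax_r _ _) Hz);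
  rewrite -Cmult_assoc re_rotated in h1; rewrite -Cmult_assoc re_rotated in h2;
  rewrite !Rmult_1_l in h1; replace (-1 * th) with (- th) in h2 by ring;
  rewrite cos_neg sin_neg in h2; apply: (Rmult_le_reg_l (cos th)) => //;
  rewrite Rinv_r; lra).
by exists a, (G (RtoC 0)).
Qed.

Lemma quadratic_bound p q R0 : (forall r, R0 < r -> 0 < r -> p * (r * r) + q * r <= 1) ->
  p <= 0 /\ (p = 0 -> q <= 0).
Proof.
move=> H; split.
- apply: Rnot_lt_le => p0.
  pose r := Rmax R0 0 + 1 + (Rabs q + 1) / p.
  have m1 := Rmax_l R0 0; have m2 := Rmax_r R0 0; have q0 := Rle_abs (- q); have pq := Rabs_pos q.
  rewrite Rabs_Ropp in q0.
  have d0 : 0 < (Rabs q + 1) / p by apply: Rdiv_lt_0_compat; lra.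
  have r1 : 1 < r by rewrite /r; lra.
  have pr : Rabs q + 1 < p * r.
    have -> : Rabs q + 1 = p * ((Rabs q + 1) / p) by field; lra.
    by apply: Rmult_lt_compat_l => //; rewrite /r; lra.
  have := H r ltac:(rewrite /r; lra) ltac:(lra).
  have -> : p * (r * r) + q * r = (p * r + q) * r by ring.
  nra.
- move=> p0; apply: Rnot_lt_le => q0.
  pose r := Rmax R0 0 + 1 + 1 / q.
  have m1 := Rmax_l R0 0; have m2 := Rmax_r R0 0.
  have d0 : 0 < 1 / q by apply: Rdiv_lt_0_compat; lra.
  have qr : 1 < q * r.
    have -> : 1 = q * (1 / q) by field; lra.
    have -> : q * (1 / q) = 1 by field; lra.
    have -> : q * r = q * (Rmax R0 0 + 1) + 1 by rewrite /r; field; lra.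
    nra.
  have := H r ltac:(rewrite /r; lra) ltac:(rewrite /r; lra).
  rewrite p0; lra.
Qed.

(** On a ray [z = r e] the condition bounds a quadratic polynomial in [r]: its leading coefficient
    is nonpositive, and when that vanishes so is the linear one. The leading coefficients for the
    two signs handle [a], the linear ones handle [b]. *)
Lemma limsup_admissible a b G th : (forall z, G z = (a * z + b)%C) -> 0 < th < PI / 2 ->
  limsup_cond G th 1 -> limsup_cond G th (-1) -> admissible a b.
Proof.
move=> HG Hth H1 H2.
have c0 : 0 < cos th by apply: cos_gt_0; lra.
have s0 : 0 < sin th by apply: sin_gt_0; lra.
have ray : forall s, limsup_cond G th s -> forall e, Cmod e = 1 ->
  let u := (cos (s * th), sin (s * th)) : C in
  Re (u * a)%C <= 0 /\ (Re (u * a)%C = 0 -> Re (u * (Cconj e * b))%C <= 0).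
  move=> s Hs e He u; have [r1 Hr1] := Hs 1 Rlt_0_1.
  apply: (quadratic_bound _ _ r1) => r Hr r0.
  have := Hr1 (r * e)%C ltac:(rewrite Cmod_mult He Cmod_R Rabs_pos_eq; lra).
  rewrite HG -/u; suff -> : (u * Cconj (r * e) * (a * (r * e) + b))%C = ((r * r)%R * (u * a) + r * (u * (Cconj e * b)))%C.
    by rewrite re_plus !re_scal_l; lra.
  have -> : Cconj (r * e)%C = (r * Cconj e)%C.
    by rewrite Cmult_conj; congr Cmult; apply: injective_projections => /=; ring.
  have EL : (e * Cconj e)%C = RtoC 1 by rewrite -Cmod2_conj He pow1.
  transitivity (r * r * (u * a) * (e * Cconj e) + r * (u * (Cconj e * b)))%C; first by ring.
  by rewrite EL RtoC_mult; ring.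
have [p1 _] := ray _ H1 (RtoC 1) Cmod_1; have [p2 _] := ray _ H2 (RtoC 1) Cmod_1.
rewrite !re_rotated Rmult_1_l in p1 p2.
replace (-1 * th) with (- th) in p2 by ring; rewrite cos_neg sin_neg in p2.
case: (Rlt_le_dec (Re a) 0) => ha; [by right|left].
have r0 : Re a = 0 by nra.
have i0 : Im a = 0 by nra.
have a0 : a = RtoC 0 by apply: injective_projections.
split=> //.
pose u := (cos (1 * th), sin (1 * th)) : C.
have nu : Cmod u = 1.
  by rewrite /Cmod /u /= !Rmult_1_r -/(Rsqr _) -/(Rsqr _) Rplus_comm sin2_cos2 sqrt_1.
have [k [k1 k2]] := unit_rotation b.
(* The direction is chosen so that the linear coefficient [u * conj e * b] is exactly [|b|]. *)
have [_] := ray _ H1 (u * Cconj k)%C ltac:(rewrite Cmod_mult nu Cmod_conj k1; ring).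
rewrite -/u a0 Cmult_0_r => h; have := h erefl.
have -> : (u * (Cconj (u * Cconj k) * b))%C = RtoC (Cmod b).
  rewrite Cmult_conj Cconj_conj -k2.
  have EL : (u * Cconj u)%C = RtoC 1 by rewrite -Cmod2_conj nu pow1.
  transitivity (u * Cconj u * (k * b))%C; first by ring.
  by rewrite EL; ring.
rewrite re_RtoC => hb; apply: Cmod_eq_0; have := Cmod_ge_0 b; lra.
Qed.

Lemma admissible_limsup a b G : (forall z, G z = (a * z + b)%C) -> admissible a b ->
  exists th, 0 < th < PI / 2 /\ limsup_cond G th 1 /\ limsup_cond G th (-1).
Proof.
have P := PI_RGT_0.
move=> HG [[a0 b0]|Ha].
  have G0 : forall z, G z = RtoC 0 by move=> z; rewrite HG a0 b0; ring.
  exists (PI / 4); split; first lra.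
  by split=> e e0; exists 0 => z _; rewrite G0 Cmult_0_r /=; lra.
have pI := Rabs_pos (Im a).
(* The tangent of the angle, small enough that rotation by it spends at most half of [Re a]; the
   other half absorbs the term in [b]. The [+ 1] covers real [a]. *)
pose eta := - Re a / (2 * (Rabs (Im a) + 1)).
have eta0 : 0 < eta by apply: Rdiv_lt_0_compat; lra.
have etaI : eta * Rabs (Im a) <= - Re a / 2.
  have -> : - Re a / 2 = eta * (Rabs (Im a) + 1) by rewrite /eta; field; lra.
  nra.
exists (atan eta).
have [at1 at2] := atan_bound eta.
have at0 : 0 < atan eta by rewrite -atan_0; exact: atan_increasing.
split; first lra.
have c0 : 0 < cos (atan eta) by apply: cos_gt_0; lra.
have Es : sin (atan eta) = eta * cos (atan eta).
  by have := tan_atan eta; rewrite /tan => h; rewrite -{2}h; field; lra.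
set c := cos (atan eta) in c0 Es.
have main : forall s, s = 1 \/ s = -1 -> limsup_cond G (atan eta) s.
  (* Beyond this radius [|z| |b|] is at most the remaining half [c * (- Re a / 2) * |z|^2], so the
     real part is even nonpositive. *)
  move=> s Hs e e0; exists (Cmod b / (c * (- Re a / 2))) => z Hz.
  have q0 : 0 < c * (- Re a / 2) by nra.
  have pz := Cmod_ge_0 z; have pb := Cmod_ge_0 b.
  have bz : Cmod b <= c * (- Re a / 2) * Cmod z.
    have -> : Cmod b = c * (- Re a / 2) * (Cmod b / (c * (- Re a / 2))) by field; lra.
    by apply: Rmult_le_compat_l; lra.
  set u := (cos (s * atan eta), sin (s * atan eta)) : C.
  have nu : Cmod u = 1.
    by rewrite /Cmod /u /= !Rmult_1_r -/(Rsqr _) -/(Rsqr _) Rplus_comm sin2_cos2 sqrt_1.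
  have ua : Re (u * a)%C <= c * Re a / 2.
    rewrite re_rotated.
    have h1 := Rle_abs (Im a); have h2 := Rle_abs (- Im a); rewrite Rabs_Ropp in h2.
    have h3 : c * (eta * Im a + Re a / 2) <= 0.
      have h : eta * Im a <= eta * Rabs (Im a) by apply: Rmult_le_compat_l; lra.
      nra.
    have h4 : c * (eta * - Im a + Re a / 2) <= 0.
      have h : eta * - Im a <= eta * Rabs (Im a) by apply: Rmult_le_compat_l; lra.
      nra.
    case: Hs => ->; rewrite ?Rmult_1_l; last first.
      replace (-1 * atan eta) with (- atan eta) by ring; rewrite cos_neg sin_neg -/c Es; lra.
    rewrite -/c Es; lra.
  have -> : (u * Cconj z * G z)%C = ((Cmod z ^ 2)%R * (u * a) + u * Cconj z * b)%C.
    by rewrite HG Cmod2_conj; ring.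
  rewrite re_plus re_scal_l.
  have := re_le_Cmod (u * Cconj z * b)%C; rewrite !Cmod_mult nu Cmod_conj => h.
  have h' := Rle_abs (Re (u * Cconj z * b)%C).
  have : Cmod z ^ 2 * Re (u * a)%C <= Cmod z ^ 2 * (c * Re a / 2) by apply: Rmult_le_compat_l => //; exact: pow2_ge_0.
  have : Cmod z * Cmod b <= Cmod z * (c * (- Re a / 2) * Cmod z) by apply: Rmult_le_compat_l.
  lra.
by split; apply: main; [left|right].
Qed.

(** * Semigroups of affine composition operators *)

Lemma Rle_pow2 x y : 0 <= y -> x ^ 2 <= y ^ 2 -> x <= y.
Proof. by move=> y0 H; apply: Rnot_lt_le => h; simpl in H; nra. Qed.

Lemma pdiff_linear (l : C) s : pdiff (fun t => t * l)%C s l.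
Proof. by apply: pdiff_ext (pdiff_affine (RtoC 0) l s) => t; rewrite Cplus_0_l. Qed.

Lemma pdiff_Cmod2 g s l : pdiff g s l ->
  is_derive (fun t => Cmod (g t) ^ 2) s (2 * Re (Cconj (g s) * l)%C).
Proof.
move=> H.
have h1 := pdiff_is_derive _ _ _ (RtoC 1) H.
have h2 := pdiff_is_derive _ _ _ (0%R, (-1)%R) H.
apply: (is_derive_ext (fun t => Re (1 * g t)%C * Re (1 * g t)%C + Re ((0, -1)%R * g t)%C * Re ((0, -1)%R * g t)%C)).
  move=> t; have E (w : C) : Cmod w ^ 2 = Re (1 * w)%C * Re (1 * w)%C + Re ((0, -1)%R * w)%C * Re ((0, -1)%R * w)%C.
    by rewrite -[LHS](re_RtoC (Cmod w ^ 2)) Cmod2_conj !re_mult; case: w => x y /=; ring.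
  by rewrite E.
have := is_derive_plus _ _ _ _ _ (is_derive_mult _ _ _ _ _ h1 h1 Rmult_comm) (is_derive_mult _ _ _ _ _ h2 h2 Rmult_comm).
rewrite /plus /mult /= => h.
by apply: eq_ind h _ _; ring.
Qed.

(** Along the segment from 0 to [xi] the derivative of the squared modulus is twice the real part
    bounded in the hypothesis. *)
Lemma flow_growth a b xi B z : (forall y, Re (Cconj y * (xi * (a * y + b)))%C <= B) ->
  Cmod (flow a b xi z) ^ 2 <= Cmod z ^ 2 + 2 * B.
Proof.
move=> H; pose y s := flow a b (RtoC s * xi)%C z.
have dy : forall s, pdiff y s (xi * (a * y s + b))%C.
  move=> s.
  rewrite Cmult_comm.
  exact: (pdiff_comp (fun u => flow a b u z) _ s _ _ (cdiff_flow_time a b _ z) (pdiff_linear xi s)).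
have dn : forall s, is_derive (fun t => Cmod (y t) ^ 2) s (2 * Re (Cconj (y s) * (xi * (a * y s + b)))%C).
  by move=> s; exact: pdiff_Cmod2.
have [c [_ Ec]] := MVT_gen (fun t => Cmod (y t) ^ 2) 0 1 _ (fun s _ => dn s)
  (fun s _ => proj2 (continuity_pt_filterlim _ _) (ex_derive_continuous (fun t => Cmod (y t) ^ 2) s (ex_intro _ _ (dn s)))).
have y0 : y 0 = z by rewrite /y Cmult_0_l flow_0.
have y1 : y 1 = flow a b xi z by rewrite /y Cmult_1_l.
rewrite y0 y1 in Ec; have := H (y c); lra.
Qed.

(** When [Re a < 0], a narrow sector satisfies [Re (a xi) <= - c |xi|], and completing the square
    gives [- c |y|^2 + |y| |b| <= |b|^2 / (4 c)], whence the constant. *)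
Lemma admissible_growth a b : admissible a b ->
  exists th K, 0 < th < PI / 2 /\ 0 <= K /\
  forall xi, sector th xi -> forall z, Cmod (flow a b xi z) ^ 2 <= Cmod z ^ 2 + K * Cmod xi.
Proof.
have P := PI_RGT_0.
case=> [[-> ->]|Ha].
  exists (PI / 4), 0; split; first lra; split; first exact: Rle_refl.
  move=> xi _ z; have -> : 0 * Cmod xi = 2 * 0 by ring.
  apply: flow_growth => y.
  by replace (Cconj y * (xi * (0 * y + 0)))%C with (RtoC 0) by ring; exact: Rle_refl.
have pI := Rabs_pos (Im a).
pose eta := - Re a / (2 * (Rabs (Im a) + 1)).
have eta0 : 0 < eta by apply: Rdiv_lt_0_compat; lra.
have etaI : Rabs (Im a) * eta <= - Re a / 2.
  have -> : - Re a / 2 = eta * (Rabs (Im a) + 1) by rewrite /eta; field; lra.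
  nra.
pose c := - Re a / (2 * (1 + eta)).
have c0 : 0 < c by apply: Rdiv_lt_0_compat; lra.
have Hth : 0 < atan eta < PI / 2.
  have [at1 at2] := atan_bound eta; split=> //.
  by rewrite -atan_0; exact: atan_increasing.
have pb := Cmod_ge_0 b.
exists (atan eta), (Cmod b ^ 2 / (2 * c)); split=> //.
split; first by apply: Rmult_le_pos; [exact: pow2_ge_0|apply: Rlt_le; apply: Rinv_0_lt_compat; lra].
move=> xi /(sectorP _ _ Hth) []; rewrite tan_atan => x1 x2 z.
have px := Cmod_ge_0 xi.
have ax : Re (a * xi)%C <= - c * Cmod xi.
  have h : Re (a * xi)%C <= Re xi * (Re a / 2).
    rewrite re_mult.
    have h1 : - (Im a * Im xi) <= Rabs (Im a) * Rabs (Im xi) by rewrite -Rabs_mult -Rabs_Ropp; exact: Rle_abs.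
    have h2 : Rabs (Im a) * Rabs (Im xi) <= Rabs (Im a) * (Re xi * eta) by apply: Rmult_le_compat_l; lra.
    have h3 : Re xi * (Rabs (Im a) * eta) <= Re xi * (- Re a / 2) by apply: Rmult_le_compat_l; lra.
    lra.
  have h1 : Cmod xi <= Re xi * (1 + eta).
    have := Cmod_le_abs xi; rewrite (Rabs_pos_eq (Re xi)); lra.
  have h2 : c * Cmod xi <= c * (Re xi * (1 + eta)) by apply: Rmult_le_compat_l; lra.
  have h3 : c * (Re xi * (1 + eta)) = - (Re xi * (Re a / 2)) by rewrite /c; field; lra.
  lra.
have -> : Cmod b ^ 2 / (2 * c) * Cmod xi = 2 * (Cmod xi * (Cmod b ^ 2 / (4 * c))) by field; lra.
apply: flow_growth => y.
have -> : (Cconj y * (xi * (a * y + b)))%C = ((Cmod y ^ 2)%R * (a * xi) + Cconj y * (xi * b))%C.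
  by rewrite Cmod2_conj; ring.
rewrite re_plus re_scal_l.
have h1 := re_le_Cmod (Cconj y * (xi * b))%C; rewrite !Cmod_mult Cmod_conj in h1.
have h2 := Rle_abs (Re (Cconj y * (xi * b))%C).
have h3 : Cmod y ^ 2 * Re (a * xi)%C <= Cmod y ^ 2 * (- c * Cmod xi).
  by apply: Rmult_le_compat_l => //; exact: pow2_ge_0.
suff : Cmod xi * (- c * Cmod y ^ 2 + Cmod y * Cmod b) <= Cmod xi * (Cmod b ^ 2 / (4 * c)) by lra.
apply: Rmult_le_compat_l => //.
have -> : Cmod b ^ 2 / (4 * c) = - c * Cmod y ^ 2 + Cmod y * Cmod b + (2 * c * Cmod y - Cmod b) ^ 2 / (4 * c) by field; lra.
have : 0 <= (2 * c * Cmod y - Cmod b) ^ 2 / (4 * c).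
  by apply: Rmult_le_pos; [exact: pow2_ge_0|apply: Rlt_le; apply: Rinv_0_lt_compat; lra].
lra.
Qed.

(** The growth of the flow costs [exp K] in the Gaussian weight and its Jacobian costs
    [exp (- 2 Re (a xi))]; the square root of their product is bounded by the stated exponential. *)
Lemma Fock_flow a b xi K f : (forall z, Cmod (flow a b xi z) ^ 2 <= Cmod z ^ 2 + K) -> Fock f ->
  Fock (fun z => f (flow a b xi z)) /\
  fnorm (fun z => f (flow a b xi z)) <= exp (K / 2 + Cmod (a * xi)%C) * fnorm f.
Proof.
move=> HK Hf.
have hg : holo (fun z => f (flow a b xi z)) by apply: holo_comp; [exact: Fock_holo|exact: holo_flow_space].
have Hw : forall z, Cmod (f (flow a b xi z)) ^ 2 * exp (- Cmod z ^ 2) <=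
    exp K * (Cmod (f (flow a b xi z)) ^ 2 * exp (- Cmod (flow a b xi z) ^ 2)).
  move=> z; have p := pow2_ge_0 (Cmod (f (flow a b xi z))).
  have e1 : exp (- Cmod z ^ 2) <= exp K * exp (- Cmod (flow a b xi z) ^ 2).
    by rewrite -exp_plus; apply: exp_le_compat; have := HK z; lra.
  have := Rmult_le_compat_l _ _ _ p e1; lra.
have [h1 h2] := Fock_affine f _ (Cexp (a * xi)) (b * drift a xi)%C (exp K) hg Hf (Cexp_nz _)
  (Rlt_le _ _ (exp_pos K)) Hw.
split=> //.
have n0 := fnorm_ge0 (fun z => f (flow a b xi z)); have n1 := fnorm_ge0 f.
have e0 := exp_pos (K / 2 + Cmod (a * xi)%C).
apply: Rle_pow2 => //; first by nra.
apply: Rle_trans h2 _; rewrite Rpow_mult_distr; apply: Rmult_le_compat_r; first exact: pow2_ge_0.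
rewrite Cmod_Cexp.
have ex := exp_pos (Re (a * xi)%C).
have -> : exp K / exp (Re (a * xi)%C) ^ 2 = exp (K + 2 * - Re (a * xi)%C).
  by rewrite exp_plus (_ : 2 * _ = - Re (a * xi)%C + - Re (a * xi)%C); [rewrite exp_plus exp_Ropp; field; lra|ring].
have -> : exp (K / 2 + Cmod (a * xi)%C) ^ 2 = exp (K + 2 * Cmod (a * xi)%C).
  by rewrite /= Rmult_1_r -exp_plus; congr exp; field.
have h3 := re_le_Cmod (a * xi)%C; have h4 := Rle_abs (- Re (a * xi)%C); rewrite Rabs_Ropp in h4.
by apply: exp_le_compat; lra.
Qed.

(** Scaling has given only upper bounds for norms; the exact value, in particular the lower bound
    used for strong continuity, comes from the parallelogram law with [g = f]. *)
Lemma Fock_double f : Fock f -> Fock (fun z => f z + f z)%C /\ fnorm (fun z => f z + f z)%C = 2 * fnorm f.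
Proof.
move=> Hf; split; first exact: Fock_plus.
have := parallelogram f f Hf Hf.
have -> : (fun z => f z - f z)%C = (fun=> RtoC 0) by apply: functional_extensionality => z; ring.
have [_ ->] := fnorm_0 => h.
have p := fnorm_ge0 f; have q := fnorm_ge0 (fun z => f z + f z)%C.
by apply: Rle_antisym; apply: Rle_pow2; lra.
Qed.

(** * From an exponential bound on a sector to an analytic semigroup with its generator *)

Section Sufficiency.

Variables (a b : C) (th om : R).
Hypothesis Hth : 0 < th < PI / 2.
Hypothesis om0 : 0 <= om.

Let S (xi : C) (f : C -> C) : C -> C := fun z => f (flow a b xi z).

Hypothesis HS : forall xi, sector th xi -> forall f, Fock f ->
  Fock (S xi f) /\ fnorm (S xi f) <= exp (om * Cmod xi) * fnorm f.

Lemma S_0 f : S (RtoC 0) f = f.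
Proof. by apply: functional_extensionality => z; rewrite /S flow_0. Qed.

Lemma S_add xi eta f : S (xi + eta)%C f = S xi (S eta f).
Proof. by apply: functional_extensionality => z; rewrite /S flow_add. Qed.

Lemma holo_S_time f z : holo f -> holo (fun u => S u f z).
Proof. by move=> Hf; apply: (holo_comp f (fun u => flow a b u z)) => //; exact: holo_flow_time. Qed.

Lemma holo_S_space f xi : holo f -> holo (S xi f).
Proof. by move=> Hf; apply: holo_comp => //; exact: holo_flow_space. Qed.

Lemma cdiff_S_time f xi z : holo f ->
  cdiff (fun u => S u f z) xi ((a * flow a b xi z + b) * Cd f (flow a b xi z))%C.
Proof.
move=> Hf; rewrite Cmult_comm; apply: (cdiff_comp f (fun u => flow a b u z)); first exact: cdiff_Cd.
exact: cdiff_flow_time.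
Qed.

(** If the norm of [S xi f - f] stayed above [eps] along times tending to 0, the parallelogram law
    would keep the norm of [S xi f + f] strictly below [2 fnorm f]; Fatou's lemma contradicts this,
    as these sums tend pointwise to [2 f]. *)
Lemma S_strong_continuity f : Fock f -> forall eps, 0 < eps ->
  exists d, 0 < d /\ forall xi, sector th xi -> Cmod xi < d -> fnorm (fun z => S xi f z - f z)%C <= eps.
Proof.
move=> Hf eps e0; apply: NNPP => Hno.
have nf := fnorm_ge0 f.
pose F := fnorm f ^ 2.
have F0 : 0 <= F := pow2_ge_0 _.
(* With [m F <= eps^2 / 4], squared norms growing by at most [1 + m] cost [eps^2 / 2] in the
   parallelogram law, half of the gain [eps^2]. The radius [d0] ensures
   [exp (2 om |xi|) <= 1 + m]. *)
pose m := eps ^ 2 / (4 * (F + 1)).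
have m0 : 0 < m by apply: Rdiv_lt_0_compat; [simpl; nra|lra].
have l0 : 0 < ln (1 + m) by rewrite -ln_1; apply: ln_increasing; lra.
pose d0 := ln (1 + m) / (2 * (om + 1)).
have d00 : 0 < d0 by apply: Rdiv_lt_0_compat; lra.
have Hch : forall n : nat, exists xi, sector th xi /\ Cmod xi < Rmin d0 (/ (INR n + 1)) /\
    eps < fnorm (fun z => S xi f z - f z)%C.
  move=> n; apply: NNPP => Hn; apply: Hno; exists (Rmin d0 (/ (INR n + 1))); split.
    by apply: Rmin_pos => //; apply: Rinv_0_lt_compat; have := pos_INR n; lra.
  by move=> xi h1 h2; apply: Rnot_lt_le => h3; apply: Hn; exists xi.
have [x Hx] := functional_choice _ Hch.
pose u n z := (S (x n) f z + f z)%C.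
have Fu : forall n, Fock (u n).
  by move=> n; have [h1 _] := Hx n; apply: Fock_plus => //; case: (HS _ h1 f Hf).
have bu : forall n, fnorm (u n) ^ 2 <= 4 * F - eps ^ 2 / 2.
  move=> n; have [h1 [h2 h3]] := Hx n; have [h4 h5] := HS _ h1 f Hf.
  have := parallelogram _ _ h4 Hf; rewrite -/(u n) -/F => E.
  have h6 : eps ^ 2 <= fnorm (fun z => S (x n) f z - f z)%C ^ 2 by apply: pow_incr; lra.
  have h7 : fnorm (S (x n) f) ^ 2 <= (1 + m) * F.
    apply: (Rle_trans _ ((exp (om * Cmod (x n)) * fnorm f) ^ 2)).
      by apply: pow_incr; split=> //; exact: fnorm_ge0.
    rewrite Rpow_mult_distr -/F; apply: Rmult_le_compat_r => //.
    rewrite /= Rmult_1_r -exp_plus -[1 + m]exp_ln; last lra.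
    apply: exp_le_compat.
    have k := Rlt_le_trans _ _ _ h2 (Rmin_l _ _); have kp := Cmod_ge_0 (x n).
    have -> : ln (1 + m) = 2 * ((om + 1) * d0) by rewrite /d0; field; lra.
    nra.
  have h8 : m * F <= eps ^ 2 / 4.
    have -> : eps ^ 2 / 4 = m * (F + 1) by rewrite /m; field; lra.
    nra.
  lra.
set K2 := 4 * F - eps ^ 2 / 2 in bu.
have K20 : 0 <= K2 := Rle_trans _ _ _ (pow2_ge_0 _) (bu 0%nat).
have [v1 v2] := Fock_double f Hf.
have [_] : Fock (fun z => f z + f z)%C /\ fnorm (fun z => f z + f z)%C <= sqrt K2.
  apply: (Fock_fatou u) => //; first exact: sqrt_pos.
  - by move=> n; apply: Rle_pow2; [exact: sqrt_pos|rewrite pow2_sqrt].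
  - exact: Fock_holo v1.
  - move=> z e ee0; have [d [dp Hd]] := holo_ccont _ (RtoC 0) (holo_S_time f z (Fock_holo _ Hf)) e ee0.
    have [N [HN N0]] := archimed_cor1 d dp.
    exists N => n Hn; have [_ [h2 _]] := Hx n.
    have k := Rlt_le_trans _ _ _ h2 (Rmin_r _ _).
    have ip : 0 < INR N by apply: lt_0_INR; lia.
    have h4 : / (INR n + 1) <= / INR N.
      by apply: Rinv_le_contravar => //; have := le_INR _ _ Hn; lra.
    have := Hd (x n) ltac:(lra); rewrite Cplus_0_l S_0.
    by replace (u n z - (f z + f z))%C with (S (x n) f z - f z)%C by (rewrite /u; ring).
rewrite v2 => h.
have : (2 * fnorm f) ^ 2 <= sqrt K2 ^ 2 by apply: pow_incr; lra.
rewrite pow2_sqrt // Rpow_mult_distr -/F /K2; simpl; nra.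
Qed.

(** A norm limit is identified through point evaluations. Conversely, if [g = G f'], then
    [(S_t f - f) / t - g] is the average over [s] in [[0, 1]] of [S_(s t) g - g], which strong
    continuity at [g] makes small in norm. *)
Lemma S_generator G : (forall z, G z = (a * z + b)%C) -> forall f g, Fock f -> Fock g ->
  ((forall eps : R, 0 < eps -> exists d, 0 < d /\ forall t, 0 < t < d ->
      fnorm (fun z => (S (RtoC t) f z - f z) / RtoC t - g z)%C <= eps) <->
   (forall z, exists l, is_cderiv f z l /\ g z = (G z * l)%C)).
Proof.
move=> HG f g Hf Hg; have hf := Fock_holo _ Hf; have hg := Fock_holo _ Hg.
have Fq : forall t, 0 < t -> Fock (fun z => (S (RtoC t) f z - f z) / RtoC t - g z)%C.
  move=> t t0; apply: Fock_minus => //.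
  have -> : (fun z => (S (RtoC t) f z - f z) / RtoC t)%C = (fun z => / t * (S (RtoC t) f z - f z))%C.
    by apply: functional_extensionality => z; rewrite /Cdiv; ring.
  by apply: Fock_scal; apply: Fock_minus => //; case: (HS _ (sector_real th t Hth t0) f Hf).
split.
- move=> Hlim z; exists (Cd f z); split; first by apply/is_cderivP; exact: cdiff_Cd.
  apply/Ceq_minus; apply: Cmod_eq0_le => e e0.
  set K := eval_norm (Cmod z).
  have K0 : 0 < K := eval_norm_pos _.
  have [d1 [d10 H1]] := Hlim (e / 2 / K) ltac:(apply: Rdiv_lt_0_compat; lra).
  have [d2 [d20 H2]] := cdiff_S_time f (RtoC 0) z hf (e / 2) ltac:(lra).
  pose t := Rmin (d1 / 2) (d2 / 2).
  have m1 : t <= d1 / 2 := Rmin_l _ _; have m2 : t <= d2 / 2 := Rmin_r _ _.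
  have t0 : 0 < t by apply: Rmin_pos; lra.
  have b1 : Cmod ((S (RtoC t) f z - f z) / RtoC t - g z)%C <= e / 2.
    apply: Rle_trans (Fock_eval _ z (Fq t t0)) _; rewrite -/K.
    have -> : e / 2 = K * (e / 2 / K) by field; lra.
    by apply: Rmult_le_compat_l; [lra|apply: H1; lra].
  have := H2 (RtoC t); rewrite Cplus_0_l S_0 flow_0 Cmod_R Rabs_pos_eq; last lra.
  move=> /(_ ltac:(lra)) b2.
  have tn := RtoC_nz t ltac:(lra).
  have b3 : Cmod ((S (RtoC t) f z - f z) / RtoC t - G z * Cd f z)%C <= e / 2.
    have -> : ((S (RtoC t) f z - f z) / RtoC t - G z * Cd f z)%C =
       ((S (RtoC t) f z - f z - (a * z + b) * Cd f z * t) / t)%C by rewrite HG; field.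
    rewrite Cmod_div // Cmod_R Rabs_pos_eq; last lra.
    by apply: (Rmult_le_reg_r t) => //; rewrite /Rdiv Rmult_assoc Rinv_l ?Rmult_1_r; lra.
  have -> : (g z - G z * Cd f z)%C = (((S (RtoC t) f z - f z) / RtoC t - G z * Cd f z) - ((S (RtoC t) f z - f z) / RtoC t - g z))%C by ring.
  apply: Rle_trans (Cmod_triangle _ _) _; rewrite Cmod_opp; lra.
- move=> Hd eps e0.
  have Eg : forall z, g z = ((a * z + b) * Cd f z)%C.
    by move=> z; have [l [/is_cderivP h1 ->]] := Hd z; rewrite HG (Cd_unique _ _ _ h1).
  have [d [d0 H]] := S_strong_continuity g Hg eps e0.
  exists d; split=> // t [t0 t1].
  have tn := RtoC_nz t ltac:(lra).
  pose H1 (s : R) z := (S (RtoC s * t)%C g z - g z)%C.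
  have pc : forall z, pcontall (fun s => H1 s z).
    move=> z; apply: pcontall_plus; last exact: pcontall_const.
    move=> s; apply: (pcont_ccont (fun u => S u g z)); last by apply: holo_ccont; exact: holo_S_time.
    exact: pdiff_cont (pdiff_linear t s).
  have E : (fun z => cint (fun s => H1 s z)) = (fun z => (S (RtoC t) f z - f z) / RtoC t - g z)%C.
    apply: functional_extensionality => z.
    rewrite (cint_ftc (fun s => / t * S (RtoC s * t)%C f z - s * g z)%C) //.
      rewrite Cmult_1_l !Cmult_0_l S_0; by field.
    move=> s; apply: pdiff_minus; last exact: pdiff_linear.
    have := pdiff_scal (/ t)%C _ _ _ (pdiff_comp (fun u => S u f z) _ _ _ _ (cdiff_S_time f _ z hf) (pdiff_linear t s)).
    have -> // : (/ t * ((a * flow a b (s * t) z + b) * Cd f (flow a b (s * t) z) * t))%C = S (s * t)%C g z.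
    by rewrite /S Eg; field.
  have HH : forall s, 0 <= s <= 1 -> Fock (H1 s) /\ fnorm (H1 s) <= eps.
    move=> s [[s0|<-] s1].
      have ss : sector th (RtoC s * t)%C by rewrite -RtoC_mult; apply: sector_real => //; nra.
      split; first by apply: Fock_minus => //; case: (HS _ ss g Hg).
      apply: H => //; rewrite Cmod_mult !Cmod_R !Rabs_pos_eq; nra.
    (* The time 0 is outside the open sector, so the endpoint [s = 0] is treated apart. *)
    have -> : H1 0 = (fun=> RtoC 0).
      by apply: functional_extensionality => z; rewrite /H1 Cmult_0_l S_0; ring.
    by have [h1 ->] := fnorm_0; split=> //; lra.
  have := Fock_cint H1 eps (Rlt_le _ _ e0) (fun s Hs => proj1 (HH s Hs)) (fun s Hs => proj2 (HH s Hs)) pc.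
  rewrite E => /(_ (Fock_holo _ (Fq t t0))) [_ ].
  by [].
Qed.

(** The candidate for the operator-norm derivative of [S] at [xi]: the generator applied to [f],
    then composed with the flow. *)
Definition dS (xi : C) (f : C -> C) : C -> C :=
  fun z => ((a * flow a b xi z + b) * Cd f (flow a b xi z))%C.

Lemma holo_dS xi f : holo f -> holo (dS xi f).
Proof.
move=> hf; apply: holo_mult.
  by apply: holo_plus; [apply: holo_scal; exact: holo_flow_space|exact: holo_const].
by apply: (holo_comp (Cd f)); [exact: holo_Cd|exact: holo_flow_space].
Qed.

Lemma S_bound xi r f w : 0 < r -> (forall h, Cmod h <= r -> sector th (xi + h)%C) -> Fock f ->
  Cmod w <= r -> Fock (S (xi + w)%C f) /\ fnorm (S (xi + w)%C f) <= exp (om * (Cmod xi + r)) * fnorm f.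
Proof.
move=> r0 Hr Hf Hw; have [h1 h2] := HS _ (Hr w Hw) f Hf; split=> //.
apply: Rle_trans h2 _; apply: Rmult_le_compat_r; first exact: fnorm_ge0.
apply: exp_le_compat; apply: Rmult_le_compat_l => //.
by have := Cmod_triangle xi w; lra.
Qed.

Lemma cdiff_S_shift f xi z : holo f -> cdiff (fun h => S (xi + h)%C f z) (RtoC 0) (dS xi f z).
Proof.
by move=> hf; apply: (cdiff_shift (fun u => S u f z)); rewrite Cplus_0_r; exact: cdiff_S_time.
Qed.

Lemma holo_S_shift f xi z : holo f -> holo (fun h => S (xi + h)%C f z).
Proof.
move=> hf h; eexists; apply: (cdiff_shift (fun u => S u f z)); exact: cdiff_S_time.
Qed.

(** A Cauchy estimate in the time variable: [dS xi f] is the average over a circle of radius [r] of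
    the functions [S (xi + w) f / w], whose norms are uniformly bounded. *)
Lemma dS_bound xi r f : 0 < r -> (forall h, Cmod h <= r -> sector th (xi + h)%C) -> Fock f ->
  Fock (dS xi f) /\ fnorm (dS xi f) <= exp (om * (Cmod xi + r)) / r * fnorm f.
Proof.
move=> r0 Hr Hf; have hf := Fock_holo _ Hf; have nf := fnorm_ge0 f.
have ex := exp_pos (om * (Cmod xi + r)).
pose H t z := (S (xi + r * eU t)%C f z / (r * eU t))%C.
have E : (fun z => cint (fun t => H t z)) = dS xi f.
  apply: functional_extensionality => z.
  have <- := cauchy_deriv _ _ _ r (holo_S_shift f xi z hf) (cdiff_S_shift f xi z hf) r0.
  by apply: cint_ext => t _; rewrite Cplus_0_l.
have HH : forall t, Fock (H t) /\ fnorm (H t) <= exp (om * (Cmod xi + r)) / r * fnorm f.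
  move=> t; have [h1 h2] := S_bound xi r f (r * eU t)%C r0 Hr Hf ltac:(rewrite Cmod_circ; lra).
  have -> : H t = (fun z => / (r * eU t) * S (xi + r * eU t)%C f z)%C.
    by apply: functional_extensionality => z; rewrite /H /Cdiv; ring.
  have [h3 h4] := Fock_scal_bound (/ (r * eU t))%C _ h1; split=> //.
  apply: Rle_trans h4 _; rewrite Cmod_inv ?Cmod_circ //; last exact: circle_nz.
  have -> : exp (om * (Cmod xi + r)) / r * fnorm f = / r * (exp (om * (Cmod xi + r)) * fnorm f) by field; lra.
  by apply: Rmult_le_compat_l => //; apply: Rlt_le; exact: Rinv_0_lt_compat.
have := Fock_cint H (exp (om * (Cmod xi + r)) / r * fnorm f) _ (fun t _ => proj1 (HH t)) (fun t _ => proj2 (HH t)).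
rewrite E; apply.
- by apply: Rmult_le_pos => //; apply: Rlt_le; exact: Rdiv_lt_0_compat.
- move=> z; have := pcontall_cauchy (fun h => S (xi + h)%C f z) (RtoC 0) r (fun w => holo_ccont _ w (holo_S_shift f xi z hf)) r0.
  suff -> : H^~ z = (fun t => S (xi + (0 + r * eU t))%C f z / (r * eU t))%C by [].
  by apply: functional_extensionality => t; rewrite Cplus_0_l.
- exact: holo_dS.
Qed.

(* With q2 the second divided difference at 0 of h |-> S (xi + h) f z, the remainder is h * q2 h, and
   q2 h is the average of q2 over the circle of radius r / 2 around h, which stays away from 0. *)
Lemma S_remainder xi r f h : 0 < r -> (forall h, Cmod h <= r -> sector th (xi + h)%C) -> Fock f ->
  h <> RtoC 0 -> Cmod h <= r / 4 ->
  fnorm (fun z => (S (xi + h)%C f z - S xi f z) / h - dS xi f z)%C <=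
    Cmod h * (48 * exp (om * (Cmod xi + r)) / r ^ 2) * fnorm f.
Proof.
move=> r0 Hr Hf hn hr; have hf := Fock_holo _ Hf; have nf := fnorm_ge0 f.
set M := exp (om * (Cmod xi + r)); have M0 : 0 < M := exp_pos _.
pose w t := (h + (r / 2)%R * eU t)%C.
have cw t : Cmod ((r / 2)%R * eU t)%C = r / 2 by apply: Cmod_circ; lra.
have w1 t : Cmod (w t) <= r by have := Cmod_triangle h ((r / 2)%R * eU t)%C; rewrite cw /w; lra.
have w2 t : r / 4 <= Cmod (w t).
  have := Cmod_le_plus ((r / 2)%R * eU t)%C (w t); rewrite cw /w.
  have -> : ((r / 2)%R * eU t - (h + (r / 2)%R * eU t))%C = (- h)%C by ring.
  by rewrite Cmod_opp; lra.
have wn t : w t <> RtoC 0 by apply/Cmod_gt_0; have := w2 t; lra.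
pose P u z := (/ (u * u) * (S (xi + u)%C f z - S xi f z - u * dS xi f z))%C.
have sl : forall z, exists q, holo q /\ forall u, u <> RtoC 0 -> P u z = q u.
  move=> z.
  have [q1 [hq1 E1]] := holo_slope _ (RtoC 0) (holo_S_shift f xi z hf).
  have [q2 [hq2 E2]] := holo_slope _ (RtoC 0) hq1.
  have q10 : q1 (RtoC 0) = dS xi f z.
    apply: (cdiff_unique (fun h => S (xi + h)%C f z) (RtoC 0)); last exact: cdiff_S_shift.
    by apply/cdiff_slope; exists q1; split; last by split; [|exact: holo_ccont].
  exists q2; split=> // u un; rewrite /P E1 E2 q10 Cplus_0_r; by field.
have EP : (fun z => cint (fun t => P (w t) z)) = P h.
  apply: functional_extensionality => z; have [q [hq Eq]] := sl z.
  rewrite Eq // -(mean_value q h (r / 2) hq); last lra.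
  by apply: cint_ext => t _; rewrite Eq.
have pcP : forall z, pcontall (fun t => P (w t) z).
  move=> z; have [q [hq Eq]] := sl z.
  have -> : (fun t => P (w t) z) = (fun t => q (w t)) by apply: functional_extensionality => t; rewrite Eq.
  by apply: pcontall_on_circle => u; exact: holo_ccont.
have hP : holo (P h).
  apply: holo_scal; apply: holo_minus; last by apply: holo_scal; exact: holo_dS.
  by apply: holo_minus; exact: holo_S_space.
have HH : forall t, Fock (P (w t)) /\ fnorm (P (w t)) <= 48 * M / r ^ 2 * fnorm f.
  move=> t.
  have [h1 h2] := S_bound xi r f (w t) r0 Hr Hf (w1 t).
  have [h3 h4] := S_bound xi r f (RtoC 0) r0 Hr Hf ltac:(rewrite Cmod_0; lra).
  rewrite Cplus_0_r in h3 h4.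
  have [h5 h6] := dS_bound xi r f r0 Hr Hf.
  have [h7 h8] := Fock_scal_bound (w t) _ h5.
  have [h9 h10] := Fock_minus_bound _ _ h1 h3.
  have [h11 h12] := Fock_minus_bound _ _ h9 h7.
  have [h13 h14] := Fock_scal_bound (/ (w t * w t))%C _ h11.
  split=> //; apply: Rle_trans h14 _.
  rewrite Cmod_inv ?Cmod_mult; last by apply: Cmult_neq_0.
  rewrite -/M in h2 h4 h6.
  have h16 : Cmod (w t) * fnorm (dS xi f) <= r * (M / r * fnorm f).
    by apply: Rmult_le_compat => //; [exact: Cmod_ge_0|exact: fnorm_ge0].
  have h15 : r * (M / r * fnorm f) = M * fnorm f by field; lra.
  (* The constant is [16 * 3]: [|w t| >= r / 4] gives [16 / r^2], and each of the three terms of the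
     remainder has norm at most [M * fnorm f]. *)
  have -> : 48 * M / r ^ 2 * fnorm f = / (r / 4 * (r / 4)) * (3 * (M * fnorm f)) by field; lra.
  have rr : 0 < r / 4 * (r / 4) by apply: Rmult_lt_0_compat; lra.
  have ww : r / 4 * (r / 4) <= Cmod (w t) * Cmod (w t) by apply: Rmult_le_compat; try lra; exact: w2.
  apply: Rmult_le_compat; [apply: Rlt_le; apply: Rinv_0_lt_compat; lra|exact: fnorm_ge0|exact: Rinv_le_contravar|lra].
have K0 : 0 <= 48 * M / r ^ 2 * fnorm f.
  by apply: Rmult_le_pos => //; apply: Rlt_le; apply: Rdiv_lt_0_compat; [lra|simpl; nra].
have := Fock_cint (fun t => P (w t)) _ K0 (fun t _ => proj1 (HH t)) (fun t _ => proj2 (HH t)) pcP.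
rewrite EP => /(_ hP) [FP nP].
have -> : (fun z => (S (xi + h)%C f z - S xi f z) / h - dS xi f z)%C = (fun z => h * P h z)%C.
  by apply: functional_extensionality => z; rewrite /P; field.
apply: Rle_trans (fnorm_scal_le _ _ FP) _.
by rewrite Rmult_assoc; apply: Rmult_le_compat_l => //; exact: Cmod_ge_0.
Qed.

Lemma S_bounded xi : sector th xi -> bounded_op (S xi).
Proof.
move=> Hxi; split; first by move=> f Hf; case: (HS _ Hxi f Hf).
split; first by [].
split; first by [].
by exists (exp (om * Cmod xi)) => f Hf; case: (HS _ Hxi f Hf).
Qed.

Theorem S_semigroup : analytic_semigroup th S.
Proof.
split=> //; split; first exact: S_bounded.
split; last first.
  split; first by move=> xi eta _ _ f _; exact: S_add.
  split; first by move=> f _; exact: S_0.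
  split; first exact: S_strong_continuity.
  exists (exp om) => xi Hxi x1 f Hf; have [_ h] := HS _ Hxi f Hf.
  apply: Rle_trans h _; apply: Rmult_le_compat_r; first exact: fnorm_ge0.
  by apply: exp_le_compat; nra.
move=> xi Hxi; have [r [r0 Hr]] := sector_open th xi Hth Hxi.
exists (dS xi); split.
  split; first by move=> f Hf; case: (dS_bound xi r f r0 Hr Hf).
  split.
    move=> f g Hf Hg; apply: functional_extensionality => z; rewrite /dS.
    have -> : Cd (fun z => f z + g z)%C (flow a b xi z) = (Cd f (flow a b xi z) + Cd g (flow a b xi z))%C.
      by apply: Cd_unique; apply: cdiff_plus; apply: cdiff_Cd; exact: Fock_holo.
    by ring.
  split.
    move=> c f Hf; apply: functional_extensionality => z; rewrite /dS.
    have -> : Cd (fun z => c * f z)%C (flow a b xi z) = (c * Cd f (flow a b xi z))%C.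
      by apply: Cd_unique; apply: cdiff_scal; apply: cdiff_Cd; exact: Fock_holo.
    by ring.
  by exists (exp (om * (Cmod xi + r)) / r) => f Hf; case: (dS_bound xi r f r0 Hr Hf).
move=> eps e0; set M := 48 * exp (om * (Cmod xi + r)) / r ^ 2.
have M0 : 0 < M.
  by have := exp_pos (om * (Cmod xi + r)) => h; apply: Rdiv_lt_0_compat; [lra|simpl; nra].
exists (Rmin (r / 4) (eps / M)); split; first by apply: Rmin_pos; [lra|exact: Rdiv_lt_0_compat].
move=> h hn hd _ f Hf.
have [k1 k2] := Rmin_Rgt_l _ _ _ hd.
apply: Rle_trans (S_remainder xi r f h r0 Hr Hf hn (Rlt_le _ _ k1)) _; rewrite -/M.
apply: Rmult_le_compat_r; first exact: fnorm_ge0.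
have -> : eps = eps / M * M by field; lra.
by apply: Rmult_le_compat_r; lra.
Qed.

End Sufficiency.

Lemma admissible_bound a b : admissible a b -> exists th om, 0 < th < PI / 2 /\ 0 <= om /\
  forall xi, sector th xi -> forall f, Fock f -> Fock (fun z => f (flow a b xi z)) /\
    fnorm (fun z => f (flow a b xi z)) <= exp (om * Cmod xi) * fnorm f.
Proof.
move=> Hab; have [th [K [Hth [K0 HK]]]] := admissible_growth a b Hab.
exists th, (K / 2 + Cmod a); split=> //.
split; first by have := Cmod_ge_0 a; lra.
move=> xi Hxi f Hf; have := Fock_flow a b xi _ f (HK xi Hxi) Hf.
by have -> : K * Cmod xi / 2 + Cmod (a * xi)%C = (K / 2 + Cmod a) * Cmod xi by rewrite Cmod_mult; field.
Qed.

Theorem theorem2p10 (G : C -> C) : entire G ->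
  ((exists (theta0 : R) (T : C -> op),
       analytic_semigroup theta0 T /\ generated_by T G)
   <->
   (exists theta : R, (0 < theta < PI / 2)%R /\
       limsup_cond G theta 1 /\ limsup_cond G theta (-1)))
  /\
  (forall (theta0 : R) (T : C -> op),
     analytic_semigroup theta0 T -> generated_by T G ->
     composition_semigroup theta0 T /\ quasicontractive T).
Proof.
move=> HG; split; first split.
- move=> [th [T [HA HT]]].
  have [a [b Hab]] := generator_affine th T G HG HA HT.
  exact: admissible_limsup Hab (semigroup_admissible th T G a b Hab HA HT).
- move=> [th [Hth [H1 H2]]].
  have [a [b Hab]] := limsup_affine G th (proj1 (entireP G) HG) Hth H1 H2.
  have [th' [om [Hth' [om0 HS]]]] := admissible_bound a b (limsup_admissible a b G th Hab Hth H1 H2).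
  exists th', (fun xi f z => f (flow a b xi z)); split.
    exact: S_semigroup Hth' om0 HS.
  exact: S_generator Hth' om0 HS G Hab.
move=> th T HA HT.
have [a [b Hab]] := generator_affine th T G HG HA HT.
have Hflow := semigroup_flow th T G a b Hab HA HT.
have [Hth [_ [_ [_ [T0 _]]]]] := HA.
split.
- move=> xi [->|Hxi].
    exists (fun z => z); split; first by apply/entireP; exact: holo_id.
    by move=> f Hf; rewrite T0.
  exists (flow a b xi); split; first by apply/entireP; exact: holo_flow_space.
  by move=> f Hf; apply: functional_extensionality => z; exact: Hflow.
(* The angle [th'] may differ from [th]; positive real times belong to both sectors, and there [T]
   is composition with the flow. *)
- have [th' [om [Hth' [om0 HS]]]] := admissible_bound a b (semigroup_admissible th T G a b Hab HA HT).
  exists om => t [t0|<-] f Hf; last first.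
    by rewrite T0 // Rmult_0_r exp_0 Rmult_1_l; exact: Rle_refl.
  have -> : T (RtoC t) f = (fun z => f (flow a b (RtoC t) z)).
    by apply: functional_extensionality => z; apply: Hflow => //; exact: sector_real.
  have [_ h] := HS _ (sector_real th' t Hth' t0) f Hf.
  by rewrite Cmod_R Rabs_pos_eq in h; last exact: Rlt_le.
Qed.
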